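(* Let $N\ge 2$, $\beta>0$, let $N_a,\tilde N_a$ ($1\le a\le N-1$) be nonnegative integers, let $\alpha_1,\alpha_2,\alpha_3$ be vectors in the space spanned by the simple roots $e_1,\dots,e_{N-1}$ of $A_{N-1}$, and let $\alpha_4$ be determined by $$\alpha_1+\alpha_2+\alpha_3+\alpha_4+\beta\sum_{a=1}^{N-1}(N_a+\tilde N_a)e_a+2(1-\beta)\rho=0 .$$ Set $$v_{a+}=(\alpha_2,e_a),\quad v_{a-}=(\alpha_3,e_a),\quad u_{a+}=(\alpha_1,e_a),\quad u_{a-}=(\alpha_4,e_a)\qquad(1\le a\le N-1),$$ so that $u_{a+}+u_{a-}+v_{a+}+v_{a-}+\beta\sum_b C_{ab}(N_b+\tilde N_b)=2\beta-2$ with $C$ the $A_{N-1}$ Cartan matrix, and for $1\le a\le N$ set $$v'_{a+}=\sum_{s=a}^{N-1}v_{s+}\ \ (\text{so } v'_{N+}=0),\qquad v'_{a-}=-\sum_{s=1}^{a-1}v_{s-}\ \ (\text{so } v'_{1-}=0).$$ Then, up to a $U(1)$ factor, the Dotsenko–Fateev integral $$Z_{\rm DF}(q)=q^{(\alpha_1,\alpha_2)/\beta}(1-q)^{(\alpha_2,\alpha_3)/\beta}\prod_{a=1}^{N-1}\prod_{I=1}^{N_a}\int_0^q dz^{(a)}_I\prod_{J=N_a+1}^{N_a+\tilde N_a}\int_1^\infty dz^{(a)}_J\ \prod_{a=1}^{N-1}\prod_{i<j}^{N_a+\tilde N_a}(z^{(a)}_j-z^{(a)}_i)^{2\beta}$$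 $$\times\prod_{a=1}^{N-1}\prod_{i=1}^{N_a+\tilde N_a}(z^{(a)}_i)^{(\alpha_1,e_a)}(z^{(a)}_i-q)^{(\alpha_2,e_a)}(z^{(a)}_i-1)^{(\alpha_3,e_a)}\prod_{a=1}^{N-2}\prod_{i=1}^{N_a+\tilde N_a}\prod_{j=1}^{N_{a+1}+\tilde N_{a+1}}(z^{(a+1)}_j-z^{(a)}_i)^{-\beta}$$ equals $$\sum_{\vec Y}q^{|\vec Y|}\Big\langle\prod_{a=1}^{N}j^{(\beta)}_{Y_a}\Big(-r^{(a)}_k-\frac{v'_{a+}}{\beta}\Big)\Big\rangle_+\Big\langle\prod_{a=1}^{N}j^{(\beta)}_{Y_a}\Big(\tilde r^{(a)}_k+\frac{v'_{a-}}{\beta}\Big)\Big\rangle_- ,$$ where the sum runs over all $N$-tuples $\vec Y=(Y_1,\dots,Y_N)$ of Young diagrams and $|\vec Y|=\sum_a|Y_a|$.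
   Context: Root data: $(\cdot,\cdot)$ is the invariant bilinear form with $(e_a,e_b)=C_{ab}$, where $C_{aa}=2$, $C_{a,a\pm1}=-1$, and $C_{ab}=0$ otherwise; $\rho$ is the Weyl vector, $(\rho,e_a)=1$. ''Up to a $U(1)$ factor'': up to a multiplicative prefactor of the form $C\,q^{\kappa}(1-q)^{\lambda}$ with $C,\kappa,\lambda$ independent of $q$. The constant $C$ absorbs the constant phases from choices of branch of the powers in the integrand (each factor of the integrand is taken in absolute value up to such phases) and the Selberg normalization constants. The remaining $q$-dependence is understood as a power series expansion in $q$. Parameters are such that the integrals converge (or the integrals are understood by analytic continuation in the parameters). Selberg averages: for $\vec u=(u_1,\dots,u_{N-1})$, $\vec v=(v_1,\dots,v_{N-1})$ and variables $x^{(a)}=(x^{(a)}_1,\dots,x^{(a)}_{M_a})$, $1\le a\le N-1$, define $$\langle f\rangle_{\vec u,\vec v,\beta}=\frac1{S_{\vec u,\vec v,\beta}}\int dx\,\prod_{a=1}^{N-1}\Big[|\Delta(x^{(a)})|^{2\beta}\prod_{i=1}^{M_a}(x^{(a)}_i)^{u_a}(1-x^{(a)}_i)^{v_a}\Big]\prod_{a=1}^{N-2}|\Delta(x^{(a)},x^{(a+1)})|^{-\beta}f(x),$$ all variables being integrated over $[0,1]$, with $S_{\vec u,\vec v,\beta}$ the same integral with $f=1$, $\Delta(x)=\prod_{i<j}(x_i-x_j)$, $\Delta(x,y)=\prod_{i,j}(x_i-y_j)$. $\langle\cdot\rangle_+$ is the average with parameters $\vec u_+,\vec v_+$ over variables $x^{(a)}_i$,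 $1\le i\le N_a$; $\langle\cdot\rangle_-$ is the average with parameters $\vec u_-,\vec v_-$ over variables $y^{(a)}_i$, $1\le i\le\tilde N_a$. Power sums: $p^{(a)}_k=\sum_i(x^{(a)}_i)^k$, $\tilde p^{(a)}_k=\sum_i(y^{(a)}_i)^k$ for $1\le a\le N-1$, $p^{(0)}_k=p^{(N)}_k=\tilde p^{(0)}_k=\tilde p^{(N)}_k=0$; $r^{(a)}_k=p^{(a)}_k-p^{(a-1)}_k$ and $\tilde r^{(a)}_k=\tilde p^{(a)}_k-\tilde p^{(a-1)}_k$ for $1\le a\le N$, $k\ge1$. Jack polynomials: $J^{(\beta)}_Y$ is the Jack symmetric function labelled by the Young diagram $Y$, monic (coefficient $1$ on the monomial symmetric function $m_Y$, triangular in dominance order), orthogonal for the inner product $\langle p_\lambda,p_\mu\rangle_\beta=\delta_{\lambda\mu}\,\beta^{-\ell(\lambda)}\prod_i i^{k_i}k_i!$ ($k_i$ the multiplicity of $i$ in $\lambda$); e.g. $J^{(\beta)}_{[1]}=p_1$, $J^{(\beta)}_{[2]}=(p_2+\beta p_1^2)/(\beta+1)$. The normalized Jack polynomial is $j^{(\beta)}_Y=J^{(\beta)}_Y/\|J^{(\beta)}_Y\|$ with $\|J^{(\beta)}_Y\|^2=\langle J^{(\beta)}_Y,J^{(\beta)}_Y\rangle_\beta$. It is viewed as a polynomial in the power sums $p_1,p_2,\dots$; the notation $j^{(\beta)}_Y(g_k)$ means that $p_k$ is replaced by $g_k$ for every $k\ge1$ (so a constant such as $v'_{a+}/\beta$ is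 added to every power sum). *)

(* Defs.v *)
From HB Require Import structures.
From mathcomp Require Import all_boot all_order all_algebra finmap.
From mathcomp Require Import all_classical all_reals all_analysis.

Set Implicit Arguments.
Unset Strict Implicit.
Unset Printing Implicit Defensive.

Import Order.TTheory GRing.Theory Num.Theory.
Import numFieldNormedType.Exports.

Local Open Scope classical_set_scope.
Local Open Scope ring_scope.

(** * Root data of A_{N-1} *)

(* Indices 1 <= a <= N-1 of the simple roots are shifted to 'I_N.-1, that is
   0 <= a < N-1; elements of the root space are row vectors of coordinates in
   the basis of simple roots. *)

Section RootData.
Variables (R : realType) (N : nat).

Definition cartan : 'M[R]_N.-1 :=
  \matrix_(a, b) (if a == b then 2
                  else if (a.+1 == b :> nat) || (b.+1 == a :> nat) then - 1
                  else 0).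

Definition rform (x y : 'rV[R]_N.-1) : R := (x *m cartan *m y^T) ord0 ord0.

Definition simple_root (a : 'I_N.-1) : 'rV[R]_N.-1 := delta_mx ord0 a.

Definition is_weyl_vector (rho : 'rV[R]_N.-1) :=
  forall a, rform rho (simple_root a) = 1.

End RootData.

(** * Young diagrams *)

Record youngdiag := YoungDiag {
  yd_rows :> seq nat;
  _ : sorted geq yd_rows && (0%N \notin yd_rows) }.

HB.instance Definition _ := [isSub for yd_rows].
HB.instance Definition _ := [Choice of youngdiag by <:].

Definition ydsize (Y : youngdiag) : nat := sumn Y.

Definition dominates (lam mu : youngdiag) : Prop :=
  ydsize mu = ydsize lam /\
  forall k : nat, (sumn (take k mu) <= sumn (take k lam))%N.

(** * Symmetric functions and Jack polynomials *)

Section Jack.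
Variable R : realType.

(* The ring of symmetric functions is R[p_1, p_2, ...]: an element is given by
   its finitely many nonzero coefficients on the basis of the products
   p_lambda = prod_i p_(lambda_i). *)
Definition symfun := {fsfun youngdiag -> R with 0}.

Definition eval_powersums (F : symfun) (g : nat -> R) : R :=
  \sum_(lam <- finsupp F) F lam * \prod_(k <- yd_rows lam) g k.

Definition powersum (x : seq R) (k : nat) : R := \sum_(t <- x) t ^+ k.

(* m_mu(x_1, ..., x_n): the sum over the distinct rearrangements al of
   (mu_1, ..., mu_l, 0, ..., 0); `permutations` lists them without repetition.
   It vanishes when mu has more than n rows. *)
Definition monomial_sym (mu : seq nat) (x : seq R) : R :=
  if (size mu <= size x)%N then
    \sum_(al <- permutations (mu ++ nseq (size x - size mu) 0%N))
      \prod_(i < size x) x`_i ^+ nth 0%N al i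
  else 0.

Definition zee (lam : seq nat) : nat :=
  (\prod_(i <- undup lam) (i ^ count_mem i lam * (count_mem i lam)`!))%N.

Definition jack_inner (beta : R) (F G : symfun) : R :=
  \sum_(lam <- finsupp F)
    F lam * G lam * (beta ^- size lam * (zee lam)%:R).

(* F = m_Y + (combination of the m_mu with mu < Y).  An identity of symmetric
   functions is an identity in any finite number of variables; R being
   infinite, the latter may be tested on the values. *)
Definition monic_triangular (Y : youngdiag) (F : symfun) : Prop :=
  exists d : symfun,
    [/\ d Y = 1,
        forall mu, mu \in finsupp d -> dominates Y mu &
        forall x : seq R,
          eval_powersums F (powersum x) =
          \sum_(mu <- finsupp d) d mu * monomial_sym mu x].

Definition is_jack (beta : R) (J : youngdiag -> symfun) : Prop :=
  (forall Y, monic_triangular Y (J Y)) /\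
  (forall Y Y', Y != Y' -> jack_inner beta (J Y) (J Y') = 0).

(* The normalized j_Y, with p_k replaced by g k for k >= 1. *)
Definition normalized_jack (beta : R) (J : youngdiag -> symfun)
    (Y : youngdiag) (g : nat -> R) : R :=
  eval_powersums (J Y) g / Num.sqrt (jack_inner beta (J Y) (J Y)).

End Jack.

(** * Iterated integrals *)

Section IteratedIntegral.
Variables (R : realType) (I : eqType).

Definition update (x : I -> R) (i : I) (t : R) : I -> R :=
  fun j => if j == i then t else x j.

(* The coordinates listed in s are integrated, x_i over D i, the head of s
   being the outermost integral; the other coordinates keep the values they
   have in x. *)
Fixpoint iterated_integral (D : I -> set R) (s : seq I)
    (f : (I -> R) -> \bar R) (x : I -> R) : \bar R :=
  if s is i :: s' then
    (\int[lebesgue_measure]_(t in D i)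
        iterated_integral D s' f (update x i t))%E
  else f x.

End IteratedIntegral.

(** * Selberg averages and the Dotsenko-Fateev integral *)

Section Averages.
Variables (R : realType) (N : nat).

(* x (a, i) is the i-th variable, i >= 0, of the colour a; only the variables
   with i < M a are used, where M a is the number of variables of colour a. *)
Definition config := 'I_N.-1 * nat -> R.

Definition variables (M : 'I_N.-1 -> nat) : seq ('I_N.-1 * nat) :=
  [seq (a, i) | a <- enum 'I_N.-1, i <- iota 0 (M a)].

Definition integral_vars (M : 'I_N.-1 -> nat) (D : 'I_N.-1 * nat -> set R)
    (f : config -> \bar R) : \bar R :=
  iterated_integral D (variables M) f (fun=> 0).

Definition Delta (M : 'I_N.-1 -> nat) (x : config) (a : 'I_N.-1) : R :=
  \prod_(i < M a) \prod_(j < M a | (i < j)%N) (x (a, val i) - x (a, val j)).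

Definition Delta2 (M : 'I_N.-1 -> nat) (x : config) (a b : 'I_N.-1) : R :=
  \prod_(i < M a) \prod_(j < M b) (x (a, val i) - x (b, val j)).

Definition selberg_weight (M : 'I_N.-1 -> nat) (u v : 'I_N.-1 -> R) (beta : R)
    (x : config) : R :=
  \prod_(a < N.-1)
     (`|Delta M x a| `^ (2 * beta) *
      \prod_(i < M a) (x (a, val i) `^ u a * (1 - x (a, val i)) `^ v a)) *
  \prod_(a < N.-1) \prod_(b < N.-1 | b == a.+1 :> nat)
     `|Delta2 M x a b| `^ (- beta).

Definition unit_box (_ : 'I_N.-1 * nat) : set R := `[0, 1]%classic.

Definition selberg (M : 'I_N.-1 -> nat) (u v : 'I_N.-1 -> R) (beta : R)
    : \bar R :=
  integral_vars M unit_box (fun x => (selberg_weight M u v beta x)%:E).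

Definition average (M : 'I_N.-1 -> nat) (u v : 'I_N.-1 -> R) (beta : R)
    (f : config -> R) : R :=
  fine (integral_vars M unit_box
          (fun x => (selberg_weight M u v beta x * f x)%:E))
  / fine (selberg M u v beta).

Definition colour_powersum (M : 'I_N.-1 -> nat) (x : config) (a : 'I_N.-1)
    (k : nat) : R :=
  \sum_(i < M a) x (a, val i) ^+ k.

(* r^(a)_k = p^(a)_k - p^(a-1)_k with p^(0) = p^(N) = 0.  Here a : 'I_N stands
   for the index a.+1, so that p^(a.+1) belongs to the colour a (no colour if
   a = N-1) and p^(a) to the colour a-1 (no colour if a = 0). *)
Definition rdiff (M : 'I_N.-1 -> nat) (x : config) (a : 'I_N) (k : nat) : R :=
  \sum_(b < N.-1 | b == a :> nat) colour_powersum M x b k -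
  \sum_(b < N.-1 | b.+1 == a :> nat) colour_powersum M x b k.

Definition vprime_plus (v : 'I_N.-1 -> R) (a : 'I_N) : R :=
  \sum_(s < N.-1 | (a <= s)%N) v s.

Definition vprime_minus (v : 'I_N.-1 -> R) (a : 'I_N) : R :=
  - \sum_(s < N.-1 | (s < a)%N) v s.

(* Every factor is taken in absolute value. *)
Definition df_integrand (M : 'I_N.-1 -> nat) (beta : R)
    (al1 al2 al3 : 'rV[R]_N.-1) (q : R) (z : config) : R :=
  \prod_(a < N.-1) \prod_(i < M a) \prod_(j < M a | (i < j)%N)
     `|z (a, val j) - z (a, val i)| `^ (2 * beta) *
  \prod_(a < N.-1) \prod_(i < M a)
     (`|z (a, val i)| `^ rform al1 (simple_root R a) *
      `|z (a, val i) - q| `^ rform al2 (simple_root R a) *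
      `|z (a, val i) - 1| `^ rform al3 (simple_root R a)) *
  \prod_(a < N.-1) \prod_(b < N.-1 | b == a.+1 :> nat)
     \prod_(i < M a) \prod_(j < M b)
        `|z (b, val j) - z (a, val i)| `^ (- beta).

Definition df_domain (Np : 'I_N.-1 -> nat) (q : R) (ai : 'I_N.-1 * nat)
    : set R :=
  if (ai.2 < Np ai.1)%N then `[0, q]%classic else `[1, +oo[%classic.

Definition Z_DF (Np Nm : 'I_N.-1 -> nat) (beta : R)
    (al1 al2 al3 : 'rV[R]_N.-1) (q : R) : \bar R :=
  let M a := (Np a + Nm a)%N in
  ((q `^ (rform al1 al2 / beta) * (1 - q) `^ (rform al2 al3 / beta))%:E *
   integral_vars M (df_domain Np q)
     (fun z => (df_integrand M beta al1 al2 al3 q z)%:E))%E.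

(* The N-tuples of Young diagrams with n boxes in total; this set is finite. *)
Definition diagram_tuples (n : nat) : set {ffun 'I_N -> youngdiag} :=
  [set Y | (\sum_(a < N) ydsize (Y a))%N = n].

End Averages.

(* Main.v *)
(* Substitute z = q x for the variables integrated near 0 and z = 1 / y for the
   others.  The condition on alpha_4 turns the integrand into a power of q times
   the two Selberg weights in x and y, times a product of binomials (1 - s q)^(-b)
   with s one of x, y, x y.  Completed by a power of 1 - q, this product equals
   exp (sum_k q^k / k beta sum_a g_a(k) h_a(k)), where g_a and h_a are the
   arguments of the Jack polynomials: the exponents agree by summation by parts
   over the Dynkin diagram.  The Cauchy identity expands the exponential into
   sum_Y q^|Y| prod_a j_(Y_a)(g_a) j_(Y_a)(h_a).  For fixed q < 1 the expansion
   converges uniformly on the domain of integration, so it may be integrated term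
   by term, and each term is a function of x times a function of y. *)

From HB Require Import structures.
Require Import Defs.
From mathcomp Require Import all_boot all_order all_algebra finmap.
From mathcomp Require Import all_classical all_reals all_analysis measurable_realfun.
From mathcomp Require Import ring lra zify.

Set Implicit Arguments.
Unset Strict Implicit.
Unset Printing Implicit Defensive.

Import Order.TTheory GRing.Theory Num.Theory.
Import numFieldNormedType.Exports.

Local Open Scope classical_set_scope.
Local Open Scope ring_scope.

(** * Changes of variable *)

(** The exponents b are real numbers of both signs, so the expansion of the binomials has no
    positivity to exploit. Integration term by term rests instead on a bound that does not see the
    configuration: if K + 1 is at least the sum of the |b|, the coefficient of q^n is at most 'C(n +
    K, K) in absolute value, which is the coefficient of q^n in (1 - q)^-(K+1). The number of
    factors and their exponents are the same at all configurations, so one K serves everywhere, and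
    the error is at most a tail of that series times the total Selberg weight, which is assumed
    finite. The exponential is never formed as a formal series. Its coefficients e_n are cycle
    indices, characterized by Newton's recursion n e_n = sum_k c_k e_(n-k); the recursion gives the
    product formula for N-tuples, the bound above and the differential equation of the binomial
    product. The hypothesis on J speaks only of values at finitely many variables. Homogeneity of
    J_Y follows from the independence of the power sums, and its non-vanishing from an evaluation at
    x_i = u^(B^i). *)

Section ChangeOfVariable.
Context {R : realType}.
Local Open Scope ereal_scope.
Notation mu := (@lebesgue_measure R).
Let T := measurableTypeR R.
Variables (w : T -> R) (phi : T -> T) (D D' : set T).
Hypotheses (mw : measurable_fun setT w) (w0 : forall t, (0 <= w t)%R).
Hypotheses (mphi : measurable_fun setT phi).
Hypotheses (mD : measurable D) (mD' : measurable D').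
Hypothesis phiD : forall t, D t -> D' (phi t).

Let mphi1 (A : set T) : measurable A -> measurable (D `&` phi @^-1` A).
Proof. by move=> mA; apply: measurableI => //; rewrite -[_ @^-1` _]setTI; exact: mphi. Qed.

(** Uniqueness of Lebesgue measure compares measures on the whole line. The transported measure only
    lives on D', so it is completed by Lebesgue measure outside D'; evaluating at subsets of D'
    removes the added part again. *)
Let nu (A : set T) : \bar R :=
  mu (A `\` D') + \int[mu]_(t in D `&` phi @^-1` A) (w t)%:E.

Let nu0 : nu set0 = 0.
Proof. by rewrite /nu set0D measure0 preimage_set0 setI0 integral_set0 adde0. Qed.

Let nu_ge0 A : 0 <= nu A.
Proof. by rewrite adde_ge0// integral_ge0// => t _; rewrite lee_fin. Qed.

Let nu_sigma_additive : semi_sigma_additive nu.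
Proof.
move=> F mF tF mUF.
pose a i := mu (F i `\` D'); pose b i := \int[mu]_(t in D `&` phi @^-1` (F i)) (w t)%:E.
have ha : (fun n => \sum_(0 <= i < n) a i) @ \oo --> mu ((\bigcup_n F n) `\` D').
  rewrite setD_bigcupl; apply: measure_semi_sigma_additive.
  - by move=> i; apply: measurableD => //; exact: mF.
  - apply/trivIsetP => i j _ _ ij; rewrite !setDE setIACA.
    by move/trivIsetP : tF => /(_ _ _ I I ij) ->; rewrite set0I.
  - by rewrite -setD_bigcupl; exact: measurableD.
have hb : (fun n => \sum_(0 <= i < n) b i) @ \oo -->
    \int[mu]_(t in D `&` phi @^-1` (\bigcup_n F n)) (w t)%:E.
  rewrite preimage_bigcup setI_bigcupr.
  apply: (@semi_sigma_additive_nng_induced _ _ _ mu (fun t => (w t)%:E)) => //.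
  - exact/measurable_EFinP.
  - by move=> i; exact: mphi1.
  - apply/trivIsetP => i j _ _ ij; rewrite setIACA -[X in _ `&` X]preimage_setI.
    by have /trivIsetP/(_ _ _ I I ij) -> := tF; rewrite preimage_set0 setI0.
  - by apply: bigcupT_measurable => i; exact: mphi1.
rewrite [X in X @ _ --> _](_ : _ = (fun n => \sum_(0 <= i < n) a i + \sum_(0 <= i < n) b i)).
  apply: cvgeD => //; apply: ge0_adde_def; rewrite inE ?measure_ge0//.
  by apply: integral_ge0 => t _; rewrite lee_fin.
by apply/funext => n; rewrite -big_split.
Qed.

Hypothesis transport : forall a b : R, (a < b)%R ->
  mu (`]a, b] `&` D') = \int[mu]_(t in D `&` phi @^-1` `]a, b]) (w t)%:E.

Lemma measure_transport (A : set T) : measurable A ->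
  mu (A `&` D') = \int[mu]_(t in D `&` phi @^-1` A) (w t)%:E.
Proof.
move=> mA.
have key B : measurable B -> mu B = nu B.
  pose nu_measure := isMeasure.Build _ (measurableTypeR R) R nu nu0 nu_ge0 nu_sigma_additive.
  pose nuM : {measure set (measurableTypeR R) -> \bar R} := HB.pack nu nu_measure.
  move=> mB; refine (@lebesgue_measure_unique R nuM _ B mB) => X /ocitvP[->|[[a b] /= ab ->]].
    by rewrite !measure0.
  rewrite -[LHS]/(mu _) -[RHS]/(nu _) /nu -transport//.
  rewrite addeC -measureU//.
  - by rewrite setUIDK.
  - exact: measurableI.
  - exact: measurableD.
  - by rewrite setDE setIACA setICr setI0.
rewrite key; last exact: measurableI.
rewrite /nu (_ : _ `\` _ = set0) ?measure0 ?add0e; last first.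
  by rewrite setDE -setIA setICr setI0.
congr (integral _ _ _); apply/seteqP; split => t /=.
  by move=> [Dt [At _]].
by move=> [Dt At]; split => //; split => //; exact: phiD.
Qed.

Import HBNNSimple.

(** From sets to simple functions by linearity, then to nonnegative measurable functions by monotone
    convergence on both sides. *)
Lemma ge0_change_of_variable (G : T -> \bar R) :
  measurable_fun setT G -> (forall t, 0 <= G t) ->
  \int[mu]_(t in D') G t = \int[mu]_(t in D) ((w t)%:E * G (phi t)).
Proof.
move=> mG G0.
have mGT : measurable_fun D' G by exact: measurable_funTS.
pose g := nnsfun_approx measurableT mG.
have gG t : EFin \o g^~ t @ \oo --> G t by exact: cvg_nnsfun_approx.
have ndg t : nondecreasing_seq (fun n => (g n t)%:E).
  by move=> m n mn; rewrite lee_fin; exact/lefP/nd_nnsfun_approx.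
have mg n : measurable_fun setT (g n) by exact: measurable_funP.
have mgphi n : measurable_fun setT (g n \o phi) by exact: measurableT_comp.
transitivity (limn (fun n => \int[mu]_(t in D') (g n t)%:E)).
  rewrite -monotone_convergence//.
  - by apply: eq_integral => t _; apply/esym/cvg_lim => //; exact: gG.
  - by move=> n; apply/measurable_EFinP; exact: measurable_funTS.
  - by move=> n t _; rewrite lee_fin.
rewrite [X in limn X](_ : _ = fun n => \int[mu]_(t in D) ((w t)%:E * (g n (phi t))%:E)).
  rewrite -monotone_convergence//.
  - apply: eq_integral => t _; apply/cvg_lim => //.
    by apply: cvgeZl => //; exact: (gG (phi t)).
  - move=> n; apply: emeasurable_funM; apply/measurable_EFinP; apply: measurable_funTS => //.
    exact: mgphi.
  - by move=> n t _; rewrite mule_ge0// lee_fin.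
  - by move=> t _ m n mn; rewrite lee_wpmul2l ?lee_fin//; exact/lefP/nd_nnsfun_approx.
apply/funext => n.
have mS k : measurable (g n @^-1` [set k]) by rewrite -[_ @^-1` _]setTI; exact: measurable_funP.
have mSphi k : measurable (phi @^-1` (g n @^-1` [set k])).
  by rewrite -[_ @^-1` _]setTI; exact: mphi.
have hk k : \int[mu]_(t in D') (k * \1_(g n @^-1` [set k]) t)%:E =
    \int[mu]_(t in D) ((w t)%:E * (k * \1_(g n @^-1` [set k]) (phi t))%:E).
  have [k0|k0] := ltP k 0%R.
    rewrite preimage_nnfun0// !integral0_eq// => t _; rewrite indicE in_set0 mulr0//.
    by rewrite mule0.
  rewrite integralZl_indic_nnsfun// integral_indic//.
  transitivity (k%:E * \int[mu]_(t in D `&` phi @^-1` (g n @^-1` [set k])) (w t)%:E).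
    by congr (_ * _); exact: measure_transport.
  rewrite integral_mkcondr -ge0_integralZl//; last 2 first.
  - apply/(measurable_restrict _ _ _) => //; apply/measurable_EFinP.
    exact: measurable_funTS.
  - by move=> t _; apply: erestrict_ge0 => x _; rewrite lee_fin.
  apply: eq_integral => t _; rewrite patchE indicE.
  have -> : (phi t \in g n @^-1` [set k]) = (t \in phi @^-1` (g n @^-1` [set k])) by [].
  by case: ifPn => _; rewrite ?mulr1 ?mulr0 ?mule0// muleC.
under eq_integral do rewrite fimfunE -fsumEFin//.
rewrite ge0_integral_fsum//; last 2 first.
- move=> y; apply/measurable_EFinP; apply: measurable_funTS; apply: measurable_funM; first exact: measurable_cst.
  exact: measurable_indic.
- by move=> y x _; rewrite nnfun_muleindic_ge0.
under [RHS]eq_integral.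
  move=> t _; rewrite fimfunE -fsumEFin// ge0_mule_fsumr; first over.
  by move=> y; rewrite nnfun_muleindic_ge0.
rewrite ge0_integral_fsum//; last 2 first.
- move=> y; apply: emeasurable_funM; apply/measurable_EFinP; apply: measurable_funTS => //.
  apply: measurable_funM; first exact: measurable_cst.
  by have /measurable_indicP := mSphi y.
- by move=> y x _; apply: mule_ge0; [rewrite lee_fin|exact: nnfun_muleindic_ge0].
by apply: eq_fsbigr => k _; exact: hk.
Qed.
End ChangeOfVariable.

(** * The substitutions z = q x and z = 1 / y *)

Section Substitutions.
Context {R : realType}.
Notation mu := (@lebesgue_measure R).
Notation T := (measurableTypeR R).

(** Inversion is not continuous at 0. Writing it as t |t|^-2 reduces the claim to measurability of
    powers, and both sides are 0 at t = 0. *)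
Lemma measurable_invr : measurable_fun [set: T] (fun t : T => t^-1 : T).
Proof.
rewrite (_ : (fun t => _) = (fun t : R => t * `|t| `^ (- 2%:R))).
  apply: measurable_funM => //.
  by apply: (measurableT_comp (measurable_powR (- 2%:R))); exact: normr_measurable.
apply/funext => t; have [->|t0] := eqVneq t 0; first by rewrite invr0 mul0r.
by rewrite powR_invn// -normrX ger0_norm ?sqr_ge0// expr2 invfM mulrA mulfV// mul1r.
Qed.

(** The endpoint 0, a null set, is dropped so that both substitutions lead to the same interval ]0,
    1], on which every variable is positive and may be inverted. *)
Lemma integral_scale (q : R) (G : T -> \bar R) : 0 < q ->
  measurable_fun setT G -> (forall t, (0 <= G t)%E) ->
  (\int[mu]_(t in `[0%R, q]) G t = \int[mu]_(t in `]0%R, 1%R]) (q%:E * G (q * t)%R))%E.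
Proof.
move=> q0 mG G0.
have <- : (\int[mu]_(t in `]0%R, q]) G t = \int[mu]_(t in `[0%R, q]) G t)%E.
  by apply: integral_itv_obnd_cbnd; exact: measurable_funTS.
apply: (@ge0_change_of_variable R (cst q) (fun t => q * t)) => //.
- by move=> t; exact: ltW.
- exact: mulrl_measurable.
- by move=> t /=; rewrite !in_itv/= => /andP[t0 t1]; rewrite mulr_gt0//= ger_pMr.
move=> a b ab.
have -> : `]a, b] `&` `]0, q] = `]Num.max a 0, Num.min b q]%classic :> set R.
  by apply/seteqP; split => x /=; rewrite !in_itv/= gt_max le_min; lra.
have -> : `]0, 1] `&` ( *%R q) @^-1` `]a, b]
    = `]Num.max a 0 / q, Num.min b q / q]%classic :> set R.
  apply/seteqP; split => x /=; rewrite !in_itv/= ltr_pdivrMr// ler_pdivlMr// gt_max le_min (mulrC q x).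
    by move=> [/andP[x0 x1] /andP[-> ->]]/=; rewrite pmulr_lgt0// x0/= ger_pMl.
  by rewrite pmulr_lgt0// ger_pMl// => /andP[/andP[-> ->] /andP[-> ->]].
rewrite [RHS](integral_cst mu (measurable_itv _) q%:E)/= !lebesgue_measure_itv/= !lte_fin ltr_pM2r ?invr_gt0//.
by case: ifP => _; rewrite ?mule0// -!EFinB -EFinM -mulrBl mulrCA mulfV ?gt_eqF// mulr1.
Qed.

Let integral_exprN2 (a b : R) : 0 < a -> a <= b ->
  (\int[mu]_(t in `[a, b]) (t ^- 2)%:E = (a^-1 - b^-1)%:E)%E.
Proof.
move=> a0; rewrite le_eqVlt => /predU1P[->|ab].
  by rewrite set_itv1 integral_set1 subrr.
have D (x : R) : 0 < x -> is_derive x 1 (fun t : R => - t^-1) (x ^- 2).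
  move=> x0; apply: is_derive_eq.
    by apply: is_deriveN; apply: is_deriveV; rewrite gt_eqF.
  by rewrite /= scaleNr opprK [_ *: _]mulr1.
have cN (x : R) : 0 < x -> {for x, continuous (fun t : R => - t^-1)}.
  by move=> x0; apply: continuousN; apply: inv_continuous; rewrite gt_eqF.
have c2 (x : R) : 0 < x -> {for x, continuous (fun t : R => t ^- 2)}.
  move=> x0; apply: continuousV; first by rewrite gt_eqF// exprn_gt0.
  exact: exprn_continuous.
rewrite (@continuous_FTC2 _ _ (fun t => - t^-1))//.
- by rewrite -EFinB opprK addrC.
- apply: continuous_in_subspaceT => x; rewrite inE/= in_itv/= => /andP[ax _].
  by apply: c2; exact: lt_le_trans ax.
- split.
  + move=> x; rewrite in_itv/= => /andP[ax _].
    by apply: ex_derive; apply: D; exact: lt_trans ax.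
  + by apply: cvg_at_right_filter; exact: cN.
  + by apply: cvg_at_left_filter; apply: cN; exact: lt_trans ab.
- move=> x; rewrite in_itv/= => /andP[ax xb]; rewrite derive1E.
  by apply: derive_val; apply: D; exact: lt_trans ax.
Qed.

Lemma integral_invert (G : T -> \bar R) :
  measurable_fun setT G -> (forall t, (0 <= G t)%E) ->
  (\int[mu]_(t in `[1%R, +oo[) G t =
   \int[mu]_(t in `]0%R, 1%R]) ((t ^- 2)%:E * G (t^-1)%R))%E.
Proof.
move=> mG G0.
apply: (@ge0_change_of_variable R (fun t => t ^- 2) (fun t => t^-1)) => //.
- under eq_fun do rewrite -exprVn.
  by apply: measurable_funX; exact: measurable_invr.
- by move=> t; rewrite invr_ge0 sqr_ge0.
- exact: measurable_invr.
- by move=> t /=; rewrite !in_itv/= => /andP[t0 t1]; rewrite andbT invf_ge1.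
move=> a b ab.
(* The trace of ]a, b] on [1, +oo[ is empty if b < 1, the closed interval [1, b] if a < 1 <= b, and
   ]a, b] itself if 1 <= a. *)
have [b1|b1] := ltP b 1.
  rewrite (_ : _ `&` _ = set0) ?measure0; last first.
    by apply/seteqP; split => x //=; rewrite !in_itv/=; lra.
  rewrite (_ : _ `&` _ = set0) ?integral_set0//.
  apply/seteqP; split => x //=; rewrite !in_itv/= => -[/andP[x0 x1] /andP[_]].
  have : 1 <= x^-1 by rewrite invf_ge1.
  lra.
have b0 : 0 < b by exact: lt_le_trans b1.
have [a1|a1] := ltP a 1.
  rewrite (_ : _ `&` `[1, +oo[ = `[1, b]%classic :> set R); last first.
    by apply/seteqP; split => x //=; rewrite !in_itv/=; lra.
  rewrite (_ : `]0, 1]%classic `&` _ = `[b^-1, 1]%classic :> set R); last first.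
    apply/seteqP; split => x //=; rewrite !in_itv/=.
      by move=> [/andP[x0 ->] /andP[_ xb]]; rewrite -[x]invrK lef_pV2 ?posrE ?invr_gt0// xb.
    move=> /andP[bx x1]; have x0 : 0 < x by apply: lt_le_trans bx; rewrite invr_gt0.
    rewrite x0 x1 (lt_le_trans a1) ?invf_ge1//=.
    by rewrite -[b]invrK lef_pV2 ?posrE ?invr_gt0.
  rewrite integral_exprN2 ?invr_gt0// ?invf_le1// invr1 invrK lebesgue_measure_itv/= lte_fin.
  case: ifPn => //; rewrite -leNgt => b1x.
  have bE : b = 1 by apply/le_anti; rewrite b1x b1.
  by rewrite bE subrr.
have a0 : 0 < a by exact: lt_le_trans a1.
rewrite (_ : _ `&` `[1, +oo[ = `]a, b]%classic :> set R); last first.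
  by apply/seteqP; split => x //=; rewrite !in_itv/=; lra.
rewrite (_ : `]0, 1]%classic `&` _ = `[b^-1, a^-1[%classic :> set R); last first.
  apply/seteqP; split => x //=; rewrite !in_itv/=.
    move=> [/andP[x0 _] /andP[ax xb]].
    by rewrite -[x]invrK lef_pV2 ?ltf_pV2 ?posrE ?invr_gt0// xb.
  move=> /andP[bx xa]; have x0 : 0 < x by apply: lt_le_trans bx; rewrite invr_gt0.
  rewrite x0 (le_trans (ltW xa)) ?invf_le1//; split => //.
  by rewrite -[a]invrK -[b]invrK lef_pV2 ?ltf_pV2 ?posrE ?invr_gt0// xa.
have -> : (\int[mu]_(t in `[b^-1%R, a^-1%R[) (t ^- 2)%:E = \int[mu]_(t in `[b^-1%R, a^-1%R]) (t ^- 2)%:E)%E.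
  apply: integral_itv_bndo_bndc; apply/measurable_EFinP; apply: measurable_funTS.
  by under eq_fun do rewrite -exprVn; apply: measurable_funX; exact: measurable_invr.
rewrite integral_exprN2 ?invr_gt0// ?lef_pV2 ?posrE//; last exact: ltW.
by rewrite !invrK lebesgue_measure_itv/= lte_fin ab.
Qed.
End Substitutions.

(** * Iterated integrals *)

Section IteratedIntegralTheory.
Context {R : realType} {I : eqType}.
Notation mu := (@lebesgue_measure R).
Notation T := (measurableTypeR R).
Implicit Types (D : I -> set R) (s : seq I) (x y : I -> R).

(* The infinitely many coordinates carry no sigma-algebra; instead a function
   of a configuration is measurable when it is so along every family of
   configurations that is measurable in each coordinate. *)
Definition config_measurable (h : (I -> R) -> \bar R) :=
  forall d (X : measurableType d) (x : X -> I -> T),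
    (forall i, measurable_fun setT (x^~ i)) ->
    measurable_fun setT (fun t => h (x t)).

Lemma measurable_update d (X : measurableType d) (x : X -> I -> T) (t : X -> T) i :
  (forall j, measurable_fun setT (x^~ j)) -> measurable_fun setT t ->
  forall j, measurable_fun setT (fun z => update (x z) i (t z) j).
Proof. by move=> mx mt j; rewrite /update; case: (j == i); [exact: mt|exact: mx]. Qed.

Lemma config_measurable_update h i x : config_measurable h ->
  measurable_fun [set: T] (fun t : T => h (update x i t)).
Proof.
move=> mh; apply: mh; exact: measurable_update.
Qed.

(** Adding the integrated variable to the parameter space X gives a family over X * T, and Tonelli
    makes its marginal measurable on X. This is why [config_measurable] quantifies over all
    parameter spaces. *)
Let ge0_config_measurable_integral (A : set T) h i :
  measurable A -> config_measurable h -> (forall x, (0 <= h x)%E) ->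
  config_measurable (fun x => \int[mu]_(t in A) h (update x i t))%E.
Proof.
move=> mA mh h0 d X x mx.
pose H (z : X * T) : \bar R := (h (update (x z.1) i z.2) * (\1_A z.2)%:E)%E.
have mH : measurable_fun setT H.
  apply: emeasurable_funM.
    apply: mh; apply: measurable_update; last exact: measurable_snd.
    by move=> j; apply: (measurableT_comp (mx j)); exact: measurable_fst.
  apply/measurable_EFinP.
  have mi : measurable_fun setT (\1_A : T -> R) by exact/measurable_indicP.
  exact: (measurableT_comp mi measurable_snd).
have H0 z : (0 <= H z)%E by rewrite mule_ge0// lee_fin.
have := measurable_fun_fubini_tonelli_F (m2 := mu) H mH H0.
apply: eq_measurable_fun => z _; rewrite /fubini_F /H /= [RHS]integral_mkcond.
apply: eq_integral => t _; rewrite patchE indicE.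
by case: ifPn => _; rewrite ?mule1 ?mule0.
Qed.

Lemma config_measurable_integral (A : set T) h i :
  measurable A -> config_measurable h ->
  config_measurable (fun x => \int[mu]_(t in A) h (update x i t))%E.
Proof.
move=> mA mh.
have mp : config_measurable (fun x => maxe (h x) 0%E).
  by move=> d X x mx; apply: measurable_maxe => //; exact: mh.
have mn : config_measurable (fun x => maxe (- h x)%E 0%E).
  by move=> d X x mx; apply: measurable_maxe => //; apply: measurableT_comp => //; exact: mh.
have p0 y : (0 <= maxe (h y) 0)%E by rewrite le_max lexx orbT.
have n0 y : (0 <= maxe (- h y) 0)%E by rewrite le_max lexx orbT.
move=> d X x mx; under eq_fun do rewrite integralE.
apply: emeasurable_funB.
- under eq_fun do under eq_integral do rewrite funeposE.
  exact: (ge0_config_measurable_integral i mA mp p0 mx).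
- under eq_fun do under eq_integral do rewrite funenegE.
  exact: (ge0_config_measurable_integral i mA mn n0 mx).
Qed.

Lemma config_measurable_iterated D s f : (forall i, measurable (D i : set T)) ->
  config_measurable f -> config_measurable (iterated_integral D s f).
Proof.
move=> mD mf; elim: s => //= i s IH.
by have := config_measurable_integral i (mD i) IH.
Qed.

Lemma iterated_integral_ge0 D s f x : (forall y, (0 <= f y)%E) ->
  (0 <= iterated_integral D s f x)%E.
Proof. by move=> f0; elim: s x => //= i s IH x; apply: integral_ge0. Qed.

(* The configurations at which [iterated_integral D s f x] evaluates [f]. *)
Definition reachable D s x y :=
  forall i, if i \in s then D i (y i) else y i = x i.

Lemma reachable_update D i s x t y :
  D i t -> reachable D s (update x i t) y -> reachable D (i :: s) x y.
Proof.
move=> Dt r j; have := r j; rewrite in_cons /update.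
by case: ifP; rewrite ?orbT// orbF; case: eqVneq => [-> _ ->|].
Qed.

Lemma eq_iterated_integral D s f g x :
  (forall y, reachable D s x y -> f y = g y) ->
  iterated_integral D s f x = iterated_integral D s g x.
Proof.
elim: s x => [|i s IH] x fg /=; first by apply: fg => i; rewrite in_nil.
apply: eq_integral => t; rewrite inE => Dt; apply: IH => y r.
exact/fg/reachable_update/r.
Qed.

Lemma le_iterated_integral_abs D s f w x : (forall i, measurable (D i : set T)) ->
  config_measurable f -> config_measurable w ->
  (forall y, (0 <= w y)%E) ->
  (forall y, reachable D s x y -> (`|f y| <= w y)%E) ->
  (`|iterated_integral D s f x| <= iterated_integral D s w x)%E.
Proof.
move=> mD mf mw w0; elim: s x => [|i s IH] x fw /=.
  by apply: fw => i; rewrite in_nil.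
have mi h : config_measurable h -> measurable_fun (D i : set T)
    (fun t => iterated_integral D s h (update x i t)).
  by move=> mh; apply: measurable_funTS; apply: config_measurable_update;
       exact: config_measurable_iterated.
have mif := mi f mf; have miw := mi w mw.
apply: (le_trans (le_abse_integral mu (mD i) mif)).
apply: ge0_le_integral => //.
- by apply: measurableT_comp.
- move=> t Dt; apply: IH => y r; apply: fw; exact: reachable_update r.
Qed.

Lemma config_measurableZD (a b : \bar R) f g :
  config_measurable f -> config_measurable g ->
  config_measurable (fun y => a * f y + b * g y)%E.
Proof.
move=> mf mg d X x mx; apply: emeasurable_funD; apply: measurable_funeM.
- exact: mf.
- exact: mg.
Qed.

(** The inner integrals need not be finite everywhere. Since the iterated integral of w is finite,
    the inner integral of w is finite for almost every value of the outer variable, and the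
    induction hypothesis is applied only there. *)
Lemma iterated_integralZD D s (a b : R) f g w x :
  (forall i, measurable (D i : set T)) ->
  config_measurable f -> config_measurable g -> config_measurable w ->
  (forall y, (0 <= w y)%E) ->
  (forall y, reachable D s x y -> (`|f y| <= w y)%E) ->
  (forall y, reachable D s x y -> (`|g y| <= w y)%E) ->
  (iterated_integral D s w x < +oo)%E ->
  iterated_integral D s (fun y => a%:E * f y + b%:E * g y)%E x =
  (a%:E * iterated_integral D s f x + b%:E * iterated_integral D s g x)%E.
Proof.
move=> mD mf mg mw w0; elim: s x => //= i s IH x fw gw wfin.
have mi h : config_measurable h -> measurable_fun (D i : set T)
    (fun t => iterated_integral D s h (update x i t)).
  by move=> mh; apply: measurable_funTS; apply: config_measurable_update;
     exact: config_measurable_iterated.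
have mif := mi f mf; have mig := mi g mg; have miw := mi w mw.
have mifg := mi _ (config_measurableZD a%:E b%:E mf mg).
have fw' t : D i t -> (`|iterated_integral D s f (update x i t)| <=
    iterated_integral D s w (update x i t))%E.
  move=> Dt; apply: le_iterated_integral_abs => // y r.
  by apply: fw; exact: reachable_update r.
have gw' t : D i t -> (`|iterated_integral D s g (update x i t)| <=
    iterated_integral D s w (update x i t))%E.
  move=> Dt; apply: le_iterated_integral_abs => // y r.
  by apply: gw; exact: reachable_update r.
have wabs t : (`|iterated_integral D s w (update x i t)| =
    iterated_integral D s w (update x i t))%E.
  by apply: gee0_abs; exact: iterated_integral_ge0.
have iw : mu.-integrable (D i) (fun t => iterated_integral D s w (update x i t)).
  by apply/integrableP; split => //; under eq_integral do rewrite wabs.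
have iif : mu.-integrable (D i) (fun t => iterated_integral D s f (update x i t)).
  by apply: le_integrable iw => // t Dt; rewrite wabs; exact: fw'.
have iig : mu.-integrable (D i) (fun t => iterated_integral D s g (update x i t)).
  by apply: le_integrable iw => // t Dt; rewrite wabs; exact: gw'.
rewrite -(integralZl (mD i) iif) -(integralZl (mD i) iig) -integralD//; last 2 first.
- exact: integrableZl.
- exact: integrableZl.
apply: ae_eq_integral => //.
- by apply: emeasurable_funD; exact: measurable_funeM.
have := integrable_ae (mD i) iw.
apply: filterS => t wt Dt; apply: IH.
- by move=> y r; apply: fw; exact: reachable_update r.
- by move=> y r; apply: gw; exact: reachable_update r.
- by have := wt Dt; rewrite fin_numElt => /andP[].
Qed.

(* Tonelli for a product whose factors depend on disjoint sets of variables;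
   no change of the order of integration is involved. *)
Lemma iterated_integralM D s (P : pred I) f g x :
  (forall i, measurable (D i : set T)) ->
  config_measurable f -> config_measurable g ->
  (forall y, (0 <= f y)%E) -> (forall y, (0 <= g y)%E) ->
  (forall i y t, i \in s -> ~~ P i -> f (update y i t) = f y) ->
  (forall i y t, i \in s -> P i -> g (update y i t) = g y) ->
  iterated_integral D s (fun y => f y * g y)%E x =
  (iterated_integral D [seq j <- s | P j] f x *
   iterated_integral D [seq j <- s | ~~ P j] g x)%E.
Proof.
move=> mD mf mg f0 g0; elim: s x => //= i s IH x fP gP.
have indep h s' y t : (forall y, h (update y i t) = h y) ->
    iterated_integral D s' h (update y i t) = iterated_integral D s' h y.
  elim: s' y => [|j s' IHs] y hi //=.
  have [->|ij] := eqVneq j i.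
    apply: eq_integral => r _.
    have -> // : update (update y i t) i r = update y i r.
    by apply/funext => k; rewrite /update; case: (k == i).
  apply: eq_integral => r _.
  have -> : update (update y i t) j r = update (update y j r) i t.
    apply/funext => k; rewrite /update; have [->|//] := eqVneq k j.
    by rewrite (negbTE ij).
  exact: IHs.
have mi h s' : config_measurable h -> measurable_fun (D i : set T)
    (fun t => iterated_integral D s' h (update x i t)).
  by move=> mh; apply: measurable_funTS; apply: config_measurable_update;
     exact: config_measurable_iterated.
under eq_integral.
  move=> t _; rewrite IH; first over.
  - by move=> j y r js; apply: fP; rewrite in_cons js orbT.
  - by move=> j y r js; apply: gP; rewrite in_cons js orbT.
have [Pi|Pi] := boolP (P i) => /=.
  under eq_integral.
    move=> t _; rewrite [X in (_ * X)%E]indep; first over.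
    by move=> y; rewrite gP// mem_head.
  apply: ge0_integralZr; [exact: mD|exact: mi| |].
  - by move=> t _; exact: iterated_integral_ge0.
  - exact: iterated_integral_ge0.
under eq_integral.
  move=> t _; rewrite [X in (X * _)%E]indep; first over.
  by move=> y; rewrite fP// mem_head.
apply: ge0_integralZl; [exact: mD|exact: mi| |].
- by move=> t _; exact: iterated_integral_ge0.
- exact: iterated_integral_ge0.
Qed.

Lemma iterated_integral_map (J : eqType) (E : J -> set R) D (sigma : J -> I) (r : seq J)
    (f : (J -> R) -> \bar R) x :
  injective sigma -> (forall j, D (sigma j) = E j) ->
  iterated_integral D (map sigma r) (fun y => f (y \o sigma)) x =
  iterated_integral E r f (x \o sigma).
Proof.
move=> inj DE; elim: r x => //= j r IH x; rewrite DE.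
apply: eq_integral => t _; rewrite IH.
have -> // : update x (sigma j) t \o sigma = update (x \o sigma) j t.
by apply/funext => k; rewrite /update /= (inj_eq inj).
Qed.

Lemma eq_iterated_integral_domain D E s f x :
  (forall i (h : T -> \bar R), measurable_fun setT h ->
     (\int[mu]_(t in D i) h t = \int[mu]_(t in E i) h t)%E) ->
  (forall i, measurable (D i : set T)) -> config_measurable f ->
  iterated_integral D s f x = iterated_integral E s f x.
Proof.
move=> DE mD mf; elim: s x => //= i s IH x.
rewrite DE; first by apply: eq_integral => t _; exact: IH.
by apply: config_measurable_update; exact: config_measurable_iterated.
Qed.

Lemma iterated_integral_change_of_variables D E (jac phi : I -> T -> T) s f x :
  (forall i (h : T -> \bar R), measurable_fun setT h -> (forall t, (0 <= h t)%E) ->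
     (\int[mu]_(t in D i) h t = \int[mu]_(t in E i) ((jac i t)%:E * h (phi i t)))%E) ->
  (forall i, measurable (D i : set T)) -> (forall i, measurable (E i : set T)) ->
  (forall i, measurable_fun setT (jac i)) -> (forall i, measurable_fun setT (phi i)) ->
  (forall i t, 0 <= jac i t) -> uniq s ->
  config_measurable f -> (forall y, (0 <= f y)%E) ->
  iterated_integral D s f (fun i => phi i (x i)) =
  iterated_integral E s
    (fun y => (\prod_(i <- s) jac i (y i))%:E * f (fun i => phi i (y i)))%E x.
Proof.
move=> cov mD mE mjac mphi jac0 + mf f0.
elim: s x => [|i s IH] x /=; first by rewrite big_nil mul1e.
move=> /andP[is_ us]; rewrite cov; last 2 first.
- by apply: config_measurable_update; exact: config_measurable_iterated.
- by move=> t; exact: iterated_integral_ge0.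
apply: eq_integral => t _.
have -> : update (fun j => phi j (x j)) i (phi i t) = fun j => phi j (update x i t j).
  by apply/funext => j; rewrite /update; case: eqVneq => [->|].
rewrite IH// -[X in (X * _)%E](_ : (jac i (update x i t i))%:E = _); last first.
  by rewrite /update eqxx.
pose f' y : \bar R := (jac i (y i))%:E.
pose g' y : \bar R := ((\prod_(j <- s) jac j (y j))%:E * f (fun j => phi j (y j)))%E.
(* The Jacobian of the outer variable is constant for the inner ones. Read as an integral over no
   variable, it is brought under the integral sign by the product rule for the predicate [pred0]. *)
rewrite -[LHS]/(iterated_integral E [::] f' (update x i t) * _)%E.
have -> : [::] = [seq j <- s | pred0 j] by rewrite filter_pred0.
have {2}-> : s = [seq j <- s | ~~ pred0 j] by rewrite filter_predT.
rewrite -(@iterated_integralM _ _ _ f' g')//.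
- by apply: eq_iterated_integral => y _; rewrite /f' /g' big_cons EFinM muleA.
- move=> d X z mz; apply/measurable_EFinP.
  exact: (measurableT_comp (mjac i) (mz i)).
- move=> d X z mz; apply: emeasurable_funM.
    apply/measurable_EFinP; apply: measurable_prod => j _.
    exact: (measurableT_comp (mjac j) (mz j)).
  by apply: mf => j; exact: (measurableT_comp (mphi j) (mz j)).
- by move=> y; rewrite lee_fin.
- by move=> y; rewrite mule_ge0// lee_fin prodr_ge0.
- move=> j y r js _; rewrite /f' /update; case: eqVneq => // ij.
  by move: is_; rewrite ij js.
Qed.

End IteratedIntegralTheory.

(** * Partitions and cycle indices *)

Section Partitions.

Lemma yd_sorted (Y : youngdiag) : sorted geq Y.
Proof. by case/andP: (valP Y). Qed.

Lemma yd_notin0 (Y : youngdiag) : 0%N \notin yd_rows Y.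
Proof. by case/andP: (valP Y). Qed.

Lemma yd_inj (Y Z : youngdiag) : perm_eq Y Z -> Y = Z.
Proof.
move=> YZ; apply/val_inj/(sorted_eq (leT := geq)) => //.
- by move=> a b c /= ba ac; exact: leq_trans ac ba.
- by move=> a b /andP[/= ba ab]; apply/anti_leq/andP.
- exact: yd_sorted.
- exact: yd_sorted.
Qed.

(** A diagram with at most n boxes has at most n rows, each of length at most n, so the finite type
    of bounded sequences over 'I_n.+1 contains all of them. *)
Definition diagrams_upto (n : nat) : seq youngdiag :=
  [seq Y <- undup (pmap insub [seq map val (bseqval b) | b : n.-bseq 'I_n.+1])
  | (ydsize Y <= n)%N].

Definition partitions (n : nat) : seq youngdiag :=
  [seq Y <- diagrams_upto n | ydsize Y == n].

Lemma mem_diagrams_upto n Y : (Y \in diagrams_upto n) = (ydsize Y <= n)%N.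
Proof.
rewrite mem_filter; case: leqP => //= Yn; rewrite mem_undup mem_pmap.
have all_le : all (fun k => k < n.+1)%N Y.
  apply/allP => k kY; rewrite ltnS; apply: leq_trans Yn.
  by rewrite /ydsize sumnE (big_rem k)//= leq_addr.
have size_le : (size [seq inord k : 'I_n.+1 | k <- Y] <= n)%N.
  rewrite size_map; apply: leq_trans Yn.
  have := yd_notin0 Y; rewrite /ydsize; elim: (yd_rows Y) => //= k s IH.
  rewrite in_cons negb_or eq_sym -lt0n => /andP[k0 /IH].
  by case: k k0 => // k _ h; rewrite addSn ltnS (leq_trans h)// leq_addl.
apply/mapP; exists (val Y); last by rewrite valK.
apply/mapP; exists (Bseq size_le); first by rewrite mem_enum.
rewrite /= -map_comp map_id_in// => k kY /=; rewrite inordK//.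
exact: (allP all_le).
Qed.

Lemma uniq_diagrams_upto n : uniq (diagrams_upto n).
Proof. by apply: filter_uniq; exact: undup_uniq. Qed.

Lemma mem_partitions n Y : (Y \in partitions n) = (ydsize Y == n).
Proof.
by rewrite mem_filter mem_diagrams_upto; case: eqP => //= ->; rewrite leqnn.
Qed.

Lemma uniq_partitions n : uniq (partitions n).
Proof. by apply: filter_uniq; exact: uniq_diagrams_upto. Qed.

Lemma zee_perm s t : perm_eq s t -> zee s = zee t.
Proof.
move=> st; rewrite /zee (perm_big _ (perm_undup (perm_mem st)))/=.
by apply: eq_bigr => i _; have /permP -> := st.
Qed.

Lemma zee_cons k s : zee (k :: s) = (k * (count_mem k s).+1 * zee s)%N.
Proof.
rewrite /zee /=; case: ifPn => ks.
  rewrite (bigD1_seq k) ?undup_uniq ?mem_undup//= eqxx add1n.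
  rewrite [in RHS](bigD1_seq k) ?undup_uniq ?mem_undup//= expnS factS.
  set a := \prod_(_ <- _ | _) _; set b := \prod_(_ <- _ | _) _.
  have -> : a = b by apply: eq_bigr => i ik; rewrite eq_sym (negbTE ik).
  by ring.
rewrite big_cons eqxx (count_memPn ks) addn0 expn1 factS fact0 !muln1.
congr (_ * _)%N; apply: eq_big_seq => i; rewrite mem_undup => is_.
by case: eqVneq => [ki|//]; move: ks; rewrite ki is_.
Qed.

Lemma zee_gt0 (Y : youngdiag) : (0 < zee Y)%N.
Proof.
rewrite /zee big_seq; apply: prodn_cond_gt0 => i; rewrite mem_undup => iY.
rewrite muln_gt0 fact_gt0 andbT expn_gt0; case: i iY => // Y0.
by move: (yd_notin0 Y); rewrite Y0.
Qed.

Let remove_rowP k (Y : youngdiag) : sorted geq (rem k Y) && (0%N \notin rem k Y).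
Proof.
apply/andP; split.
  apply: (subseq_sorted _ (rem_subseq _ _)); last exact: yd_sorted.
  by move=> a b c /= ba ac; exact: leq_trans ac ba.
by apply: contra (yd_notin0 Y); exact: mem_rem.
Qed.

Definition remove_row k (Y : youngdiag) := YoungDiag (remove_rowP k Y).

Let insert_rowP k (Y : youngdiag) :
  sorted geq (sort geq (k.+1 :: Y)) && (0%N \notin sort geq (k.+1 :: Y)).
Proof.
apply/andP; split; first by apply: sort_sorted => a b; exact: leq_total.
by rewrite mem_sort in_cons /= yd_notin0.
Qed.

Definition insert_row k (Y : youngdiag) := YoungDiag (insert_rowP k Y).

Lemma insert_row_perm k (Y : youngdiag) : perm_eq (insert_row k Y) (k.+1 :: Y).
Proof. by rewrite /= perm_sort. Qed.

Lemma insert_rowK k : cancel (insert_row k) (remove_row k.+1).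
Proof.
move=> Y; apply: yd_inj => /=.
rewrite -(perm_cons k.+1) -(permPr (insert_row_perm k Y)) perm_sym perm_to_rem//.
by rewrite (perm_mem (insert_row_perm k Y)) mem_head.
Qed.

Lemma remove_rowK k (Y : youngdiag) : k.+1 \in yd_rows Y ->
  insert_row k (remove_row k.+1 Y) = Y.
Proof.
move=> kY; apply: yd_inj; rewrite (permPl (insert_row_perm _ _)) /= perm_sym.
exact: perm_to_rem.
Qed.

Lemma ydsize_insert_row k (Y : youngdiag) : ydsize (insert_row k Y) = (k.+1 + ydsize Y)%N.
Proof. by rewrite /ydsize !sumnE (perm_big _ (insert_row_perm k Y)) big_cons. Qed.

(** Removing one row of length k.+1 is a bijection; it is the combinatorial step of Newton's
    recursion. *)
Lemma perm_partitions_row n k : (k < n)%N ->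
  perm_eq [seq Y <- partitions n | k.+1 \in yd_rows Y]
    [seq insert_row k Y | Y <- partitions (n - k.+1)].
Proof.
move=> kn; apply: uniq_perm.
- by apply: filter_uniq; exact: uniq_partitions.
- by rewrite map_inj_uniq ?uniq_partitions//; exact: can_inj (insert_rowK k).
move=> Y; rewrite mem_filter mem_partitions; apply/idP/mapP.
  move=> /andP[kY /eqP Yn]; exists (remove_row k.+1 Y); last by rewrite remove_rowK.
  rewrite mem_partitions; have := ydsize_insert_row k (remove_row k.+1 Y).
  by rewrite remove_rowK// Yn => ->; rewrite addKn.
move=> [Z]; rewrite mem_partitions => /eqP Zn ->.
by rewrite (perm_mem (insert_row_perm k Z)) mem_head ydsize_insert_row Zn subnKC /=.
Qed.

Lemma sumn_count n s : {in s, forall k, 0 < k <= n}%N ->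
  sumn s = (\sum_(k < n) k.+1 * count_mem k.+1 s)%N.
Proof.
elim: s => [|x s IH] xs /=.
  by rewrite big1// => k _; rewrite muln0.
rewrite IH; last by move=> k ks; apply: xs; rewrite in_cons ks orbT.
under [RHS]eq_bigr do rewrite mulnDr.
rewrite [RHS]big_split; congr addn.
have /andP[x0 xn] := xs x (mem_head _ _).
case: x x0 xn xs => // x _ xn _.
rewrite (bigD1 (Ordinal xn))//= eqxx muln1 big1 ?addn0// => k kx.
by rewrite eqSS eq_sym (_ : (k == x :> nat) = false) ?muln0//; exact: negbTE.
Qed.

End Partitions.

(** * Cycle indices and Newton's recursion *)

Section CycleIndex.
Variable R : realType.
Implicit Types c : nat -> R.

(* Coefficient of q^n in exp (sum_k c_k q^k / k). *)
Definition cycle_index c (n : nat) : R :=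
  \sum_(lam <- partitions n) (\prod_(k <- yd_rows lam) c k) / (zee lam)%:R.

Lemma eq_cycle_index c c' n : (forall k, (0 < k)%N -> c k = c' k) ->
  cycle_index c n = cycle_index c' n.
Proof.
move=> cc; apply: eq_bigr => Y _; congr (_ / _).
rewrite big_seq [RHS]big_seq; apply: eq_bigr => k kY; apply: cc.
by case: k kY => // Y0; move: (yd_notin0 Y); rewrite Y0.
Qed.

Lemma cycle_index0 c : cycle_index c 0 = 1.
Proof.
have Y0P : sorted geq [::] && (0%N \notin [::]) by [].
rewrite /cycle_index (perm_big [:: YoungDiag Y0P])/=.
  by rewrite big_seq1 /= big_nil /zee big_nil divr1.
apply: uniq_perm => //; first exact: uniq_partitions.
move=> Y; rewrite mem_partitions mem_seq1; apply/idP/eqP => [|->//].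
have := yd_notin0 Y; rewrite /ydsize => Y0 /eqP Yn; apply/val_inj => /=.
by case: (yd_rows Y) Y0 Yn => // k s; rewrite in_cons /=; lia.
Qed.

(** Write n as the sum of k m_k over the row lengths k of Y, with m_k their multiplicities, and
    remove one row of length k: the weight k m_k is exactly the ratio of [zee] before and after the
    removal. *)
Lemma cycle_index_newton c n :
  n%:R * cycle_index c n = \sum_(k < n) c k.+1 * cycle_index c (n - k.+1).
Proof.
rewrite /cycle_index mulr_sumr.
transitivity (\sum_(Y <- partitions n) \sum_(k < n)
    (k.+1 * count_mem k.+1 (yd_rows Y))%:R * ((\prod_(i <- yd_rows Y) c i) / (zee Y)%:R)).
  rewrite big_seq [RHS]big_seq; apply: eq_bigr => Y; rewrite mem_partitions => /eqP Yn.
  rewrite -mulr_suml -natr_sum -sumn_count -/(ydsize Y) ?Yn// => k kY; apply/andP; split.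
    by case: k kY => // Y0; move: (yd_notin0 Y); rewrite Y0.
  by rewrite -Yn /ydsize sumnE (big_rem k)//= leq_addr.
rewrite exchange_big /=; apply: eq_bigr => k _.
rewrite (bigID (fun Y : youngdiag => k.+1 \in yd_rows Y))/= [X in _ + X]big1 ?addr0; last first.
  by move=> Y kY; rewrite (count_memPn kY) muln0 mul0r.
rewrite -big_filter (perm_big _ (perm_partitions_row (ltn_ord k))) /= big_map mulr_sumr.
apply: eq_bigr => Y _; have p := insert_row_perm k Y.
rewrite (permP p) (perm_big _ p) (zee_perm p) zee_cons /= eqxx big_cons add1n !natrM.
have z0 : (zee Y)%:R != 0 :> R by rewrite pnatr_eq0 -lt0n zee_gt0.
by field; rewrite z0 !nat1r !pnatr_eq0.
Qed.

Lemma cycle_index_unique c (e : nat -> R) n : e 0%N = 1 ->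
  (forall i, (i < n)%N -> i%:R * e i = \sum_(k < i) c k.+1 * e (i - k.+1)%N) ->
  forall i, (i < n)%N -> e i = cycle_index c i.
Proof.
move=> e0 eN i; elim/ltn_ind: i => -[|i] IH iln; first by rewrite cycle_index0.
have i0 : i.+1%:R != 0 :> R by rewrite pnatr_eq0.
apply: (mulfI i0); rewrite eN// cycle_index_newton; apply: eq_bigr => k _.
by rewrite IH// ?(leq_ltn_trans (leq_subr _ _) iln)// subSS ltnS leq_subr.
Qed.

(** The equation X P' = C P modulo X^n with P(0) = 1: a truncated form of P = exp (sum_k C_k X^k /
    k), for C without constant term. *)
Definition newton_rel n (P C : {poly R}) :=
  P`_0 = 1 /\ forall i, (i < n)%N -> ('X * P^`() - C * P)`_i = 0.

Lemma newton_rel_mul n P Q C E : newton_rel n P C -> newton_rel n Q E ->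
  newton_rel n (P * Q) (C + E).
Proof.
move=> [P0 hP] [Q0 hQ]; split; first by rewrite coef0M P0 Q0 mulr1.
move=> i iln.
have -> : 'X * (P * Q)^`() - (C + E) * (P * Q) =
    ('X * P^`() - C * P) * Q + P * ('X * Q^`() - E * Q).
  by rewrite derivM; ring.
rewrite coefD !coefM !big1 ?addr0// => j _.
  by rewrite hQ ?mulr0// (leq_ltn_trans (leq_subr _ _) iln).
by rewrite hP ?mul0r// (leq_ltn_trans _ iln)// -ltnS.
Qed.

Lemma newton_rel_cycle_index n P C c : newton_rel n P C -> C`_0 = 0 ->
  (forall k, (0 < k < n)%N -> C`_k = c k) -> forall i, (i < n)%N -> P`_i = cycle_index c i.
Proof.
move=> [P0 hP] C0 Cc; apply: cycle_index_unique => // i iln.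
have := hP i iln; rewrite coefB => /eqP; rewrite subr_eq0 coefXM => /eqP.
have -> : (if i == 0%N then 0 else P^`()`_i.-1) = i%:R * P`_i.
  by case: i {iln} => [|i]; rewrite /= ?mul0r// coef_deriv mulr_natl.
move=> ->; rewrite coefM big_ord_recl C0 mul0r add0r; apply: eq_bigr => k _.
by rewrite lift0 Cc//; have := ltn_ord k; lia.
Qed.

Definition genpoly c n : {poly R} := \poly_(i < n) cycle_index c i.
Definition logpoly c n : {poly R} := \poly_(i < n) (if i == 0%N then 0 else c i).

Lemma newton_rel_genpoly c n : (0 < n)%N -> newton_rel n (genpoly c n) (logpoly c n).
Proof.
move=> n0; split; first by rewrite coef_poly n0 cycle_index0.
move=> i iln; rewrite coefB coefXM.
have -> : (if i == 0%N then 0 else (genpoly c n)^`()`_i.-1) = i%:R * cycle_index c i.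
  case: i iln => [|i] iln; rewrite /= ?mul0r// coef_deriv coef_poly iln mulr_natl//.
rewrite cycle_index_newton coefM big_ord_recl !coef_poly n0 /= mul0r add0r.
apply/eqP; rewrite subr_eq0; apply/eqP; apply: eq_bigr => k _.
have := ltn_ord k => ki.
by rewrite /bump leq0n add1n !coef_poly (leq_ltn_trans ki iln) (leq_ltn_trans (leq_subr _ _) iln).
Qed.

(** Exponentials multiply when their exponents add, by the Leibniz rule in [newton_rel_mul];
    truncating at degree n.+1 leaves the coefficient of degree n intact. *)
Lemma coef_prod_genpoly (I : finType) (c : I -> nat -> R) n :
  (\prod_(a : I) genpoly (c a) n.+1)`_n = cycle_index (fun k => \sum_(a : I) c a k) n.
Proof.
have h : newton_rel n.+1 (\prod_(a : I) genpoly (c a) n.+1) (\sum_(a : I) logpoly (c a) n.+1).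
  apply: (big_rec2 (newton_rel n.+1)).
    split; first by rewrite coef1.
    by move=> i _; rewrite derivC mulr0 mul0r subr0 coef0.
  by move=> a P C _ PC; apply: newton_rel_mul PC; exact: newton_rel_genpoly.
apply: (newton_rel_cycle_index h) => //.
- by rewrite coef_sum big1// => a _; rewrite coef_poly.
- by move=> k /andP[k0 kn]; rewrite coef_sum; apply: eq_bigr => a _; rewrite coef_poly kn gtn_eqF.
Qed.

End CycleIndex.

(** * Sums over N-tuples of Young diagrams *)

Section DiagramTuples.
Variable N : nat.

Let diag n (i : 'I_(size (diagrams_upto n))) := tnth (in_tuple (diagrams_upto n)) i.

Let diag_inj n : injective (@diag n).
Proof. by apply/tuple_uniqP; exact: uniq_diagrams_upto. Qed.

(** Each component of a tuple with n boxes has at most n boxes, so it is encoded by its position in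
    [diagrams_upto n]; the encoded tuples form a finite type. *)
Definition tuple_seq n : seq {ffun 'I_N -> youngdiag} :=
  [seq [ffun a => diag (f a)] | f : {ffun 'I_N -> 'I_(size (diagrams_upto n))} <-
       enum {: {ffun 'I_N -> 'I_(size (diagrams_upto n))}} &
     (\sum_(a < N) ydsize (diag (f a)) == n)%N].

Lemma uniq_tuple_seq n : uniq (tuple_seq n).
Proof.
rewrite map_inj_uniq ?filter_uniq -?enumT ?enum_uniq// => f g /ffunP fg; apply/ffunP => a.
by have := fg a; rewrite !ffunE => /diag_inj.
Qed.

Lemma diagram_tuplesE n : diagram_tuples n = [set` tuple_seq n].
Proof.
apply/seteqP; split => Y /=; rewrite /diagram_tuples /=.
  move=> Yn; apply/mapP.
  have YL a : Y a \in diagrams_upto n.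
    by rewrite mem_diagrams_upto -Yn (bigD1 a)//= leq_addr.
  have h a : exists i : 'I_(size (diagrams_upto n)), diag i = Y a.
    by have /tnthP[i ->] : Y a \in in_tuple (diagrams_upto n) by []; exists i.
  have [f fE] := choice h.
  exists [ffun a => f a].
    rewrite mem_filter mem_enum andbT; apply/eqP; rewrite -[RHS]Yn; apply: eq_bigr => a _.
    by rewrite ffunE fE.
  by apply/ffunP => a; rewrite !ffunE fE.
move=> /mapP[f]; rewrite mem_filter mem_enum andbT => /eqP fn ->; rewrite -[RHS]fn.
by apply: eq_bigr => a _; rewrite ffunE.
Qed.

Lemma sum_diagram_tuples (R : realType) n (G : {ffun 'I_N -> youngdiag} -> R) :
  \sum_(Y \in diagram_tuples n) G Y = \sum_(Y <- tuple_seq n) G Y.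
Proof. by rewrite diagram_tuplesE -fsbig_seq ?uniq_tuple_seq. Qed.

(** Both sides are the coefficient of degree n in the product of the N generating polynomials:
    distributivity expands this product over the tuples. *)
Lemma sum_prod_tuple_seq (R : realType) (F : 'I_N -> youngdiag -> R) c n :
  (forall a m, \sum_(Y <- partitions m) F a Y = cycle_index (c a) m) ->
  \sum_(Y <- tuple_seq n) \prod_(a < N) F a (Y a) =
  cycle_index (fun k => \sum_(a < N) c a k) n.
Proof.
move=> Fc; rewrite -coef_prod_genpoly.
have genE a : genpoly (c a) n.+1 =
    \sum_(i < size (diagrams_upto n)) F a (diag i) *: 'X^(ydsize (diag i)).
  rewrite -(big_tnth _ _ (diagrams_upto n) predT (fun Y => F a Y *: 'X^(ydsize Y))).
  apply/polyP => k; rewrite coef_sum coef_poly.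
  under eq_bigr do rewrite coefZ coefXn mulr_natr mulrb eq_sym.
  rewrite -big_mkcond -big_filter; case: ltnP => kn.
    rewrite -Fc; apply: perm_big; apply: uniq_perm.
    - exact: uniq_partitions.
    - by apply: filter_uniq; exact: uniq_diagrams_upto.
    move=> Y; rewrite mem_partitions mem_filter mem_diagrams_upto.
    by case: eqP => //= ->; rewrite -ltnS kn.
  rewrite big1_seq// => Y; rewrite mem_filter mem_diagrams_upto => /andP[_ /andP[/eqP Yk]].
  by rewrite Yk => /(leq_trans kn); rewrite ltnn.
under eq_bigr do rewrite genE.
rewrite bigA_distr_bigA /= coef_sum big_map big_filter big_enum_cond /= [LHS]big_mkcond /=.
apply: eq_bigr => f _; rewrite scaler_prod -expr_sum coefZ coefXn eq_sym /=.
case: eqP => _; rewrite ?mulr0// mulr1; apply: eq_bigr => a _.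
by rewrite ffunE.
Qed.
End DiagramTuples.

(** * The Cauchy identity for Jack polynomials *)

Section Polynomials.
Variable R : realType.

Lemma poly_eq0_nat (P : {poly R}) : (forall n : nat, P.[n%:R] = 0) -> P = 0.
Proof.
move=> P0; apply: (@roots_geq_poly_eq0 _ _ [seq i%:R | i <- iota 0 (size P)]).
- by apply/allP => _ /mapP[i _ ->]; apply/rootP.
- by rewrite map_inj_uniq ?iota_uniq//; exact: mulrIn.
- by rewrite size_map size_iota.
Qed.

Lemma poly_eq0 (P : {poly R}) : (forall x, P.[x] = 0) -> P = 0.
Proof. by move=> P0; apply: poly_eq0_nat. Qed.

(** Uniqueness of expansions in base B. It allows monomials in several variables to be told apart
    after the substitution of u^(B^i) for the i-th variable, which leaves polynomials in one
    variable u. *)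
Lemma digits_inj B n (d e : nat -> nat) :
  (forall i, i < n -> d i < B)%N -> (forall i, i < n -> e i < B)%N ->
  (\sum_(i < n) d i * B ^ i = \sum_(i < n) e i * B ^ i)%N ->
  forall i, (i < n)%N -> d i = e i.
Proof.
elim: n d e => // n IH d e dB eB.
rewrite !big_ord_recl /= !expn0 !muln1.
have shift f : (\sum_(i < n) f (bump 0 i) * B ^ bump 0 i = (\sum_(i < n) f i.+1 * B ^ i) * B)%N.
  by rewrite big_distrl /=; apply: eq_bigr => i _; rewrite /bump /= add1n expnSr mulnA.
rewrite !shift => de.
have d0 : d 0%N = e 0%N.
  have := congr1 (modn^~ B) de; rewrite /= ![(_ + _ * B)%N]addnC !modnMDl.
  by rewrite !modn_small; [|exact: (eB 0%N)|exact: (dB 0%N)].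
have B0 : (0 < B)%N by apply: leq_ltn_trans (dB 0%N isT).
case=> // i iln; apply: (IH (fun i => d i.+1) (fun i => e i.+1)) => // [j jn|j jn|].
- exact: (dB j.+1).
- exact: (eB j.+1).
move: de; rewrite d0 => /addnI/eqP; rewrite eqn_pmul2r// => /eqP; exact.
Qed.

End Polynomials.

(** * Algebraic independence of the power sums *)

Section PowerSums.
Variable R : realType.
Implicit Types (L : seq youngdiag) (a : youngdiag -> R).

Definition powersum_comb L a (g : nat -> R) : R :=
  \sum_(lam <- L) a lam * \prod_(k <- yd_rows lam) g k.

Lemma eq_powersum_comb L a g h :
  (forall lam, lam \in L -> forall k, k \in yd_rows lam -> g k = h k) ->
  powersum_comb L a g = powersum_comb L a h.
Proof.
move=> gh; rewrite /powersum_comb big_seq [RHS]big_seq; apply: eq_bigr => lam lamL.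
by congr (_ * _); rewrite big_seq [RHS]big_seq; apply: eq_bigr => k; exact: gh.
Qed.

Lemma row_bound (Y : youngdiag) k : k \in yd_rows Y -> (0 < k <= ydsize Y)%N.
Proof.
move=> kY; apply/andP; split; last by rewrite /ydsize sumnE (big_rem k)//= leq_addr.
by case: k kY => // Y0; move: (yd_notin0 Y); rewrite Y0.
Qed.

Lemma powersum_comb_line L a (g h : nat -> R) :
  exists P : {poly R}, forall u, P.[u] = powersum_comb L a (fun k => g k + u * h k).
Proof.
exists (\sum_(lam <- L) a lam *: \prod_(k <- yd_rows lam) ((g k)%:P + h k *: 'X)) => u.
rewrite horner_sum; apply: eq_bigr => lam _; rewrite hornerZ horner_prod; congr (_ * _).
by apply: eq_bigr => k _; rewrite hornerD hornerC hornerZ hornerX mulrC.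
Qed.

Lemma powersum_cat (x y : seq R) k : powersum (x ++ y) k = powersum x k + powersum y k.
Proof. by rewrite /powersum big_cat. Qed.

Lemma powersum_nseq n (t : R) k : powersum (nseq n t) k = n%:R * t ^+ k.
Proof. by rewrite /powersum big_nseq iter_addr addr0 mulr_natl. Qed.

Section Independence.
Variables (L : seq youngdiag) (a : youngdiag -> R).
Hypothesis uL : uniq L.
Hypothesis a0 : forall x : seq R, powersum_comb L a (powersum x) = 0.

(* Repeating an entry m times adds m (t^k)_k to the power sums, and a
   polynomial in m which vanishes on the integers vanishes. *)
Let vanish_span m (c t : nat -> R) (x : seq R) :
  powersum_comb L a (fun k => \sum_(j < m) c j * t j ^+ k + powersum x k) = 0.
Proof.
elim: m x => [|m IH] x.
  by under eq_fun do rewrite big_ord0 add0r.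
have [P PE] := powersum_comb_line L a
  (fun k => \sum_(j < m) c j * t j ^+ k + powersum x k) (fun k => t m ^+ k).
have P0 : P = 0.
  apply: poly_eq0_nat => n; rewrite PE; apply: etrans (IH (nseq n (t m) ++ x)).
  by apply: eq_powersum_comb => *; rewrite powersum_cat powersum_nseq; ring.
have := PE (c m); rewrite P0 horner0 => /esym; apply: etrans; apply: eq_powersum_comb => *.
by rewrite big_ord_recr /= addrAC.
Qed.

(** Only the values g 1, ..., g n matter, n being the largest size in L. The Vandermonde matrix of
    the points 1, ..., n is invertible, so these values are a linear combination of the sequences
    (t^k)_k, to which [vanish_span] applies. *)
Let vanish g : powersum_comb L a g = 0.
Proof.
pose n := (\max_(lam <- L) ydsize lam)%N.
pose t : 'rV[R]_n := \row_j j.+1%:R.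
have t0 j : t 0 j != 0 by rewrite mxE pnatr_eq0.
have Vu : Vandermonde n t \in unitmx.
  rewrite unitmxE det_Vandermonde unitfE; apply/prodf_neq0 => i _; apply/prodf_neq0 => j ij.
  by rewrite !mxE subr_eq0 eqr_nat eqSS neq_ltn ij orbT.
pose c := invmx (Vandermonde n t) *m (\col_(k < n) g k.+1).
have cE (k : 'I_n) : \sum_(j < n) c j 0 * t 0 j ^+ k = g k.+1.
  have /matrixP/(_ k 0) := mulKVmx Vu (\col_(k < n) g k.+1).
  rewrite [RHS]mxE => <-; rewrite -/c mxE; apply: eq_bigr => j _.
  by rewrite mulrC [Vandermonde _ _ _ _]mxE.
(* The Vandermonde matrix starts at exponent 0, the power sums at exponent 1; dividing by the
   nonzero point shifts the exponent by one. *)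
pose c' j := if insub j is Some j' then c j' 0 / t 0 j' else 0.
apply: etrans (@vanish_span n c' (fun j => j.+1%:R) [::]).
apply: eq_powersum_comb => lam lamL [|k] /row_bound/andP[// _ kn].
have {}kn : (k < n)%N by apply: leq_trans kn _; rewrite /n (big_rem lam)//= leq_maxl.
rewrite /powersum big_nil addr0 -(cE (Ordinal kn)); apply: eq_bigr => j _.
rewrite /c' insubT//= => jn; rewrite (_ : Sub _ _ = j); last exact: val_inj.
by have := t0 j; rewrite mxE /= exprS => tj; field.
Qed.

(** Put p_k = u^(B^k) with B larger than every row and every multiplicity of the diagrams in L. The
    product p_lambda becomes a power of u whose exponent has the multiplicities of lambda as digits
    in base B, so distinct diagrams give distinct powers. *)
Lemma powersum_independent lam : lam \in L -> a lam = 0.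
Proof.
move=> lamL; pose n := (\max_(mu <- L) ydsize mu)%N; pose B := n.+1.
have Ln mu : mu \in L -> (ydsize mu <= n)%N.
  by move=> muL; rewrite /n (big_rem mu)//= leq_maxl.
pose w (mu : youngdiag) := (\sum_(k <- yd_rows mu) B ^ k)%N.
have wE mu : mu \in L -> w mu = (\sum_(k < B) count_mem (k : nat) (yd_rows mu) * B ^ k)%N.
  move=> muL; have : {in yd_rows mu, forall k, k < B}%N.
    by move=> k /row_bound/andP[_ km]; rewrite ltnS; apply: leq_trans (Ln _ muL).
  rewrite /w; elim: (yd_rows mu) => [|k s IH] kB.
    by rewrite big_nil big1.
  rewrite big_cons IH; last by move=> j js; apply: kB; rewrite in_cons js orbT.
  under [RHS]eq_bigr do rewrite /= mulnDl.
  rewrite [RHS]big_split; congr addn.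
  rewrite (bigD1 (Ordinal (kB k (mem_head _ _))))//= eqxx mul1n big1 ?addn0// => j jk.
  by rewrite eq_sym (_ : (j == k :> nat) = false)//; exact: negbTE.
have w_inj mu : mu \in L -> w mu = w lam -> mu = lam.
  move=> muL; rewrite !wE// => we; apply: yd_inj; apply/allP => k kml.
  have size_le nu : nu \in L -> forall i, (count_mem i (yd_rows nu) < B)%N.
    move=> nuL i; rewrite ltnS; apply: leq_trans (Ln nu nuL).
    apply: leq_trans (count_size _ _) _; rewrite /ydsize.
    have := yd_notin0 nu; elim: (yd_rows nu) => //= j s IH.
    by rewrite in_cons negb_or => /andP[j0 /IH]; lia.
  apply/eqP; apply: (@digits_inj B B (fun i => count_mem i (yd_rows mu))
    (fun i => count_mem i (yd_rows lam)) _ _ we k) => [i _|i _|]; [exact: size_le|exact: size_le|].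
  rewrite ltnS; move: kml; rewrite mem_cat => /orP[] /row_bound/andP[_ kb].
    exact: leq_trans (Ln _ muL).
  exact: leq_trans (Ln _ lamL).
have : \sum_(mu <- L) a mu *: 'X^(w mu) = 0 :> {poly R}.
  apply: poly_eq0 => u; rewrite horner_sum; apply: etrans (vanish (fun k => u ^+ (B ^ k))).
  apply: eq_bigr => mu _; rewrite hornerZ hornerXn; congr (_ * _).
  by rewrite /w expr_sum.
move=> /(congr1 (fun P : {poly R} => P`_(w lam))); rewrite coef0 coef_sum => <-.
rewrite (bigD1_seq lam)//= coefZ coefXn eqxx mulr1 big1_seq ?addr0// => mu /andP[mulam muL].
rewrite coefZ coefXn; case: eqP => [/esym/(w_inj mu muL) ml|_]; last by rewrite mulr0.
by rewrite ml eqxx in mulam.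
Qed.

End Independence.

Lemma powersum_scale (s : R) (x : seq R) k :
  powersum [seq s * t | t <- x] k = s ^+ k * powersum x k.
Proof.
by rewrite /powersum big_map mulr_sumr; apply: eq_bigr => t _; rewrite exprMn.
Qed.

(** For fixed x both sides are polynomials in s. Comparing the coefficients of s^|lam| shows that
    the part of that degree vanishes at every x, and independence applies to it. *)
Lemma homogeneous_support L a n : uniq L ->
  (forall (s : R) (x : seq R), powersum_comb L a (powersum [seq s * t | t <- x]) =
     s ^+ n * powersum_comb L a (powersum x)) ->
  forall lam, lam \in L -> ydsize lam != n -> a lam = 0.
Proof.
move=> uL hom lam lamL lamn.
pose b mu := if ydsize mu == ydsize lam then a mu else 0.
suff : b lam = 0 by rewrite /b eqxx.
apply: (powersum_independent uL) => // x.
pose P : {poly R} := \sum_(mu <- L) (a mu * \prod_(k <- yd_rows mu) powersum x k) *: 'X^(ydsize mu)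
  - powersum_comb L a (powersum x) *: 'X^n.
have P0 : P = 0.
  apply: poly_eq0 => s; rewrite hornerD hornerN hornerZ hornerXn horner_sum.
  apply/eqP; rewrite subr_eq0 mulrC -hom; apply/eqP/eq_bigr => mu _.
  rewrite hornerZ hornerXn -mulrA; congr (_ * _).
  under [RHS]eq_bigr do rewrite powersum_scale.
  by rewrite big_split /= mulrC -expr_sum -sumnE.
have := congr1 (fun Q : {poly R} => Q`_(ydsize lam)) P0.
rewrite coef0 coefB coefZ coefXn (negbTE lamn) mulr0 subr0 coef_sum => <-.
apply: eq_bigr => mu _; rewrite coefZ coefXn /b eq_sym.
by case: eqP => _; rewrite ?mul0r ?mulr0// mulr1.
Qed.

End PowerSums.

(** * Orthogonality of Jack polynomials and their reproducing kernel *)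

Section Jack.
Variables (R : realType) (beta : R) (J : youngdiag -> symfun R).
Hypotheses (beta_gt0 : 0 < beta) (hJ : is_jack beta J).
Implicit Types (Y : youngdiag) (F : symfun R).

Lemma eval_powersumsE F g : eval_powersums F g = powersum_comb (finsupp F) F g.
Proof. by []. Qed.

Lemma monomial_sym_scale (mu : seq nat) (s : R) (x : seq R) :
  monomial_sym mu [seq s * t | t <- x] = s ^+ sumn mu * monomial_sym mu x.
Proof.
rewrite /monomial_sym size_map; case: ifP => mux; last by rewrite mulr0.
rewrite mulr_sumr big_seq [RHS]big_seq; apply: eq_bigr => al.
rewrite mem_permutations => p.
have {p} -> : sumn mu = (\sum_(i < size x) nth 0 al i)%N.
  have := perm_size p; rewrite size_cat size_nseq subnKC// => <-.
  transitivity (sumn (mu ++ nseq (size x - size mu) 0%N)); first by rewrite sumn_cat sumn_nseq addn0.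
  by rewrite !sumnE -(perm_big _ p) (big_nth 0%N) big_mkord.
rewrite expr_sum -big_split; apply: eq_bigr => i _ /=.
by rewrite (nth_map 0) ?size_map// exprMn.
Qed.

Lemma jack_support Y lam : J Y lam != 0 -> ydsize lam = ydsize Y.
Proof.
move=> JYl; have lamJ : lam \in finsupp (J Y) by rewrite mem_finsupp.
apply/eqP; apply: contraNT JYl => lamY; apply/eqP.
apply: (homogeneous_support (fset_uniq _) _ lamJ lamY) => s x.
have [d [_ dom JE]] := hJ.1 Y.
rewrite -!eval_powersumsE !JE mulr_sumr big_seq [RHS]big_seq; apply: eq_bigr => mu /dom[muY _].
by rewrite monomial_sym_scale mulrCA -/(ydsize mu) muY.
Qed.

(** If J_Y were 0, the combination of the m_mu would vanish at every point. Evaluate it in as many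
    variables as Y has rows, at x_i = u^(B^i) with B > |Y|: by uniqueness of digits, the power of u
    belonging to the monomial x^Y comes from m_Y alone, and its coefficient is d Y = 1. *)
Lemma jack_neq0 Y : exists lam, J Y lam != 0.
Proof.
apply: contrapT => /forallNP J0.
have {}J0 lam : J Y lam = 0 by apply/eqP; have := J0 lam; case: eqP.
have [d [dY dom JE]] := hJ.1 Y.
have {JE} d0 x : \sum_(mu <- finsupp d) d mu * monomial_sym mu x = 0.
  by rewrite -JE /eval_powersums big1// => lam _; rewrite J0 mul0r.
pose l := size Y; pose B := (ydsize Y).+1.
pose P : {poly R} := \sum_(mu <- finsupp d | (size mu <= l)%N)
  \sum_(al <- permutations (mu ++ nseq (l - size mu) 0%N))
    d mu *: 'X^(\sum_(i < l) nth 0%N al i * B ^ i)%N.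
have P0 : P = 0.
  apply: poly_eq0 => u; apply: etrans (d0 [seq u ^+ (B ^ i) | i <- iota 0 l]).
  rewrite horner_sum big_mkcond; apply: eq_bigr => mu _.
  rewrite /monomial_sym size_map size_iota; case: ifP => _; last by rewrite mulr0.
  rewrite horner_sum mulr_sumr; apply: eq_bigr => al _; rewrite hornerZ hornerXn; congr (_ * _).
  rewrite expr_sum; apply: eq_bigr => i _.
  by rewrite (nth_map 0%N) ?size_iota// nth_iota// -exprM mulnC.
have := congr1 (fun Q : {poly R} => Q`_(\sum_(i < l) nth 0%N Y i * B ^ i)%N) P0.
have key mu al : mu \in finsupp d -> (size mu <= l)%N ->
    al \in permutations (mu ++ nseq (l - size mu) 0%N) ->
    (\sum_(i < l) nth 0%N Y i * B ^ i = \sum_(i < l) nth 0%N al i * B ^ i)%N ->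
    al = Y /\ mu = Y.
  move=> mud mul; rewrite mem_permutations => p w.
  have sal : size al = l by rewrite (perm_size p) size_cat size_nseq subnKC.
  have alB i : (i < l)%N -> (nth 0%N al i < B)%N.
    move=> il; rewrite ltnS -(dom mu mud).1 /ydsize.
    have -> : sumn mu = sumn al.
      by rewrite !sumnE (perm_big _ p) -!sumnE sumn_cat sumn_nseq addn0.
    by rewrite sumnE (big_rem (nth 0%N al i)) ?mem_nth ?sal//= leq_addr.
  have YB i : (i < l)%N -> (nth 0%N Y i < B)%N.
    by move=> il; have /andP[] := @row_bound Y _ (mem_nth 0%N il).
  have alY : al = Y.
    apply: (@eq_from_nth _ 0%N) => [|i]; first by rewrite sal.
    by rewrite sal => il; apply/esym/(digits_inj YB alB w).
  split=> //; apply: yd_inj; rewrite -alY perm_sym.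
  (* Any padding of mu would put a zero among the rows of Y. *)
  case: (l - size mu)%N p => [|k p]; first by rewrite cats0.
  have := yd_notin0 Y; rewrite -{1}alY (perm_mem p) mem_cat in_cons eqxx orbT.
  by [].
rewrite coef0 coef_sum big_mkcond => P1.
have Yd : Y \in finsupp d by rewrite mem_finsupp dY oner_eq0.
have /eqP := P1; rewrite (bigD1_seq Y) ?fset_uniq//= leqnn subnn cats0 [X in _ + X]big1_seq ?addr0; last first.
  move=> mu /andP[muY mud]; case: ifP => // mul; rewrite coef_sum big1_seq// => al alp.
  rewrite coefZ coefXn; case: eqP; rewrite ?mulr0// => w.
  by have [_ mE] := key mu al mud mul alp w; rewrite mE eqxx in muY.
rewrite coef_sum (bigD1_seq (yd_rows Y)) ?permutations_uniq ?mem_permutations//=.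
rewrite coefZ coefXn eqxx dY mulr1 [X in _ + X]big1_seq ?addr0 ?oner_eq0// => al /andP[alY alp].
rewrite coefZ coefXn; case: eqP; rewrite ?mulr0// => w.
have [|aE _] := key Y al Yd (leqnn _) _ w; first by rewrite subnn cats0.
by rewrite aE eqxx in alY.
Qed.

Lemma jack_innerE n F G : (forall lam, F lam != 0 -> ydsize lam = n) ->
  jack_inner beta F G =
  \sum_(lam <- partitions n) F lam * G lam * (beta ^- size lam * (zee lam)%:R).
Proof.
move=> Fn; rewrite [RHS](bigID (fun lam => lam \in finsupp F))/= [X in _ + X]big1 ?addr0; last first.
  by move=> lam; rewrite memNfinsupp => /eqP ->; rewrite !mul0r.
rewrite -big_filter; apply: perm_big; apply: uniq_perm.
- exact: fset_uniq.
- by apply: filter_uniq; exact: uniq_partitions.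
move=> lam; rewrite mem_filter mem_partitions; apply/idP/andP => [lamF|[]//].
by split => //; apply/eqP/Fn; rewrite -mem_finsupp.
Qed.

Let weight (lam : youngdiag) : R := beta ^- size lam * (zee lam)%:R.

Let weight_gt0 lam : 0 < weight lam.
Proof. by rewrite mulr_gt0 ?invr_gt0 ?exprn_gt0// ltr0n zee_gt0. Qed.

(** For beta > 0 the power sum products have positive norms, so the form is positive definite.
    Positivity makes the square root in [normalized_jack] square back to the norm. *)
Lemma jack_norm_gt0 Y : 0 < jack_inner beta (J Y) (J Y).
Proof.
have [lam Jlam] := jack_neq0 Y.
rewrite (jack_innerE _ (@jack_support Y)).
have lamY : lam \in partitions (ydsize Y) by rewrite mem_partitions (jack_support Jlam).
rewrite (bigD1_seq lam)//=; last exact: uniq_partitions.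
apply: ltr_wpDr; last by rewrite -expr2 mulr_gt0 ?weight_gt0// exprn_even_gt0.
by apply: sumr_ge0 => mu _; rewrite -expr2 mulr_ge0 ?sqr_ge0// ltW// weight_gt0.
Qed.

(* The Jack polynomials of degree n are an orthogonal basis, as many as the
   power-sum products; so their Gram relation A D A^T = diag(norms) transposes
   to A^T diag(norms)^-1 A = D^-1. *)
Lemma jack_dual n lam mu : lam \in partitions n -> mu \in partitions n ->
  \sum_(Y <- partitions n) J Y lam * J Y mu / jack_inner beta (J Y) (J Y) =
  (lam == mu)%:R / weight mu.
Proof.
move=> lamn mun; pose m := size (partitions n).
pose e (i : 'I_m) := tnth (in_tuple (partitions n)) i.
have e_inj : injective e by apply/tuple_uniqP; exact: uniq_partitions.
have e_size i : ydsize (e i) = n.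
  by apply/eqP; rewrite -mem_partitions; exact: mem_tnth.
have [i lamE] : exists i, lam = e i by have /tnthP := (lamn : lam \in in_tuple (partitions n)).
have [j muE] : exists j, mu = e j by have /tnthP := (mun : mu \in in_tuple (partitions n)).
pose A : 'M[R]_m := \matrix_(a, b) J (e a) (e b).
pose V : 'M[R]_m := \matrix_(a, b) (A a b * weight (e b) / jack_inner beta (J (e a)) (J (e a))).
have VA : V *m A^T = 1%:M.
  apply/matrixP => a b; rewrite !mxE.
  transitivity (jack_inner beta (J (e a)) (J (e b)) / jack_inner beta (J (e a)) (J (e a))).
    rewrite [in RHS](@jack_innerE n); last by move=> nu /jack_support ->.
    rewrite [in RHS]big_tnth mulr_suml; apply: eq_bigr => k _; rewrite !mxE -/(e k) -/(weight _); ring.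
  have [->|ab] := eqVneq a b; first by rewrite divff// gt_eqF// jack_norm_gt0.
  by rewrite (hJ.2 (e a) (e b)) ?mul0r// (inj_eq e_inj).
have /matrixP/(_ i j) := mulmx1C VA; rewrite !mxE => AV.
rewrite lamE muE (inj_eq e_inj) -AV mulr_suml [LHS]big_tnth; apply: eq_bigr => k _.
rewrite !mxE -/(e k); have wj := weight_gt0 (e j); have nk := jack_norm_gt0 (e k).
by field; rewrite !gt_eqF.
Qed.

(** Expand both Jack polynomials in power sums. By [jack_dual] only the terms with equal diagrams
    survive, with coefficient beta^(number of rows) / zee; the power of beta supplies one factor
    beta for each row, as in the cycle index of beta g h. *)
Lemma jack_cauchy n g h :
  \sum_(Y <- partitions n) normalized_jack beta J Y g * normalized_jack beta J Y h =
  cycle_index (fun k => beta * (g k * h k)) n.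
Proof.
have evalE Y f : Y \in partitions n -> eval_powersums (J Y) f =
    \sum_(lam <- partitions n) J Y lam * \prod_(k <- yd_rows lam) f k.
  rewrite mem_partitions => /eqP Yn.
  rewrite [RHS](bigID (fun lam => lam \in finsupp (J Y)))/= [X in _ + X]big1 ?addr0; last first.
    by move=> lam; rewrite memNfinsupp => /eqP ->; rewrite !mul0r.
  rewrite -big_filter; apply: perm_big; apply: uniq_perm.
  - exact: fset_uniq.
  - by apply: filter_uniq; exact: uniq_partitions.
  move=> lam; rewrite mem_filter mem_partitions; apply/idP/andP => [lamF|[]//].
  by split => //; apply/eqP; rewrite -Yn; apply: jack_support; rewrite -mem_finsupp.
transitivity (\sum_(Y <- partitions n) \sum_(lam <- partitions n) \sum_(mu <- partitions n)
    (J Y lam * J Y mu / jack_inner beta (J Y) (J Y)) *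
    (\prod_(k <- yd_rows lam) g k * \prod_(k <- yd_rows mu) h k)).
  rewrite big_seq [RHS]big_seq; apply: eq_bigr => Y Yn.
  rewrite /normalized_jack !evalE// mulrACA -invfM -expr2 sqr_sqrtr; last first.
    by rewrite ltW// jack_norm_gt0.
  rewrite big_distrlr /= mulr_suml; apply: eq_bigr => lam _.
  by rewrite mulr_suml; apply: eq_bigr => mu _; ring.
rewrite exchange_big /cycle_index big_seq [RHS]big_seq; apply: eq_bigr => lam lamn.
rewrite exchange_big /= (bigD1_seq lam)//=; last exact: uniq_partitions.
rewrite -mulr_suml jack_dual// eqxx [X in _ + X]big1_seq ?addr0.
  rewrite !big_split /= big_const_seq count_predT iter_mulr_1 mul1r /weight invfM invrK.
  by rewrite mulrC; ring.
move=> mu /andP[mulam mun]; rewrite -mulr_suml jack_dual//.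
by rewrite eq_sym (negbTE mulam) !mul0r.
Qed.

End Jack.

(** * Products of binomial series *)

Section BinomialBound.
Variable R : realType.
Implicit Types (e : nat -> R) (K n : nat) (x : R).

Definition binom_dominated (A : R) K e :=
  forall n, `|e n| <= A * 'C(n + K, K)%:R.

Lemma hockey_stick K n : (\sum_(i < n) 'C(i + K, K) = 'C(n + K, K.+1))%N.
Proof.
elim: n => [|n IH]; first by rewrite big_ord0 bin_small.
by rewrite big_ord_recr /= IH addSn binS.
Qed.

(** Pascal's rule: multiplication by 1 - x lowers K by one, up to a boundary term. For x >= 0 this
    term may be dropped, which bounds all partial sums by induction on K. *)
Lemma binom_series_partial K m x :
  (1 - x) * \sum_(n < m) 'C(n + K.+1, K.+1)%:R * x ^+ n =
  \sum_(n < m) 'C(n + K, K)%:R * x ^+ n - 'C(m + K, K.+1)%:R * x ^+ m.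
Proof.
elim: m => [|m IH].
  by rewrite !big_ord0 mulr0 bin_small// mul0r subr0.
rewrite !big_ord_recr /= mulrDr IH exprS.
by rewrite addnS addSn binS natrD; ring.
Qed.

Lemma binom_series_bound K m x : 0 <= x < 1 ->
  \sum_(n < m) 'C(n + K, K)%:R * x ^+ n <= (1 - x) ^- K.+1.
Proof.
move=> /andP[x0 x1]; have x1' : 0 < 1 - x by rewrite subr_gt0.
elim: K => [|K IH].
  rewrite -(ler_pM2l x1') expr1 divff ?gt_eqF//.
  under eq_bigr do rewrite addn0 bin0 mul1r.
  have := subrX1 x m; rewrite -[1 - x]opprB mulNr => <-.
  by rewrite opprB lerBlDr lerDl exprn_ge0.
rewrite -(ler_pM2l x1') binom_series_partial exprS invfM mulVKf ?gt_eqF//.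
by apply: le_trans IH; rewrite lerBlDr lerDl mulr_ge0// exprn_ge0.
Qed.

Lemma cvg_binom_series K x : 0 <= x < 1 ->
  cvgn (series (fun n => 'C(n + K, K)%:R * x ^+ n)).
Proof.
move=> x01; have /andP[x0 x1] := x01.
apply: nondecreasing_is_cvgn.
  apply/nondecreasing_seqP => n; rewrite /series /= big_nat_recr//= lerDl.
  by rewrite mulr_ge0// exprn_ge0.
exists ((1 - x) ^- K.+1) => _ [m _ <-].
by rewrite /series /= big_mkord; exact: binom_series_bound.
Qed.

Lemma cvg_dominated_series A K e x : binom_dominated A K e -> `|x| < 1 ->
  cvgn (pseries e x).
Proof.
move=> eA x1; apply: normed_cvg.
have A0 : 0 <= A.
  by have := le_trans (normr_ge0 _) (eA 0%N); rewrite add0n binn mulr1.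
apply: (@series_le_cvg _ _ (fun n => A * ('C(n + K, K)%:R * `|x| ^+ n))).
- by move=> n /=.
- by move=> n; rewrite !mulr_ge0// exprn_ge0.
- by move=> n /=; rewrite normrM normrX mulrA ler_wpM2r ?exprn_ge0.
have xge : 0 <= `|x| < 1 by rewrite normr_ge0.
exact: (@is_cvg_seriesZ _ _ A (@cvg_binom_series K _ xge)).
Qed.

Lemma binom_dominated_diffs A K e : binom_dominated A K e ->
  binom_dominated (A * K.+1%:R) K.+1 (pseries_diffs e).
Proof.
move=> eA n; rewrite /pseries_diffs normrM normr_nat.
apply: le_trans (ler_wpM2l (ler0n _ _) (eA n.+1)) _.
rewrite mulrCA -mulrA ler_wpM2l//.
  by have := le_trans (normr_ge0 _) (eA 0%N); rewrite add0n binn mulr1.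
by rewrite -!natrM ler_nat -addSnnS mul_bin_left addnK mulnC.
Qed.

Lemma is_derive_dominated A K e x : binom_dominated A K e -> `|x| < 1 ->
  is_derive x 1 (fun y => limn (pseries e y)) (limn (pseries (pseries_diffs e) x)).
Proof.
(* Termwise differentiation needs the series and its first two derived series to converge at a point
   of modulus larger than |x|; the midpoint between |x| and 1 is such a point. *)
move=> eA x1; pose k := (`|x| + 1) / 2.
have k0 : 0 <= k by rewrite divr_ge0// addr_ge0.
have k1 : `|k| < 1 by rewrite ger0_norm// /k; lra.
have xk : `|x| < `|k| by rewrite [X in _ < X]ger0_norm// /k; lra.
have d1 := binom_dominated_diffs eA; have d2 := binom_dominated_diffs d1.
apply: (pseries_snd_diffs _ _ _ xk).
- exact: cvg_dominated_series eA k1.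
- exact: cvg_dominated_series d1 k1.
- exact: cvg_dominated_series d2 k1.
Qed.

End BinomialBound.

(** * Products of binomials as power series *)

Section BinomialProduct.
Variables (R : realType) (K : nat) (fs : seq (R * R)).
Hypothesis fs01 : forall f, f \in fs -> 0 <= f.2 <= 1.
Hypothesis fsK : \sum_(f <- fs) `|f.1| <= K.+1%:R.

(** A pair (b, s) stands for the factor (1 - s q)^(-b), whose logarithm is the sum over k >= 1 of b
    s^k q^k / k. *)
Definition factor_sum k : R := \sum_(f <- fs) f.1 * f.2 ^+ k.

Notation e := (cycle_index factor_sum).

Let factor_sum_le k : `|factor_sum k| <= K.+1%:R.
Proof.
apply: le_trans (ler_norm_sum _ _ _) _; apply: le_trans fsK.
rewrite big_seq [leRHS]big_seq; apply: ler_sum => f /fs01/andP[f0 f1].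
by rewrite normrM ler_piMr// normrX exprn_ile1// ger0_norm.
Qed.

(** By induction in Newton's recursion: since |c_k| <= K + 1, n |e_n| is at most (K + 1) times the
    sum of the 'C(m + K, K) for m < n, that is (K + 1) 'C(n + K, K + 1) = n 'C(n + K, K). *)
Lemma cycle_index_dominated : binom_dominated 1 K e.
Proof.
elim/ltn_ind => n IH; rewrite mul1r; case: n IH => [_|n IH].
  by rewrite cycle_index0 normr1 add0n binn.
have n0 : 0 < n.+1%:R :> R by [].
rewrite -(ler_pM2l n0) -[X in X * `|_|](normr_nat R n.+1) -normrM cycle_index_newton.
apply: le_trans (ler_norm_sum _ _ _) _.
apply: (@le_trans _ _ (\sum_(k < n.+1) K.+1%:R * 'C(n.+1 - k.+1 + K, K)%:R)).
  apply: ler_sum => k _; rewrite normrM ler_pM//.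
  by have := IH (n.+1 - k.+1)%N; rewrite mul1r; apply; rewrite subSS ltnS leq_subr.
rewrite -mulr_sumr -natr_sum -!natrM ler_nat.
have -> : (\sum_(k < n.+1) 'C(n.+1 - k.+1 + K, K) = 'C(n.+1 + K, K.+1))%N.
  by rewrite -hockey_stick [RHS](reindex_inj rev_ord_inj).
by rewrite mul_bin_left addnK.
Qed.

(** Coefficients of s / (1 - s x) times the series of e. They are the contributions of the single
    factors to the derivative of that series. *)
Let conv (s : R) n := \sum_(k < n.+1) s ^+ k.+1 * e (n - k).

Let convS s n : conv s n.+1 = s * e n.+1 + s * conv s n.
Proof.
rewrite /conv big_ord_recl subn0 expr1; congr (_ + _); rewrite mulr_sumr.
by apply: eq_bigr => k _; rewrite lift0 subSS exprS mulrA.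
Qed.

Let conv_dominated (s : R) : 0 <= s <= 1 -> binom_dominated 1 K.+1 (conv s).
Proof.
move=> /andP[s0 s1] n; rewrite mul1r; apply: le_trans (ler_norm_sum _ _ _) _.
apply: (@le_trans _ _ (\sum_(k < n.+1) 'C(n - k + K, K)%:R)).
  apply: ler_sum => k _; rewrite normrM normrX (ger0_norm s0).
  have := cycle_index_dominated (n - k)%N; rewrite mul1r => h.
  by rewrite -[leRHS]mul1r; apply: ler_pM => //; [exact: exprn_ge0|exact: exprn_ile1].
rewrite -natr_sum ler_nat addnS -addSn -hockey_stick [leqRHS](reindex_inj rev_ord_inj).
by rewrite (eq_bigr (fun k : 'I_n.+1 => 'C(n.+1 - k.+1 + K, K))).
Qed.

(** In the limit the recursion [convS] becomes the equation L = s E + s x L, where E is the sum of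
    the series of e; it determines L because s x differs from 1. *)
Let conv_lim (s x : R) : 0 <= s <= 1 -> `|x| < 1 ->
  limn (pseries (conv s) x) = s / (1 - s * x) * limn (pseries e x).
Proof.
move=> s01 x1.
have ce := cvg_dominated_series cycle_index_dominated x1.
have cc := cvg_dominated_series (conv_dominated s01) x1.
have sx : 1 - s * x != 0.
  rewrite subr_eq0 eq_sym lt_eqF//; case/andP: s01 => s0 s1.
  apply: le_lt_trans (ler_norm _) _; rewrite normrM (ger0_norm s0).
  by apply: le_lt_trans x1; rewrite ler_piMl.
have pS f n : pseries f x n.+1 = pseries f x n + f n * x ^+ n.
  by rewrite /pseries /series /= big_nat_recr.
have h m : pseries (conv s) x m.+1 = s * pseries e x m.+1 + s * x * pseries (conv s) x m.
  elim: m => [|m IH].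
    by rewrite !pS /pseries /series /= !big_geq// /conv big_ord1; ring.
  by rewrite (pS (conv s) m.+1) {1}IH convS (pS e m.+1) (pS (conv s) m) exprS; ring.
have E : limn (pseries (conv s) x) =
    s * limn (pseries e x) + s * x * limn (pseries (conv s) x).
  apply: cvg_lim => //; rewrite -cvg_shiftS.
  rewrite [X in X @ _ --> _](_ : _ = (fun m => s * pseries e x m.+1 + s * x * pseries (conv s) x m)).
    apply: cvgD; apply: cvgMr => //; rewrite ?cvg_shiftS//.
  by apply/funext => m; rewrite -h.
by apply: (mulfI sx); rewrite mulrBl mul1r {1}E addrK mulrA mulrCA mulfV// mulr1.
Qed.

Definition binom_product x : R := \prod_(f <- fs) (1 - f.2 * x) `^ (- f.1).

Let log_factors x : R := \sum_(f <- fs) f.1 * ln (1 - f.2 * x).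

Let base_gt0 (s x : R) : 0 <= s <= 1 -> 0 <= x < 1 -> 0 < 1 - s * x.
Proof.
move=> /andP[s0 s1] /andP[x0 x1]; rewrite subr_gt0.
by apply: le_lt_trans x1; rewrite ler_piMl.
Qed.

Let is_derive_log_factors (x : R) : 0 <= x < 1 ->
  is_derive x 1 log_factors (- \sum_(f <- fs) f.1 * (f.2 / (1 - f.2 * x))).
Proof.
move=> x01; rewrite /log_factors; elim: fs fs01 => [|f l IH] l01.
  rewrite big_nil oppr0; under eq_fun do rewrite big_nil.
  exact: is_derive_cst.
under eq_fun do rewrite big_cons.
rewrite big_cons opprD; apply: is_deriveD; last first.
  by apply: IH => g gl; apply: l01; rewrite in_cons gl orbT.
have b0 := base_gt0 (l01 f (mem_head _ _)) x01.
have dl : is_derive x 1 (fun y : R => 1 - f.2 * y) (- f.2).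
  have d1 : is_derive x 1 (fun y : R => f.2 * y) f.2.
    by apply: is_derive_eq; rewrite [_ *: _]mulr1.
  by apply: is_derive_eq; rewrite add0r mul1r.
have dln := @is_derive1_comp _ (@ln R) (fun y : R => 1 - f.2 * y) x _ _ (is_derive1_ln b0) dl.
apply: is_derive_eq.
by rewrite /GRing.scale /=; field; rewrite gt_eqF.
Qed.

Let diffs_lim (x : R) : 0 <= x < 1 -> limn (pseries (pseries_diffs e) x) =
  \sum_(f <- fs) f.1 * (f.2 / (1 - f.2 * x)) * limn (pseries e x).
Proof.
move=> /andP[x0 x1]; have xn : `|x| < 1 by rewrite ger0_norm.
have -> : pseries_diffs e = fun n => \sum_(f <- fs) f.1 * conv f.2 n.
  apply/funext => n; rewrite /pseries_diffs cycle_index_newton.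
  under eq_bigr do rewrite mulr_suml.
  rewrite exchange_big /=; apply: eq_bigr => f _; rewrite /conv mulr_sumr.
  by apply: eq_bigr => k _; rewrite subSS mulrA.
apply: cvg_lim => //.
elim: fs fs01 => [|f l IH] l01.
  rewrite big_nil (_ : pseries _ x = cst 0); first exact: cvg_cst.
  by apply/funext => n; rewrite /pseries /series /= big1// => k _; rewrite big_nil mul0r.
rewrite big_cons (_ : pseries _ x = (fun m => f.1 * pseries (conv f.2) x m +
    pseries (fun n => \sum_(g <- l) g.1 * conv g.2 n) x m)); last first.
  apply/funext => m; rewrite /pseries /series /= mulr_sumr -big_split.
  by apply: eq_bigr => k _; rewrite big_cons /= mulrDl mulrA.
have f01 := l01 f (mem_head _ _).
apply: cvgD; last by apply: IH => g gl; apply: l01; rewrite in_cons gl orbT.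
rewrite -mulrA -conv_lim//; apply: cvgMr => //.
exact: cvg_dominated_series (conv_dominated f01) xn.
Qed.

(* Newton's recursion says that both sides solve
   f' = (sum_j b_j s_j / (1 - s_j x)) f. *)
Lemma cycle_index_gen (x : R) : 0 <= x < 1 -> limn (pseries e x) = binom_product x.
Proof.
move=> x01; have /andP[x0 x1] := x01.
(* [G] is the quotient of the two sides, the binomial product being expR (- log_factors); it has
   derivative 0 and value 1 at 0. *)
pose G y := limn (pseries e y) * expR (log_factors y).
have dG (y : R) : 0 <= y < 1 -> is_derive y 1 G 0.
  move=> y01; have /andP[y0 y1] := y01; have yn : `|y| < 1 by rewrite ger0_norm.
  have df := is_derive_dominated cycle_index_dominated yn.
  have dL := @is_derive1_comp _ (@expR R) log_factors y _ _
    (is_derive_expR _) (is_derive_log_factors y01).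
  apply: is_derive_eq.
  rewrite diffs_lim// /GRing.scale /= -mulr_suml; ring.
have [c _] : exists2 c, c \in `[0, x] & G x - G 0 = 0 * (x - 0).
  apply: (@MVT_segment _ _ (cst 0)) => //.
    move=> y; rewrite in_itv /= => /andP[y0 yx]; apply: dG.
    by rewrite (ltW y0) (lt_trans yx).
  apply: derivable_within_continuous => y; rewrite in_itv /= => /andP[y0 yx].
  by apply: ex_derive; apply: dG; rewrite y0 (le_lt_trans yx).
have -> : G 0 = 1.
  rewrite /G /log_factors big1; last by move=> f _; rewrite mulr0 subr0 ln1 mulr0.
  rewrite expR0 mulr1; apply: cvg_lim => //; rewrite -cvg_shiftS.
  rewrite [X in X @ _ --> _](_ : _ = cst 1); first exact: cvg_cst.
  apply/funext => n; rewrite /pseries /series /= big_nat_recl//= expr0 mulr1 cycle_index0.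
  by rewrite big1 ?addr0// => k _; rewrite expr0n mulr0.
rewrite mul0r => /eqP; rewrite subr_eq0 /G => /eqP G1.
rewrite -[LHS]mulr1 -(expRxMexpNx_1 (log_factors x)) mulrA G1 mul1r.
rewrite /log_factors -sumrN expR_sum /binom_product big_seq [RHS]big_seq.
apply: eq_bigr => f ffs; rewrite /powR gt_eqF ?base_gt0 ?fs01// mulNr//.
Qed.

End BinomialProduct.

(** The error is dominated by the tail of the series of (1 - q)^-(K+1), so [eps] depends only on K
    and q and is shared by all lists of factors, hence by all configurations. *)
Lemma binom_product_uniform (R : realType) (K : nat) (q : R) : 0 <= q < 1 ->
  exists2 eps : nat -> R, eps n @[n --> \oo] --> 0 &
  forall fs : seq (R * R), (forall f, f \in fs -> 0 <= f.2 <= 1) ->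
    \sum_(f <- fs) `|f.1| <= K.+1%:R -> forall m,
    `|binom_product fs q - \sum_(n < m) q ^+ n * cycle_index (factor_sum fs) n| <= eps m.
Proof.
move=> q01; have /andP[q0 q1] := q01; have qn : `|q| < 1 by rewrite ger0_norm.
pose S := series (fun n => 'C(n + K, K)%:R * q ^+ n).
have cS : cvgn S := @cvg_binom_series R K q q01.
exists (fun m => limn S - S m).
  by rewrite -(subrr (limn S)); apply: cvgB => //; exact: cvg_cst.
move=> fs fs01 fsK m; rewrite -(cycle_index_gen fs01 fsK q01).
have dom := cycle_index_dominated fs01 fsK.
pose P := pseries (cycle_index (factor_sum fs)) q.
have cP : cvgn P := cvg_dominated_series dom qn.
have -> : \sum_(n < m) q ^+ n * cycle_index (factor_sum fs) n = P m.
  by rewrite /P /pseries /series /= big_mkord; apply: eq_bigr => n _; rewrite mulrC.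
have : `|P n - P m| @[n --> \oo] --> `|limn P - P m|.
  by apply: cvg_norm; apply: cvgB => //; exact: cvg_cst.
have : S n - S m @[n --> \oo] --> limn S - S m.
  by apply: cvgB => //; exact: cvg_cst.
move=> h2 h1; apply: ler_cvg_to h1 h2 _.
near=> n; have mn : (m <= n)%N by near: n; exact: nbhs_infty_ge.
have split (u : nat -> R) : series u n - series u m = \sum_(m <= k < n) u k.
  by rewrite /series /= (@big_cat_nat _ _ _ m)//= addrAC subrr add0r.
rewrite /P /S /pseries !split; apply: le_trans (ler_norm_sum _ _ _) _.
apply: ler_sum => k _; rewrite normrM normrX (ger0_norm q0) ler_wpM2r ?exprn_ge0//.
by have := dom k; rewrite mul1r.
Unshelve. all: by end_near.
Qed.

(** * Weighted averages *)

Section WeightedIntegral.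
Context {R : realType} {I : eqType}.
Variables (D : I -> set R) (s : seq I) (x0 : I -> R) (w : (I -> R) -> R).
Notation T := (measurableTypeR R).
Hypothesis mD : forall i, measurable (D i : set T).
Hypothesis mw : config_measurable (EFin \o w).
Hypothesis w0 : forall y, 0 <= w y.
Hypothesis w_fin : (iterated_integral D s (EFin \o w) x0 < +oo)%E.

Definition weighted_integral (h : (I -> R) -> R) : \bar R :=
  iterated_integral D s (fun y => (w y * h y)%:E) x0.

Definition bounded_by K (h : (I -> R) -> R) :=
  forall y, reachable D s x0 y -> `|h y| <= K.

Let mwh h : config_measurable (EFin \o h) -> config_measurable (fun y => (w y * h y)%:E).
Proof.
move=> mh d X x mx; under eq_fun do rewrite EFinM.
by apply: emeasurable_funM; [exact: mw|exact: mh].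
Qed.

Let mKw (K : R) : config_measurable (fun y => (K * w y)%:E).
Proof.
move=> d X x mx; under eq_fun do rewrite EFinM.
by apply: measurable_funeM; exact: mw.
Qed.

Let total_ge0 : (0 <= iterated_integral D s (EFin \o w) x0)%E.
Proof. by apply: iterated_integral_ge0 => y; rewrite lee_fin. Qed.

Let total_fin : iterated_integral D s (EFin \o w) x0 \is a fin_num.
Proof. by rewrite ge0_fin_numE. Qed.

Let scaled_total (K : R) : 0 <= K -> iterated_integral D s (fun y => (K * w y)%:E) x0 =
  (K%:E * iterated_integral D s (EFin \o w) x0)%E.
Proof.
move=> K0.
have := @iterated_integralZD _ _ D s K 0 (EFin \o w) (EFin \o w) (EFin \o w) x0 mD mw mw mw.
rewrite mul0e adde0 => <- //.
- by apply: eq_iterated_integral => y _; rewrite /= mul0e adde0.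
- by move=> y _; rewrite /= lee_fin ger0_norm.
- by move=> y _; rewrite /= lee_fin ger0_norm.
Qed.

Lemma weighted_integral_le K h : 0 <= K -> config_measurable (EFin \o h) ->
  bounded_by K h ->
  (`|weighted_integral h| <= K%:E * iterated_integral D s (EFin \o w) x0)%E.
Proof.
move=> K0 mh hK; rewrite -scaled_total//; apply: le_iterated_integral_abs => //.
- exact: mwh.
- by move=> y; rewrite lee_fin mulr_ge0.
- by move=> y r; rewrite lee_fin normrM (ger0_norm (w0 y)) mulrC ler_wpM2r// hK.
Qed.

Lemma weighted_integral_fin_num K h : config_measurable (EFin \o h) ->
  bounded_by K h -> weighted_integral h \is a fin_num.
Proof.
move=> mh hK.
have hK' : bounded_by `|K| h by move=> y r; apply: le_trans (hK y r) (ler_norm _).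
rewrite fin_num_abs; apply: le_lt_trans (weighted_integral_le _ mh hK') _ => //.
by rewrite lte_mul_pinfty// lee_fin.
Qed.

Lemma weighted_integralZD (a b K : R) f g :
  config_measurable (EFin \o f) -> config_measurable (EFin \o g) ->
  bounded_by K f -> bounded_by K g ->
  weighted_integral (fun y => a * f y + b * g y) =
  (a%:E * weighted_integral f + b%:E * weighted_integral g)%E.
Proof.
move=> mf mg fK gK.
rewrite -(@iterated_integralZD _ _ D s a b _ _ (fun y => (`|K| * w y)%:E))//.
- by apply: eq_iterated_integral => y _; rewrite -!EFinM -EFinD; congr EFin; ring.
- exact: mwh.
- exact: mwh.
- by move=> y; rewrite lee_fin mulr_ge0.
- move=> y r; rewrite lee_fin normrM (ger0_norm (w0 y)) mulrC ler_wpM2r//.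
  by apply: le_trans (ler_norm _); exact: fK.
- move=> y r; rewrite lee_fin normrM (ger0_norm (w0 y)) mulrC ler_wpM2r//.
  by apply: le_trans (ler_norm _); exact: gK.
- by rewrite scaled_total// lte_mul_pinfty// lee_fin.
Qed.

Lemma config_measurable_linear (J : Type) (r : seq J) (a : J -> R) (f : J -> (I -> R) -> R) :
  (forall j, config_measurable (EFin \o f j)) ->
  config_measurable (EFin \o (fun y => \sum_(j <- r) a j * f j y)).
Proof.
move=> mf d X x mx; apply/measurable_EFinP; apply: measurable_sum => j.
by apply: measurable_funM => //; apply/measurable_EFinP; exact: mf.
Qed.

Lemma weighted_integral_sum (J : Type) (r : seq J) (a : J -> R) (f : J -> (I -> R) -> R) :
  (forall j, config_measurable (EFin \o f j)) ->
  (forall j, exists K, bounded_by K (f j)) ->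
  weighted_integral (fun y => \sum_(j <- r) a j * f j y) =
  (\sum_(j <- r) (a j * fine (weighted_integral (f j))))%:E.
Proof.
move=> mf bf; elim: r => [|j r IH].
  rewrite big_nil /weighted_integral.
  have := @weighted_integral_le 0 (fun=> 0) (lexx _) _ _.
  rewrite mul0e => h; apply/eqP; rewrite -abse_eq0 eq_le abse_ge0 andbT.
  under [X in iterated_integral _ _ X]eq_fun do rewrite big_nil.
  apply: h; last by move=> y _; rewrite normr0.
  by move=> d X x mx; exact: measurable_cst.
have [K fK] := bf j.
have [L gL] : exists L, bounded_by L (fun y => \sum_(j <- r) a j * f j y).
  elim: r {IH} => [|i r [L IH]]; first by exists 0 => y _; rewrite big_nil normr0.
  have [K' fK'] := bf i; exists (`|a i| * K' + L) => y ry; rewrite big_cons.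
  apply: le_trans (ler_normD _ _) _; rewrite lerD ?IH// normrM ler_wpM2l//.
  exact: fK'.
rewrite [LHS](_ : _ = weighted_integral (fun y => a j * f j y + 1 * \sum_(j <- r) a j * f j y)).
  rewrite (@weighted_integralZD _ _ (Num.max K L)) ?IH//.
  - by rewrite big_cons mul1e EFinD EFinM fineK//; exact: weighted_integral_fin_num fK.
  - exact: config_measurable_linear.
  - by move=> y ry; rewrite le_max fK.
  - by move=> y ry; rewrite le_max gL// orbT.
by congr weighted_integral; apply/funext => y; rewrite big_cons mul1r.
Qed.

End WeightedIntegral.

(** * Weights that are products over disjoint sets of variables *)

Section WeightedIntegralProduct.
Context {R : realType} {I : eqType}.
Variables (D : I -> set R) (s : seq I) (x0 : I -> R) (P : pred I) (w1 w2 : (I -> R) -> R).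
Notation T := (measurableTypeR R).
Notation s1 := [seq i <- s | P i].
Notation s2 := [seq i <- s | ~~ P i].
Hypothesis mD : forall i, measurable (D i : set T).
Hypotheses (mw1 : config_measurable (EFin \o w1)) (mw2 : config_measurable (EFin \o w2)).
Hypotheses (w1_ge0 : forall y, 0 <= w1 y) (w2_ge0 : forall y, 0 <= w2 y).
Hypothesis w1P : forall i y t, i \in s -> ~~ P i -> w1 (update y i t) = w1 y.
Hypothesis w2P : forall i y t, i \in s -> P i -> w2 (update y i t) = w2 y.
Hypothesis w1_fin : (iterated_integral D s1 (EFin \o w1) x0 < +oo)%E.
Hypothesis w2_fin : (iterated_integral D s2 (EFin \o w2) x0 < +oo)%E.

Notation w := (fun y => w1 y * w2 y).

Let ge0_product f g : config_measurable (EFin \o f) -> config_measurable (EFin \o g) ->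
  (forall y, 0 <= f y) -> (forall y, 0 <= g y) ->
  (forall i y t, i \in s -> ~~ P i -> f (update y i t) = f y) ->
  (forall i y t, i \in s -> P i -> g (update y i t) = g y) ->
  weighted_integral D s x0 w (fun y => f y * g y) =
  (weighted_integral D s1 x0 w1 f * weighted_integral D s2 x0 w2 g)%E.
Proof.
move=> mf mg f0 g0 fP gP; rewrite /weighted_integral -iterated_integralM//.
- by apply: eq_iterated_integral => y _; rewrite -EFinM; congr EFin; ring.
- move=> d X x mx; under eq_fun do rewrite EFinM.
  by apply: emeasurable_funM; [exact: mw1|exact: mf].
- move=> d X x mx; under eq_fun do rewrite EFinM.
  by apply: emeasurable_funM; [exact: mw2|exact: mg].
- by move=> y; rewrite lee_fin mulr_ge0.
- by move=> y; rewrite lee_fin mulr_ge0.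
- by move=> i y t si Pi; rewrite w1P// fP.
- by move=> i y t si Pi; rewrite w2P// gP.
Qed.

Let mone : config_measurable (EFin \o (fun _ : I -> R => 1 : R)).
Proof. by move=> d X x mx; exact: measurable_cst. Qed.

Let one_total (D' : I -> set R) s' w' : weighted_integral D' s' x0 w' (fun=> 1%R) =
  iterated_integral D' s' (EFin \o w') x0.
Proof. by apply: eq_iterated_integral => y _; rewrite mulr1. Qed.

Lemma iterated_integral_product_fin :
  iterated_integral D s (EFin \o w) x0 =
  (iterated_integral D s1 (EFin \o w1) x0 * iterated_integral D s2 (EFin \o w2) x0)%E.
Proof.
rewrite -!one_total -ge0_product//.
by apply: eq_iterated_integral => y _; rewrite !mulr1.
Qed.

Let ge0_total s' (w' : (I -> R) -> R) : (forall y, 0 <= w' y) ->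
  (0 <= iterated_integral D s' (EFin \o w') x0)%E.
Proof. by move=> w'0; apply: iterated_integral_ge0 => y; rewrite lee_fin. Qed.

Lemma iterated_integral_product_lty : (iterated_integral D s (EFin \o w) x0 < +oo)%E.
Proof.
rewrite iterated_integral_product_fin lte_mul_pinfty//; first exact: ge0_total.
by rewrite ge0_fin_numE//; exact: ge0_total.
Qed.

(* A bounded factor is reduced to a nonnegative one by adding a constant. *)
Lemma weighted_integralM K f g :
  config_measurable (EFin \o f) -> config_measurable (EFin \o g) ->
  (forall i y t, i \in s -> ~~ P i -> f (update y i t) = f y) ->
  (forall i y t, i \in s -> P i -> g (update y i t) = g y) ->
  bounded_by D s x0 K f -> bounded_by D s1 x0 K f ->
  bounded_by D s x0 K g -> bounded_by D s2 x0 K g -> 0 <= K ->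
  weighted_integral D s x0 w (fun y => f y * g y) =
  (weighted_integral D s1 x0 w1 f * weighted_integral D s2 x0 w2 g)%E.
Proof.
move=> mf mg fP gP fK f1K gK g2K K0.
pose pos (h : (I -> R) -> R) y := Num.max (h y + K) 0.
have pos_ge0 h y : 0 <= pos h y by rewrite le_max lexx orbT.
have mpos h : config_measurable (EFin \o h) -> config_measurable (EFin \o pos h).
  move=> mh d X x mx; apply/measurable_EFinP; apply: measurable_maxr => //.
  by apply: measurable_funD => //; apply/measurable_EFinP; exact: mh.
have posE s' h y : bounded_by D s' x0 K h -> reachable D s' x0 y -> pos h y = h y + K.
  move=> hK ry; apply/max_idPl; have := hK y ry; rewrite ler_norml => /andP[h0 _].
  by rewrite -lerBlDr sub0r.
have posK s' h : bounded_by D s' x0 K h -> bounded_by D s' x0 (K + K) (pos h).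
  move=> hK y ry; rewrite ger0_norm// (posE _ _ _ hK ry) lerD2r.
  exact: le_trans (ler_norm _) (hK y ry).
have oneK s' : bounded_by D s' x0 (K + 1) (fun=> 1%R).
  by move=> y _; rewrite normr1 lerDr.
have mw : config_measurable (EFin \o w).
  move=> d X x mx; under eq_fun do rewrite /= EFinM.
  by apply: emeasurable_funM; [exact: mw1|exact: mw2].
have w_ge0 y : 0 <= w y by rewrite mulr_ge0.
have posf i y t : i \in s -> ~~ P i -> pos f (update y i t) = pos f y.
  by move=> si Pi; rewrite /pos fP.
have posg i y t : i \in s -> P i -> pos g (update y i t) = pos g y.
  by move=> si Pi; rewrite /pos gP.
have E s' w' h : config_measurable (EFin \o w') -> (forall y, 0 <= w' y) ->
    (iterated_integral D s' (EFin \o w') x0 < +oo)%E ->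
    config_measurable (EFin \o h) -> bounded_by D s' x0 K h ->
    weighted_integral D s' x0 w' h = (weighted_integral D s' x0 w' (pos h) -
      K%:E * weighted_integral D s' x0 w' (fun=> 1%R))%E.
  move=> mw' w'0 w'fin mh hK.
  transitivity (1%R%:E * weighted_integral D s' x0 w' (pos h) +
      (- K)%R%:E * weighted_integral D s' x0 w' (fun=> 1%R))%E; last first.
    by rewrite mul1e EFinN mulNe.
  rewrite -(@weighted_integralZD _ _ D s' x0 w' mD mw' w'0 w'fin 1 (- K) (K + K + 1))//; last 3 first.
  - exact: mpos.
  - by move=> y ry; apply: le_trans (posK _ _ hK y ry) _; rewrite lerDl.
  - by move=> y ry; rewrite normr1 lerDr addr_ge0.
  by apply: eq_iterated_integral => y ry; rewrite (posE _ _ _ hK ry); congr EFin; ring.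
have [F FE] : exists F, weighted_integral D s1 x0 w1 (pos f) = F%:E.
  by eexists; apply: esym; apply: fineK; exact: (weighted_integral_fin_num mD mw1 w1_ge0 w1_fin (mpos _ mf) (posK _ _ f1K)).
have [G GE] : exists G, weighted_integral D s2 x0 w2 (pos g) = G%:E.
  by eexists; apply: esym; apply: fineK; exact: (weighted_integral_fin_num mD mw2 w2_ge0 w2_fin (mpos _ mg) (posK _ _ g2K)).
have [U UE] : exists U, weighted_integral D s1 x0 w1 (fun=> 1%R) = U%:E.
  by eexists; apply: esym; apply: fineK; exact: (weighted_integral_fin_num mD mw1 w1_ge0 w1_fin mone (oneK _)).
have [V VE] : exists V, weighted_integral D s2 x0 w2 (fun=> 1%R) = V%:E.
  by eexists; apply: esym; apply: fineK; exact: (weighted_integral_fin_num mD mw2 w2_ge0 w2_fin mone (oneK _)).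
rewrite (E s1 w1 f)// (E s2 w2 g)// FE GE UE VE.
have hFG := ge0_product (mpos _ mf) (mpos _ mg) (pos_ge0 f) (pos_ge0 g) posf posg.
have hFV := ge0_product (mpos _ mf) mone (pos_ge0 f) (fun=> ler01) posf (fun _ _ _ _ _ => erefl).
have hUG := ge0_product mone (mpos _ mg) (fun=> ler01) (pos_ge0 g) (fun _ _ _ _ _ => erefl) posg.
have hUV := ge0_product mone mone (fun=> ler01) (fun=> ler01)
  (fun _ _ _ _ _ => erefl) (fun _ _ _ _ _ => erefl).
rewrite FE GE in hFG; rewrite FE VE in hFV; rewrite UE GE in hUG; rewrite UE VE in hUV.
(* f g = (pos f - K) (pos g - K) has four terms, indexed by pairs of booleans: true selects the
   nonnegative function, false the constant - K. Each term is a multiple of a product of nonnegative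
   functions. *)
pose coef (b : bool * bool) : R := (if b.1 then 1 else - K) * (if b.2 then 1 else - K).
pose term (b : bool * bool) y : R := (if b.1 then pos f y else 1) * (if b.2 then pos g y else 1).
pose bs := [:: (true, true); (true, false); (false, true); (false, false)].
have mterm b : config_measurable (EFin \o term b).
  move=> d X x mx; apply/measurable_EFinP; apply: measurable_funM.
    by case: b.1 => //; apply/measurable_EFinP; exact: mpos.
  by case: b.2 => //; apply/measurable_EFinP; exact: mpos.
have KK1 : 1 <= K + K + 1 by rewrite lerDr addr_ge0.
have bterm b : exists L, bounded_by D s x0 L (term b).
  exists ((K + K + 1) * (K + K + 1)) => y ry; rewrite normrM ler_pM//.
    case: b.1; last by rewrite normr1.
    by apply: le_trans (posK _ _ fK y ry) _; rewrite lerDl.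
  case: b.2; last by rewrite normr1.
  by apply: le_trans (posK _ _ gK y ry) _; rewrite lerDl.
transitivity (weighted_integral D s x0 w (fun y => \sum_(b <- bs) coef b * term b y)).
  apply: eq_iterated_integral => y ry; rewrite /bs !big_cons big_nil /coef /term /=.
  by rewrite (posE _ _ _ fK ry) (posE _ _ _ gK ry); congr EFin; ring.
rewrite (weighted_integral_sum mD mw w_ge0 iterated_integral_product_lty)//.
rewrite /bs !big_cons big_nil /coef /term /= hFG hFV hUG hUV /=.
by rewrite -?EFinM; congr EFin; ring.
Qed.

End WeightedIntegralProduct.

(** * The interaction factors *)

Section FactorLists.
Variable R : realType.
Implicit Types fs : seq (R * R).

Lemma factor_sum_cat k : {morph (fun fs => factor_sum fs k) : fs gs / fs ++ gs >-> fs + gs}.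
Proof. by move=> fs gs; rewrite /factor_sum big_cat. Qed.

Lemma factor_sum_nil k : factor_sum (R := R) [::] k = 0.
Proof. exact: big_nil. Qed.

Lemma factor_sum_big (I : Type) (r : seq I) (P : pred I) (F : I -> seq (R * R)) k :
  factor_sum (\big[cat/[::]]_(i <- r | P i) F i) k = \sum_(i <- r | P i) factor_sum (F i) k.
Proof. exact: (big_morph _ (factor_sum_cat k) (factor_sum_nil k)). Qed.

Lemma factor_sum_seq1 (f : R * R) k : factor_sum [:: f] k = f.1 * f.2 ^+ k.
Proof. exact: big_seq1. Qed.

Lemma binom_product_cat q : {morph (fun fs => binom_product fs q) : fs gs / fs ++ gs >-> fs * gs}.
Proof. by move=> fs gs; rewrite /binom_product big_cat. Qed.

Lemma binom_product_nil q : binom_product (R := R) [::] q = 1.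
Proof. exact: big_nil. Qed.

Lemma binom_product_big (I : Type) (r : seq I) (P : pred I) (F : I -> seq (R * R)) q :
  binom_product (\big[cat/[::]]_(i <- r | P i) F i) q = \prod_(i <- r | P i) binom_product (F i) q.
Proof. exact: (big_morph _ (binom_product_cat q) (binom_product_nil q)). Qed.

Lemma binom_product_seq1 (f : R * R) q : binom_product [:: f] q = (1 - f.2 * q) `^ (- f.1).
Proof. exact: big_seq1. Qed.

Definition factor_weight fs : R := \sum_(f <- fs) `|f.1|.

Lemma factor_weight_cat : {morph factor_weight : fs gs / fs ++ gs >-> fs + gs}.
Proof. by move=> fs gs; rewrite /factor_weight big_cat. Qed.

Lemma factor_weight_nil : factor_weight [::] = 0.
Proof. exact: big_nil. Qed.

Lemma factor_weight_big (I : Type) (r : seq I) (P : pred I) (F : I -> seq (R * R)) :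
  factor_weight (\big[cat/[::]]_(i <- r | P i) F i) = \sum_(i <- r | P i) factor_weight (F i).
Proof. exact: (big_morph _ factor_weight_cat factor_weight_nil). Qed.

Definition in_unit fs := forall f, f \in fs -> 0 <= f.2 <= 1.

Lemma in_unit_cat fs gs : in_unit fs -> in_unit gs -> in_unit (fs ++ gs).
Proof. by move=> hf hg f; rewrite mem_cat => /orP[/hf|/hg]. Qed.

End FactorLists.

Lemma cartan_sum (R : realType) N (F : 'I_N.-1 -> R) (a : 'I_N.-1) :
  \sum_(b < N.-1) cartan R N a b * F b =
  2 * F a - \sum_(b < N.-1 | b == a.+1 :> nat) F b - \sum_(b < N.-1 | b.+1 == a :> nat) F b.
Proof.
have <- : \sum_(b < N.-1 | b == a) 2 * F b = 2 * F a by rewrite big_pred1_eq.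
rewrite [X in X - _ - _]big_mkcond [X in _ - X - _]big_mkcond [X in _ - _ - X]big_mkcond.
rewrite -!sumrB; apply: eq_bigr => b _; rewrite mxE (eq_sym a b) (eq_sym a.+1).
have [->|ba] := eqVneq b a.
  by rewrite [_ == _.+1](_ : _ = false) 1?[_.+1 == _](_ : _ = false) ?subr0//; lia.
case: eqP => [E1|_] /=; case: eqP => [E2|_] /=; try ring.
by lia.
Qed.

(** * The exponents of the binomials and the Jack arguments *)

Section CrossFactors.
Variables (R : realType) (N : nat) (beta : R) (Np Nm : 'I_N.-1 -> nat) (vp vm : 'I_N.-1 -> R).
Hypotheses (hN : (2 <= N)%N) (beta0 : beta != 0).
Implicit Types x y : @config R N.

(* The interaction of the variables near 0 with those near infinity is the
   product of the (1 - s q) `^ (- b) over the pairs (b, s) listed here; the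
   last pair makes the exponents of the Jack arguments factorize. *)
Definition cross_factors x y : seq (R * R) :=
  \big[cat/[::]]_(a < N.-1) \big[cat/[::]]_(i < Np a) [:: (- vm a, x (a, val i))] ++
  (\big[cat/[::]]_(a < N.-1) \big[cat/[::]]_(j < Nm a) [:: (- vp a, y (a, val j))] ++
  (\big[cat/[::]]_(a < N.-1) \big[cat/[::]]_(b < N.-1)
     \big[cat/[::]]_(i < Np a) \big[cat/[::]]_(j < Nm b)
       [:: (- (beta * cartan R N a b), x (a, val i) * y (b, val j))] ++
  [:: (- \sum_(a < N) vprime_plus vp a * vprime_minus vm a / beta, 1)])).

Let sum_ord_eq (F : 'I_N.-1 -> R) (b : 'I_N.-1) : \sum_(c < N.-1 | c == b :> nat) F c = F b.
Proof. by rewrite (big_pred1 b)// => c; rewrite /= -val_eqE. Qed.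

(** There are no boundary terms because p^(0) = p^(N) = 0: at the two extreme values of a one of the
    inner sums is empty. *)
Let sum_by_parts (p : 'I_N.-1 -> R) (z : nat -> R) :
  \sum_(a < N) (\sum_(b < N.-1 | b == a :> nat) p b - \sum_(b < N.-1 | b.+1 == a :> nat) p b) * z a =
  \sum_(b < N.-1) p b * (z b - z b.+1).
Proof.
under eq_bigr do rewrite mulrBl !mulr_suml.
rewrite sumrB; under [RHS]eq_bigr do rewrite mulrBr; rewrite sumrB; congr (_ - _).
  rewrite (exchange_big_dep predT)//=; apply: eq_bigr => b _.
  have bN : (b < N)%N by have := ltn_ord b; lia.
  rewrite (big_pred1 (Ordinal bN))// => a; by rewrite /= -val_eqE eq_sym.
rewrite (exchange_big_dep predT)//=; apply: eq_bigr => b _.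
have bN : (b.+1 < N)%N by have := ltn_ord b; lia.
by rewrite (big_pred1 (Ordinal bN))// => a; rewrite /= -val_eqE eq_sym.
Qed.

(** [rdiff] with its index read as a natural number, so that summation by parts can use it at b and
    at b.+1. *)
Let rdiff_nat (M : 'I_N.-1 -> nat) x (k a : nat) : R :=
  \sum_(b < N.-1 | b == a :> nat) colour_powersum M x b k -
  \sum_(b < N.-1 | b.+1 == a :> nat) colour_powersum M x b k.

(** The difference of two consecutive r is a second difference 2 p^(a) - p^(a+1) - p^(a-1), that is,
    a row of the Cartan matrix applied to p. *)
Let rdiff_rdiff x y k : \sum_(a < N) rdiff Np x a k * rdiff Nm y a k =
  \sum_(a < N.-1) \sum_(b < N.-1)
     cartan R N a b * (colour_powersum Np x a k * colour_powersum Nm y b k).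
Proof.
rewrite (sum_by_parts _ (rdiff_nat Nm y k)); apply: eq_bigr => a _.
under [RHS]eq_bigr do rewrite mulrCA.
rewrite -mulr_sumr; congr (_ * _); rewrite /rdiff_nat cartan_sum sum_ord_eq.
by ring.
Qed.

(** The shifts v' are partial sums of v, so their consecutive differences give back single values of
    v; likewise for [vprime_plus] below. *)
Let rdiff_vminus x k : \sum_(a < N) rdiff Np x a k * vprime_minus vm a =
  \sum_(a < N.-1) vm a * colour_powersum Np x a k.
Proof.
rewrite (sum_by_parts _ (fun a => - \sum_(s < N.-1 | (s < a)%N) vm s)).
apply: eq_bigr => a _; rewrite mulrC; congr (_ * _); rewrite opprK addrC.
rewrite (bigD1 a) ?ltnSn//= -addrA -[RHS]addr0; congr (_ + _).
rewrite (eq_bigl (fun s : 'I_N.-1 => (s < a)%N)) ?subrr// => s.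
by rewrite ltnS -val_eqE ltn_neqAle andbC.
Qed.

Let rdiff_vplus y k : \sum_(a < N) vprime_plus vp a * rdiff Nm y a k =
  \sum_(a < N.-1) vp a * colour_powersum Nm y a k.
Proof.
under eq_bigr do rewrite mulrC.
rewrite (sum_by_parts _ (fun a => \sum_(s < N.-1 | (a <= s)%N) vp s)).
apply: eq_bigr => a _; rewrite mulrC; congr (_ * _).
rewrite (bigD1 a) ?leqnn//= -addrA -[RHS]addr0; congr (_ + _).
rewrite (eq_bigl (fun s : 'I_N.-1 => (a < s)%N)) ?subrr// => s.
by rewrite -val_eqE ltn_neqAle eq_sym andbC.
Qed.

(** Expanding the product gives four sums, one for each block of [cross_factors]; the term
    independent of x and y is the last pair, whose second component is 1. *)
Lemma factor_sum_cross x y k : factor_sum (cross_factors x y) k =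
  \sum_(a < N) beta * ((- rdiff Np x a k - vprime_plus vp a / beta) *
                       (rdiff Nm y a k + vprime_minus vm a / beta)).
Proof.
rewrite /cross_factors !factor_sum_cat 2!factor_sum_big [factor_sum (\big[cat/[::]]_(_ < _) \big[cat/[::]]_(_ < _) \big[cat/[::]]_(_ < _) _) k]factor_sum_big.
rewrite factor_sum_seq1 /= expr1n mulr1.
have -> : \sum_(a < N) beta * ((- rdiff Np x a k - vprime_plus vp a / beta) *
      (rdiff Nm y a k + vprime_minus vm a / beta)) =
    - (beta * \sum_(a < N) rdiff Np x a k * rdiff Nm y a k)
    - \sum_(a < N) rdiff Np x a k * vprime_minus vm a
    - \sum_(a < N) vprime_plus vp a * rdiff Nm y a k
    - \sum_(a < N) vprime_plus vp a * vprime_minus vm a / beta.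
  rewrite mulr_sumr -!sumrN -!big_split; apply: eq_bigr => a _ /=.
  by field.
rewrite rdiff_rdiff rdiff_vminus rdiff_vplus addrA addrA; congr (_ + _).
rewrite addrAC -addrA addrC -!addrA.
have -> : \sum_(a < N.-1) factor_sum (\big[cat/[::]]_(i < Np a) [:: (- vm a, x (a, val i))]) k =
    - \sum_(a < N.-1) vm a * colour_powersum Np x a k.
  rewrite -sumrN; apply: eq_bigr => a _; rewrite factor_sum_big mulr_sumr -sumrN.
  by apply: eq_bigr => i _; rewrite factor_sum_seq1 mulNr.
have -> : \sum_(a < N.-1) factor_sum (\big[cat/[::]]_(i < Nm a) [:: (- vp a, y (a, val i))]) k =
    - \sum_(a < N.-1) vp a * colour_powersum Nm y a k.
  rewrite -sumrN; apply: eq_bigr => a _; rewrite factor_sum_big mulr_sumr -sumrN.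
  by apply: eq_bigr => i _; rewrite factor_sum_seq1 mulNr.
under eq_bigr do rewrite factor_sum_big; under eq_bigr do under eq_bigr do rewrite factor_sum_big.
under eq_bigr do under eq_bigr do under eq_bigr do rewrite factor_sum_big.
rewrite [- _ - \sum_(a < N.-1) vm a * _]addrC; congr (_ + _).
rewrite mulr_sumr -sumrN; apply: eq_bigr => a _.
rewrite mulr_sumr -sumrN; apply: eq_bigr => b _.
rewrite /colour_powersum big_distrlr /= mulrA mulr_sumr -sumrN; apply: eq_bigr => i _.
rewrite mulr_sumr -sumrN; apply: eq_bigr => j _.
by rewrite factor_sum_seq1 /= exprMn mulNr.
Qed.

Lemma cross_factors_in_unit x y :
  (forall a (i : 'I_(Np a)), 0 <= x (a, val i) <= 1) ->
  (forall a (j : 'I_(Nm a)), 0 <= y (a, val j) <= 1) -> in_unit (cross_factors x y).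
Proof.
move=> x01 y01.
have hbig (I : finType) (F : I -> seq (R * R)) :
    (forall i, in_unit (F i)) -> in_unit (\big[cat/[::]]_i F i).
  by move=> hF; apply: big_ind => // fs gs; exact: in_unit_cat.
have one (f : R * R) : 0 <= f.2 <= 1 -> in_unit [:: f].
  by move=> f01 g; rewrite mem_seq1 => /eqP ->.
apply: in_unit_cat; first by apply: (hbig _ _) => a; apply: (hbig _ _) => i; apply: (one _); exact: x01.
apply: in_unit_cat; first by apply: (hbig _ _) => a; apply: (hbig _ _) => i; apply: (one _); exact: y01.
apply: in_unit_cat; last by apply: (one _); rewrite /= ler01 lexx.
apply: (hbig _ _) => a; apply: (hbig _ _) => b; apply: (hbig _ _) => i; apply: (hbig _ _) => j; apply: (one _) => /=.
have /andP[x0 x1] := x01 a i; have /andP[y0 y1] := y01 b j.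
by rewrite mulr_ge0// mulr_ile1.
Qed.

(** The exponents do not depend on the configuration, so one K bounds the weight at all
    configurations. *)
Lemma factor_weight_cross x y x' y' :
  factor_weight (cross_factors x y) = factor_weight (cross_factors x' y').
Proof.
rewrite /cross_factors !factor_weight_cat; congr (_ + (_ + (_ + _))).
- rewrite !factor_weight_big; apply: eq_bigr => a _; rewrite !factor_weight_big.
  by apply: eq_bigr => i _; rewrite /factor_weight !big_seq1.
- rewrite !factor_weight_big; apply: eq_bigr => a _; rewrite !factor_weight_big.
  by apply: eq_bigr => i _; rewrite /factor_weight !big_seq1.
- rewrite !factor_weight_big; apply: eq_bigr => a _; rewrite !factor_weight_big.
  apply: eq_bigr => b _; rewrite !factor_weight_big; apply: eq_bigr => i _.
  rewrite !factor_weight_big; apply: eq_bigr => j _.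
  by rewrite /factor_weight !big_seq1.
Qed.

(** The exponent is 2 beta for equal colours, - beta for neighbours and 0 otherwise. The two
    orientations of each edge of the Dynkin diagram are collected under its smaller colour, as in
    the integrand. *)
Lemma binom_product_cross x y q :
  binom_product (cross_factors x y) q =
  (\prod_(a < N.-1) \prod_(i < Np a) (1 - x (a, val i) * q) `^ vm a) *
  (\prod_(a < N.-1) \prod_(j < Nm a) (1 - y (a, val j) * q) `^ vp a) *
  (\prod_(a < N.-1) \prod_(i < Np a) \prod_(j < Nm a)
     (1 - x (a, val i) * y (a, val j) * q) `^ (2 * beta)) *
  (\prod_(a < N.-1) \prod_(b < N.-1 | b == a.+1 :> nat)
     ((\prod_(i < Np a) \prod_(j < Nm b) (1 - x (a, val i) * y (b, val j) * q) `^ (- beta)) *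
      (\prod_(i < Np b) \prod_(j < Nm a) (1 - x (b, val i) * y (a, val j) * q) `^ (- beta)))) *
  (1 - q) `^ (\sum_(a < N) vprime_plus vp a * vprime_minus vm a / beta).
Proof.
rewrite /cross_factors !binom_product_cat binom_product_seq1 /= mul1r opprK !mulrA.
congr (_ * _); rewrite -!mulrA; congr (_ * (_ * _)).
- rewrite binom_product_big; apply: eq_bigr => a _; rewrite binom_product_big.
  by apply: eq_bigr => i _; rewrite binom_product_seq1 /= opprK.
- rewrite binom_product_big; apply: eq_bigr => a _; rewrite binom_product_big.
  by apply: eq_bigr => i _; rewrite binom_product_seq1 /= opprK.
pose G a b c := \prod_(i < Np a) \prod_(j < Nm b) (1 - x (a, val i) * y (b, val j) * q) `^ (beta * c).
transitivity (\prod_(a < N.-1) \prod_(b < N.-1) G a b (cartan R N a b)).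
  rewrite binom_product_big; apply: eq_bigr => a _; rewrite binom_product_big.
  apply: eq_bigr => b _; rewrite binom_product_big; apply: eq_bigr => i _.
  by rewrite binom_product_big; apply: eq_bigr => j _; rewrite binom_product_seq1 /= opprK.
have GE a b : G a b (cartan R N a b) = (if b == a then G a b 2 else 1) *
    ((if b == a.+1 :> nat then G a b (-1) else 1) * (if a == b.+1 :> nat then G a b (-1) else 1)).
  rewrite /cartan mxE (eq_sym a b) (eq_sym a.+1) (eq_sym b.+1).
  have G0 : G a b 0 = 1 by rewrite /G big1// => i _; rewrite big1// => j _; rewrite mulr0 powRr0.
  have [->|ba] := eqVneq b a.
    by rewrite [_ == _.+1](_ : _ = false) ?mulr1//; lia.
  case: eqP => [E1|_] /=; case: eqP => [E2|_] /=; rewrite ?G0 ?mulr1 ?mul1r//.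
  by lia.
rewrite (eq_bigr _ (fun a _ => eq_bigr _ (fun b _ => GE a b))).
rewrite (eq_bigr (fun a => G a a 2 * (\prod_(b < N.-1 | b == a.+1 :> nat) G a b (-1) *
    \prod_(b < N.-1 | a == b.+1 :> nat) G a b (-1)))); last first.
  by move=> a _; rewrite !big_split /= -!big_mkcond /= big_pred1_eq.
rewrite !big_split /=; congr (_ * _).
  by apply: eq_bigr => a _; rewrite /G mulrC.
under [RHS]eq_bigr do rewrite big_split; rewrite big_split /=; congr (_ * _).
  by apply: eq_bigr => a _; apply: eq_bigr => b _; rewrite /G mulrN1.
rewrite (exchange_big_dep predT)//=; apply: eq_bigr => b _.
by apply: eq_bigr => a _; rewrite /G mulrN1.
Qed.

End CrossFactors.

Section PowerProducts.
Variable R : realType.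
Implicit Types (q r s x y : R).

Lemma powR_prod (I : Type) (l : seq I) (P : pred I) (f : I -> R) r :
  (forall i, P i -> 0 <= f i) ->
  (\prod_(i <- l | P i) f i) `^ r = \prod_(i <- l | P i) f i `^ r.
Proof.
move=> f0; elim: l => [|i l IH]; first by rewrite !big_nil powR1.
rewrite !big_cons; case: ifP => // Pi; rewrite powRM ?IH ?f0//.
by apply: prodr_ge0.
Qed.

Lemma gt0_powRD x r s : 0 < x -> x `^ (r + s) = x `^ r * x `^ s.
Proof. by move=> x0; rewrite powRD//; apply/implyP => _; rewrite gt_eqF. Qed.

Lemma prod_powR (I : Type) (l : seq I) (P : pred I) (f : I -> R) q : 0 < q ->
  \prod_(i <- l | P i) q `^ f i = q `^ (\sum_(i <- l | P i) f i).
Proof.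
move=> q0; apply/esym; apply: (big_morph (powR q)); last by rewrite powRr0.
by move=> r s; exact: gt0_powRD.
Qed.

Lemma powRX q r n : 0 <= q -> (q `^ r) ^+ n = q `^ (r * n%:R).
Proof. by move=> q0; rewrite powRrM powR_mulrn// powR_ge0. Qed.

Lemma powRVl y r : 0 <= y -> y^-1 `^ r = y `^ (- r).
Proof. by move=> y0; rewrite -powR_inv1// -powRrM mulN1r. Qed.

Lemma dist_scale_powR q x1 x2 r : 0 <= q ->
  `|q * x2 - q * x1| `^ r = q `^ r * `|x1 - x2| `^ r.
Proof. by move=> q0; rewrite -mulrBr normrM ger0_norm// powRM// distrC. Qed.

Lemma dist_mixed_powR q x y r : 0 <= q < 1 -> 0 <= x <= 1 -> 0 < y <= 1 ->
  `|y^-1 - q * x| `^ r = y `^ (- r) * (1 - x * y * q) `^ r.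
Proof.
move=> /andP[q0 q1] /andP[x0 x1] /andP[y0 y1].
have h : 0 <= 1 - x * y * q.
  rewrite subr_ge0 mulr_ile1 ?mulr_ge0//; [exact: ltW| |exact: ltW].
  by rewrite mulr_ile1// ltW.
have -> : y^-1 - q * x = y^-1 * (1 - x * y * q) by field; rewrite gt_eqF.
have yi : 0 <= y^-1 by rewrite invr_ge0 ltW.
by rewrite normrM (ger0_norm yi) (ger0_norm h) powRM// powRVl// ltW.
Qed.

Lemma dist_inv_powR y1 y2 r : 0 < y1 -> 0 < y2 ->
  `|y2^-1 - y1^-1| `^ r = y1 `^ (- r) * y2 `^ (- r) * `|y1 - y2| `^ r.
Proof.
move=> y10 y20.
have -> : y2^-1 - y1^-1 = y1^-1 * y2^-1 * (y1 - y2) by field; rewrite !gt_eqF.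
have i1 : 0 <= y1^-1 by rewrite invr_ge0 ltW.
have i2 : 0 <= y2^-1 by rewrite invr_ge0 ltW.
by rewrite normrM powRM// ger0_norm ?mulr_ge0// powRM// !powRVl// ltW.
Qed.

Lemma prod_pairs_split (F : nat -> nat -> R) m n :
  \prod_(i < m + n) \prod_(j < m + n | (i < j)%N) F i j =
  (\prod_(i < m) \prod_(j < m | (i < j)%N) F i j) *
  (\prod_(i < m) \prod_(j < n) F i (m + j)%N) *
  (\prod_(i < n) \prod_(j < n | (i < j)%N) F (m + i)%N (m + j)%N).
Proof.
rewrite big_split_ord /=; congr (_ * _).
  rewrite -big_split; apply: eq_bigr => i _; rewrite big_mkcond big_split_ord /= -big_mkcond.
  congr (_ * _); apply: eq_bigr => j _.
  by rewrite (leq_trans (ltn_ord i))// leq_addr.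
apply: eq_bigr => i _; rewrite big_mkcond big_split_ord /= big1 ?mul1r.
  by rewrite [RHS]big_mkcond; apply: eq_bigr => j _; rewrite ltn_add2l.
move=> j _; rewrite ifF//; apply/negbTE; rewrite -leqNgt.
by apply: leq_trans (ltnW (ltn_ord j)) _; exact: leq_addr.
Qed.

(** Each index belongs to n - 1 pairs. *)
Lemma prod_pairs_mul (f : nat -> R) n :
  \prod_(i < n) \prod_(j < n | (i < j)%N) (f i * f j) = (\prod_(i < n) f i) ^+ n.-1.
Proof.
elim: n => [|n IH]; first by rewrite big_ord0 expr0.
rewrite -(addn1 n) (prod_pairs_split (fun i j => f i * f j)) IH.
have -> : \prod_(i < n) \prod_(j < 1) (f i * f (n + j)%N) = (\prod_(i < n) f i) * f n ^+ n.
  under eq_bigr do rewrite big_ord1 addn0.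
  by rewrite big_split /= prodr_const card_ord.
have -> : \prod_(i < 1) \prod_(j < 1 | (i < j)%N) (f (n + i)%N * f (n + j)%N) = 1.
  by rewrite big_ord1 big_mkcond big_ord1.
rewrite mulr1 addn1 big_ord_recr /= exprMn mulrA; congr (_ * _).
by case: n {IH} => [|n]; rewrite ?big_ord0 ?mulr1 ?expr1n// -exprSr.
Qed.

End PowerProducts.

(** * Factorization of the Dotsenko-Fateev integrand *)

Section Integrand.
Variables (R : realType) (N : nat) (beta : R) (Np Nm : 'I_N.-1 -> nat).
Variables (u v w um : 'I_N.-1 -> R) (q : R) (y : @config R N).
Let M a := (Np a + Nm a)%N.
Hypotheses (hN : (2 <= N)%N) (beta0 : beta != 0).
Hypothesis q01 : 0 < q < 1.
Hypothesis y01 : forall a i, (i < M a)%N -> 0 < y (a, i) <= 1.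
Hypothesis umE : forall a, u a + um a + v a + w a +
  beta * (\sum_(b < N.-1) cartan R N a b * (M b)%:R) = 2 * beta - 2.

Definition df_shift (ai : 'I_N.-1 * nat) := (ai.1, (Np ai.1 + ai.2)%N).
Definition df_phi (ai : 'I_N.-1 * nat) (t : R) := if (ai.2 < Np ai.1)%N then q * t else t^-1.
Definition df_jac (ai : 'I_N.-1 * nat) (t : R) := if (ai.2 < Np ai.1)%N then q else t ^- 2.

Notation z := (fun ai => df_phi ai (y ai)).
Notation y' := (y \o df_shift).

Let q0 : 0 < q. Proof. by case/andP: q01. Qed.
Let q0' : 0 <= q < 1. Proof. by case/andP: q01 => /ltW -> ->. Qed.

Let zp a (i : 'I_(Np a)) : z (a, val i) = q * y (a, val i).
Proof. by rewrite /df_phi /= ltn_ord. Qed.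

Let zm a j : z (a, (Np a + j)%N) = (y' (a, j))^-1.
Proof. by rewrite /df_phi /= ltnNge leq_addr. Qed.

Let yp01 a (i : 'I_(Np a)) : 0 < y (a, val i) <= 1.
Proof. by apply: y01; rewrite /M (leq_trans (ltn_ord i))// leq_addr. Qed.

Let yp01' a (i : 'I_(Np a)) : 0 <= y (a, val i) <= 1.
Proof. by have /andP[/ltW -> ->] := yp01 i. Qed.

Let ym01 a (j : 'I_(Nm a)) : 0 < y' (a, val j) <= 1.
Proof. by apply: (@y01 a (Np a + j)%N); rewrite /M ltn_add2l ltn_ord. Qed.

Let ypow a r := \prod_(j < Nm a) y' (a, val j) `^ r.

Let ypowD a r s : ypow a (r + s) = ypow a r * ypow a s.
Proof.
rewrite /ypow -big_split; apply: eq_bigr => j _ /=.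
by have /andP[h _] := ym01 j; exact: gt0_powRD.
Qed.

Let ypowX a r n : (ypow a r) ^+ n = ypow a (r * n%:R).
Proof. by rewrite /ypow -prodrXl; apply: eq_bigr => j _; rewrite powRX// ltW//; case/andP: (ym01 j). Qed.

Let Delta_powR (K : 'I_N.-1 -> nat) (x : @config R N) a r :
  `|Delta K x a| `^ r = \prod_(i < K a) \prod_(j < K a | (i < j)%N) `|x (a, val i) - x (a, val j)| `^ r.
Proof.
rewrite /Delta normr_prod powR_prod//; apply: eq_bigr => i _.
by rewrite normr_prod powR_prod.
Qed.

Let Delta2_powR (K : 'I_N.-1 -> nat) (x : @config R N) a b r :
  `|Delta2 K x a b| `^ r = \prod_(i < K a) \prod_(j < K b) `|x (a, val i) - x (b, val j)| `^ r.
Proof.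
rewrite /Delta2 normr_prod powR_prod//; apply: eq_bigr => i _.
by rewrite normr_prod powR_prod.
Qed.

(** Pairs near 0 scale by q, pairs near infinity produce powers of their y, and mixed pairs produce
    a power of y and a binomial. [neighbours] treats pairs of different colours in the same way. *)
Let same_colour a r :
  \prod_(i < M a) \prod_(j < M a | (i < j)%N) `|z (a, val j) - z (a, val i)| `^ r =
  q `^ (\sum_(i < Np a) \sum_(j < Np a | (i < j)%N) r) *
  `|Delta Np y a| `^ r * `|Delta Nm y' a| `^ r *
  ypow a (- r * (Np a)%:R + - r * (Nm a).-1%:R) *
  \prod_(i < Np a) \prod_(j < Nm a) (1 - y (a, val i) * y' (a, val j) * q) `^ r.
Proof.
rewrite (prod_pairs_split (fun i j => `|z (a, j) - z (a, i)| `^ r)) ypowD !Delta_powR.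
have -> : \prod_(i < Np a) \prod_(j < Np a | (i < j)%N) `|z (a, val j) - z (a, val i)| `^ r =
    q `^ (\sum_(i < Np a) \sum_(j < Np a | (i < j)%N) r) *
    \prod_(i < Np a) \prod_(j < Np a | (i < j)%N) `|y (a, val i) - y (a, val j)| `^ r.
  rewrite -prod_powR// -big_split; apply: eq_bigr => i _ /=.
  rewrite -prod_powR// -big_split; apply: eq_bigr => j _ /=.
  by rewrite (zp j) (zp i) dist_scale_powR// ltW.
have -> : \prod_(i < Np a) \prod_(j < Nm a) `|z (a, (Np a + j)%N) - z (a, val i)| `^ r =
    ypow a (- r * (Np a)%:R) *
    \prod_(i < Np a) \prod_(j < Nm a) (1 - y (a, val i) * y' (a, val j) * q) `^ r.
  rewrite -ypowX -[X in _ ^+ X]card_ord -prodr_const -big_split; apply: eq_bigr => i _ /=.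
  rewrite /ypow -big_split; apply: eq_bigr => j _ /=.
  by rewrite zm (zp i) (dist_mixed_powR r q0' (yp01' i) (ym01 j)).
have -> : \prod_(i < Nm a) \prod_(j < Nm a | (i < j)%N) `|z (a, (Np a + j)%N) - z (a, (Np a + i)%N)| `^ r =
    ypow a (- r * (Nm a).-1%:R) *
    \prod_(i < Nm a) \prod_(j < Nm a | (i < j)%N) `|y' (a, val i) - y' (a, val j)| `^ r.
  rewrite -ypowX /ypow -(prod_pairs_mul (fun j => y' (a, j) `^ (- r))) -big_split.
  apply: eq_bigr => i _ /=; rewrite -big_split; apply: eq_bigr => j _ /=.
  rewrite !zm dist_inv_powR//; [by case/andP: (ym01 i)|by case/andP: (ym01 j)].
ring.
Qed.

(** The Jacobian is included here: it adds 1 to the exponent of q for a variable near 0 and - 2 to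
    the exponent of y for a variable near infinity. *)
Let singles a :
  \prod_(i < M a) (df_jac (a, val i) (y (a, val i)) * (`|z (a, val i)| `^ u a *
    `|z (a, val i) - q| `^ v a * `|z (a, val i) - 1| `^ w a)) =
  q `^ (\sum_(i < Np a) (1 + u a + v a)) *
  (\prod_(i < Np a) (y (a, val i) `^ u a * (1 - y (a, val i)) `^ v a)) *
  (\prod_(j < Nm a) (1 - y' (a, val j)) `^ w a) *
  ypow a (- 2 - u a - v a - w a) *
  (\prod_(i < Np a) (1 - y (a, val i) * q) `^ w a) *
  \prod_(j < Nm a) (1 - y' (a, val j) * q) `^ v a.
Proof.
rewrite /M big_split_ord /=.
have -> : \prod_(i < Np a) (df_jac (a, val i) (y (a, val i)) * (`|z (a, val i)| `^ u a *
    `|z (a, val i) - q| `^ v a * `|z (a, val i) - 1| `^ w a)) =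
    q `^ (\sum_(i < Np a) (1 + u a + v a)) *
    (\prod_(i < Np a) (y (a, val i) `^ u a * (1 - y (a, val i)) `^ v a)) *
    (\prod_(i < Np a) (1 - y (a, val i) * q) `^ w a).
  rewrite -prod_powR// -!big_split; apply: eq_bigr => i _ /=.
  have /andP[x0 x1] := yp01 i; rewrite zp /df_jac /= ltn_ord; move: x0 x1; move: (y _) => x x0 x1.
  have -> : q * x - q = - (q * (1 - x)) by ring.
  have -> : q * x - 1 = - (1 - x * q) by ring.
  have xq : 0 <= 1 - x * q by rewrite subr_ge0 mulr_ile1// ltW//; case/andP: q01.
  have xq' : 0 <= 1 - x by rewrite subr_ge0.
  rewrite !normrN !ger0_norm ?mulr_ge0// ?(ltW q0) ?(ltW x0)//.
  rewrite !powRM ?(ltW q0) ?(ltW x0)// !gt0_powRD// powRr1 ?(ltW q0)//; ring.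
have -> : \prod_(i < Nm a) (df_jac (a, (Np a + i)%N) (y (a, (Np a + i)%N)) *
    (`|z (a, (Np a + i)%N)| `^ u a * `|z (a, (Np a + i)%N) - q| `^ v a *
     `|z (a, (Np a + i)%N) - 1| `^ w a)) =
    (\prod_(j < Nm a) (1 - y' (a, val j)) `^ w a) * ypow a (- 2 - u a - v a - w a) *
    \prod_(j < Nm a) (1 - y' (a, val j) * q) `^ v a.
  rewrite -!big_split; apply: eq_bigr => j _ /=.
  have := ym01 j; rewrite zm /df_jac /= ltnNge leq_addr /=.
  rewrite -[y (a, (Np a + j)%N)]/(y' (a, val j)); move: (y' _) => t t01.
  have /andP[t0 t1] := t01; have t0' := ltW t0.
  have -> : `|t^-1 - q| `^ v a = t `^ (- v a) * (1 - t * q) `^ v a.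
    have one01 : 0 <= (1 : R) <= 1 by rewrite ler01 lexx.
    by have := dist_mixed_powR (v a) q0' one01 t01; rewrite mulr1 mul1r.
  have -> : `|t^-1 - 1| `^ w a = t `^ (- w a) * (1 - t) `^ w a.
    have -> : t^-1 - 1 = t^-1 * (1 - t) by field; rewrite gt_eqF.
    have ti : 0 <= t^-1 by rewrite invr_ge0.
    have t1' : 0 <= 1 - t by rewrite subr_ge0.
    by rewrite normrM (ger0_norm ti) (ger0_norm t1') powRM// powRVl.
  have -> : `|t^-1| `^ u a = t `^ (- u a) by rewrite ger0_norm ?invr_ge0// powRVl.
  rewrite !gt0_powRD//; have -> : t `^ (- 2) = t ^- 2 by rewrite -powR_invn.
  ring.
rewrite ypowD; ring.
Qed.

Let neighbours a b r :
  \prod_(i < M a) \prod_(j < M b) `|z (b, val j) - z (a, val i)| `^ r =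
  q `^ (\sum_(i < Np a) \sum_(j < Np b) r) *
  `|Delta2 Np y a b| `^ r * `|Delta2 Nm y' a b| `^ r *
  (ypow a (- r * (M b)%:R) * ypow b (- r * (M a)%:R)) *
  ((\prod_(i < Np a) \prod_(j < Nm b) (1 - y (a, val i) * y' (b, val j) * q) `^ r) *
   (\prod_(i < Np b) \prod_(j < Nm a) (1 - y (b, val i) * y' (a, val j) * q) `^ r)).
Proof.
rewrite /M big_split_ord /= !Delta2_powR.
under eq_bigr do rewrite big_split_ord /=.
under [X in _ * X]eq_bigr do rewrite big_split_ord /=.
rewrite !big_split /=.
have -> : \prod_(i < Np a) \prod_(j < Np b) `|z (b, val j) - z (a, val i)| `^ r =
    q `^ (\sum_(i < Np a) \sum_(j < Np b) r) *
    \prod_(i < Np a) \prod_(j < Np b) `|y (a, val i) - y (b, val j)| `^ r.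
  rewrite -prod_powR// -big_split; apply: eq_bigr => i _ /=.
  rewrite -prod_powR// -big_split; apply: eq_bigr => j _ /=.
  by rewrite (zp j) (zp i) dist_scale_powR// ltW.
have -> : \prod_(i < Np a) \prod_(j < Nm b) `|z (b, (Np b + j)%N) - z (a, val i)| `^ r =
    ypow b (- r * (Np a)%:R) *
    \prod_(i < Np a) \prod_(j < Nm b) (1 - y (a, val i) * y' (b, val j) * q) `^ r.
  rewrite -ypowX -[X in _ ^+ X]card_ord -prodr_const -big_split; apply: eq_bigr => i _ /=.
  rewrite /ypow -big_split; apply: eq_bigr => j _ /=.
  by rewrite zm (zp i) (dist_mixed_powR r q0' (yp01' i) (ym01 j)).
have -> : \prod_(i < Nm a) \prod_(j < Np b) `|z (b, val j) - z (a, (Np a + i)%N)| `^ r =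
    ypow a (- r * (Np b)%:R) *
    \prod_(i < Np b) \prod_(j < Nm a) (1 - y (b, val i) * y' (a, val j) * q) `^ r.
  rewrite exchange_big /=.
  rewrite -ypowX -[X in _ ^+ X]card_ord -prodr_const -big_split; apply: eq_bigr => i _ /=.
  rewrite /ypow -big_split; apply: eq_bigr => j _ /=.
  by rewrite distrC zm (zp i) (dist_mixed_powR r q0' (yp01' i) (ym01 j)).
have -> : \prod_(i < Nm a) \prod_(j < Nm b) `|z (b, (Np b + j)%N) - z (a, (Np a + i)%N)| `^ r =
    ypow a (- r * (Nm b)%:R) * ypow b (- r * (Nm a)%:R) *
    \prod_(i < Nm a) \prod_(j < Nm b) `|y' (a, val i) - y' (b, val j)| `^ r.
  have -> : ypow a (- r * (Nm b)%:R) = \prod_(i < Nm a) \prod_(j < Nm b) y' (a, val i) `^ (- r).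
    by rewrite -ypowX /ypow -prodrXl; apply: eq_bigr => i _; rewrite prodr_const card_ord.
  have -> : ypow b (- r * (Nm a)%:R) = \prod_(i < Nm a) \prod_(j < Nm b) y' (b, val j) `^ (- r).
    by rewrite -ypowX prodr_const card_ord.
  rewrite -!big_split; apply: eq_bigr => i _ /=; rewrite -!big_split; apply: eq_bigr => j _ /=.
  by rewrite !zm dist_inv_powR//; [case/andP: (ym01 i)|case/andP: (ym01 j)].
rewrite !natrD !mulrDr !ypowD; ring.
Qed.

Let ypow_sum a (P : pred 'I_N.-1) (f : 'I_N.-1 -> R) :
  \prod_(b < N.-1 | P b) ypow a (f b) = ypow a (\sum_(b < N.-1 | P b) f b).
Proof.
apply/esym; apply: (big_morph (ypow a)); first exact: ypowD.
by rewrite /ypow big1// => j _; rewrite powRr0.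
Qed.

(** All powers of the variables near infinity add up to the exponent (alpha_4, e_a) of the second
    Selberg weight: this is the condition on alpha_4 paired with e_a. *)
Let ypow_exponent a :
  ypow a (- (2 * beta) * (Np a)%:R + - (2 * beta) * (Nm a).-1%:R) * ypow a (- 2 - u a - v a - w a) *
  (ypow a (\sum_(b < N.-1 | b == a.+1 :> nat) (- - beta) * (M b)%:R) *
   ypow a (\sum_(b < N.-1 | a == b.+1 :> nat) (- - beta) * (M b)%:R)) = ypow a (um a).
Proof.
(* The predecessor of [Nm a] is truncated when [Nm a] is 0, but then [ypow] is an empty product. *)
rewrite -!ypowD; case: (posnP (Nm a)) => [Na0|Na0].
  have e r : ypow a r = 1.
    by rewrite /ypow; apply: big1 => -[j jn] _; exfalso; move: jn; rewrite Na0.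
  by rewrite !e.
congr (ypow a _).
have -> : (Nm a).-1%:R = (Nm a)%:R - 1 :> R.
  by rewrite -[in RHS](prednK Na0) -natr1 addrK.
have := umE a; rewrite cartan_sum opprK -!mulr_sumr.
have -> : \sum_(b < N.-1 | b.+1 == a :> nat) (M b)%:R = \sum_(b < N.-1 | a == b.+1 :> nat) (M b)%:R :> R.
  by apply: eq_bigl => b; rewrite eq_sym.
have -> : (M a)%:R = (Np a)%:R + (Nm a)%:R :> R by rewrite -natrD.
move: (\sum_(b < N.-1 | b == a.+1 :> nat) (M b)%:R) (\sum_(b < N.-1 | a == b.+1 :> nat) (M b)%:R).
move=> A B h; nra.
Qed.

Lemma df_integrand_factor (al1 al2 al3 : 'rV[R]_N.-1) :
  (forall a, u a = rform al1 (simple_root R a)) ->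
  (forall a, v a = rform al2 (simple_root R a)) ->
  (forall a, w a = rform al3 (simple_root R a)) ->
  (\prod_(ai <- variables M) df_jac ai (y ai)) * df_integrand M beta al1 al2 al3 q z =
  q `^ (\sum_(a < N.-1) \sum_(i < Np a) \sum_(j < Np a | (i < j)%N) (2 * beta) +
        \sum_(a < N.-1) \sum_(i < Np a) (1 + u a + v a) +
        \sum_(a < N.-1) \sum_(b < N.-1 | b == a.+1 :> nat) \sum_(i < Np a) \sum_(j < Np b) (- beta)) *
  selberg_weight Np u v beta y * selberg_weight Nm um w beta y' *
  (binom_product (cross_factors beta Np Nm v w y y') q *
   (1 - q) `^ (- \sum_(a < N) vprime_plus v a * vprime_minus w a / beta)).
Proof.
move=> uE vE wE.
have jacE : \prod_(ai <- variables M) df_jac ai (y ai) =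
    \prod_(a < N.-1) \prod_(i < M a) df_jac (a, val i) (y (a, val i)).
  rewrite /variables big_allpairs_dep /= big_enum /=; apply: eq_bigr => a _.
  by rewrite -[X in iota 0 X]subn0 -/(index_iota 0 (M a)) big_mkord.
pose same a := \prod_(i < M a) \prod_(j < M a | (i < j)%N) `|z (a, val j) - z (a, val i)| `^ (2 * beta).
pose sing a := \prod_(i < M a) (df_jac (a, val i) (y (a, val i)) * (`|z (a, val i)| `^ u a *
    `|z (a, val i) - q| `^ v a * `|z (a, val i) - 1| `^ w a)).
pose neigh a b := \prod_(i < M a) \prod_(j < M b) `|z (b, val j) - z (a, val i)| `^ (- beta).
transitivity ((\prod_(a < N.-1) same a) * (\prod_(a < N.-1) sing a) *
    \prod_(a < N.-1) \prod_(b < N.-1 | b == a.+1 :> nat) neigh a b).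
  have -> : \prod_(a < N.-1) sing a =
      (\prod_(a < N.-1) \prod_(i < M a) df_jac (a, val i) (y (a, val i))) *
      \prod_(a < N.-1) \prod_(i < M a) (`|z (a, val i)| `^ rform al1 (simple_root R a) *
        `|z (a, val i) - q| `^ rform al2 (simple_root R a) *
        `|z (a, val i) - 1| `^ rform al3 (simple_root R a)).
    rewrite -big_split; apply: eq_bigr => a _ /=; rewrite -big_split; apply: eq_bigr => i _ /=.
    by rewrite uE vE wE.
  by rewrite jacE /df_integrand /same /neigh; ring.
rewrite /same (eq_bigr _ (fun a _ => same_colour a (2 * beta))).
rewrite /sing (eq_bigr _ (fun a _ => singles a)).
rewrite /neigh (eq_bigr _ (fun a _ => eq_bigr _ (fun b _ => neighbours a b (- beta)))).
(* An edge of the Dynkin diagram contributes powers to both of its ends; reindexing gathers, for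
   each colour, those coming from its two neighbours. *)
have nE : \prod_(a < N.-1) \prod_(b < N.-1 | b == a.+1 :> nat)
      (ypow a (- - beta * (M b)%:R) * ypow b (- - beta * (M a)%:R)) =
    \prod_(a < N.-1) (ypow a (\sum_(b < N.-1 | b == a.+1 :> nat) (- - beta) * (M b)%:R) *
      ypow a (\sum_(b < N.-1 | a == b.+1 :> nat) (- - beta) * (M b)%:R)).
  under eq_bigr do rewrite big_split /=.
  rewrite !big_split /=; congr (_ * _); first by apply: eq_bigr => a _; rewrite ypow_sum.
  rewrite (exchange_big_dep predT)//=; apply: eq_bigr => b _; exact: ypow_sum.
have selE : selberg_weight Nm um w beta y' =
    (\prod_(a < N.-1) (`|Delta Nm y' a| `^ (2 * beta))) *
    (\prod_(a < N.-1) ypow a (um a)) *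
    (\prod_(a < N.-1) \prod_(j < Nm a) (1 - y' (a, val j)) `^ w a) *
    \prod_(a < N.-1) \prod_(b < N.-1 | b == a.+1 :> nat) `|Delta2 Nm y' a b| `^ (- beta).
  rewrite /selberg_weight; congr (_ * _); rewrite -!big_split; apply: eq_bigr => a _ /=.
  by rewrite big_split /= mulrA.
have cancel_q S : (1 - q) `^ S * (1 - q) `^ (- S) = 1.
  have q1 : 0 < 1 - q by rewrite subr_gt0; case/andP: q01.
  by rewrite -gt0_powRD// subrr powRr0.
have split5 (F1 F2 F3 F4 F5 : 'I_N.-1 -> 'I_N.-1 -> R) (P : 'I_N.-1 -> pred 'I_N.-1) :
    \prod_(a < N.-1) \prod_(b < N.-1 | P a b) (F1 a b * F2 a b * F3 a b * F4 a b * F5 a b) =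
    (\prod_(a < N.-1) \prod_(b < N.-1 | P a b) F1 a b) *
    (\prod_(a < N.-1) \prod_(b < N.-1 | P a b) F2 a b) *
    (\prod_(a < N.-1) \prod_(b < N.-1 | P a b) F3 a b) *
    (\prod_(a < N.-1) \prod_(b < N.-1 | P a b) F4 a b) *
    (\prod_(a < N.-1) \prod_(b < N.-1 | P a b) F5 a b).
  by rewrite -!big_split; apply: eq_bigr => a _ /=; rewrite -!big_split.
rewrite split5 nE selE -(eq_bigr _ (fun a _ => ypow_exponent a)) binom_product_cross//.
rewrite -(mulrA _ ((1 - q) `^ _)) cancel_q mulr1 !gt0_powRD// -(prod_powR _ _ (fun a => \sum_(b < N.-1 | _) _))//.
under [\prod_(a < N.-1) q `^ (\sum_(b < N.-1 | _) _)]eq_bigr do rewrite -prod_powR//.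
rewrite /selberg_weight !big_split /= !prod_powR//.
ring.
Qed.

End Integrand.

(** * Measurable and bounded functions of a configuration *)

Section MeasurableBounded.
Context {R : realType} {I : eqType}.
Notation T := (measurableTypeR R).
Implicit Types (f g : (I -> R) -> R) (B : (I -> R) -> Prop).

Definition real_measurable f := config_measurable (EFin \o f).

Lemma real_measurableP f : real_measurable f <->
  forall d (X : measurableType d) (x : X -> I -> T),
    (forall i, measurable_fun setT (x^~ i)) -> measurable_fun setT (fun t => f (x t) : T).
Proof. by split=> h d X x mx; apply/measurable_EFinP; exact: h. Qed.

Lemma real_measurable_cst c : real_measurable (fun=> c).
Proof. by move=> d X x mx; exact: measurable_cst. Qed.

Lemma real_measurable_coord i : real_measurable (fun y => y i).
Proof. by apply/real_measurableP => d X x mx; exact: mx. Qed.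

Lemma real_measurableD f g : real_measurable f -> real_measurable g ->
  real_measurable (fun y => f y + g y).
Proof.
move=> /real_measurableP mf /real_measurableP mg; apply/real_measurableP => d X x mx.
by apply: measurable_funD; [exact: mf|exact: mg].
Qed.

Lemma real_measurableN f : real_measurable f -> real_measurable (fun y => - f y).
Proof.
move=> /real_measurableP mf; apply/real_measurableP => d X x mx.
by apply: measurableT_comp => //; exact: mf.
Qed.

Lemma real_measurableM f g : real_measurable f -> real_measurable g ->
  real_measurable (fun y => f y * g y).
Proof.
move=> /real_measurableP mf /real_measurableP mg; apply/real_measurableP => d X x mx.
by apply: measurable_funM; [exact: mf|exact: mg].
Qed.

Lemma real_measurable_norm f : real_measurable f -> real_measurable (fun y => `|f y|).
Proof.
move=> /real_measurableP mf; apply/real_measurableP => d X x mx.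
by apply: measurableT_comp => //; exact: mf.
Qed.

Lemma real_measurable_powR f r : real_measurable f -> real_measurable (fun y => f y `^ r).
Proof.
move=> /real_measurableP mf; apply/real_measurableP => d X x mx.
by apply: (measurableT_comp (measurable_powR r)); exact: mf.
Qed.

Lemma real_measurable_sum (J : Type) (s : seq J) (P : pred J) (f : J -> (I -> R) -> R) :
  (forall j, real_measurable (f j)) -> real_measurable (fun y => \sum_(j <- s | P j) f j y).
Proof.
move=> mf; elim: s => [|j s IH].
  by under eq_fun do rewrite big_nil; exact: real_measurable_cst.
under eq_fun do rewrite big_cons.
by case: (P j) => //; exact: real_measurableD.
Qed.

Lemma real_measurable_prod (J : Type) (s : seq J) (P : pred J) (f : J -> (I -> R) -> R) :
  (forall j, real_measurable (f j)) -> real_measurable (fun y => \prod_(j <- s | P j) f j y).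
Proof.
move=> mf; elim: s => [|j s IH].
  by under eq_fun do rewrite big_nil; exact: real_measurable_cst.
under eq_fun do rewrite big_cons.
by case: (P j) => //; exact: real_measurableM.
Qed.

Lemma real_measurableX f n : real_measurable f -> real_measurable (fun y => f y ^+ n).
Proof.
move=> mf; elim: n => [|n IH]; first exact: real_measurable_cst.
by under eq_fun do rewrite exprS; exact: real_measurableM.
Qed.

Lemma real_measurable_comp (K : eqType) (h : (K -> R) -> R) (phi : (I -> R) -> K -> R) :
  config_measurable (EFin \o h) -> (forall k, real_measurable (fun y => phi y k)) ->
  real_measurable (fun y => h (phi y)).
Proof.
move=> mh mphi d X x mx; apply: mh => k.
by have /real_measurableP := mphi k; apply.
Qed.

Definition bounded_on B f := exists K, forall y, B y -> `|f y| <= K.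

Lemma bounded_on_cst B c : bounded_on B (fun=> c).
Proof. by exists `|c|. Qed.

Lemma bounded_onD B f g : bounded_on B f -> bounded_on B g ->
  bounded_on B (fun y => f y + g y).
Proof.
move=> [K fK] [L gL]; exists (K + L) => y By.
by apply: le_trans (ler_normD _ _) _; rewrite lerD ?fK ?gL.
Qed.

Lemma bounded_onN B f : bounded_on B f -> bounded_on B (fun y => - f y).
Proof. by move=> [K fK]; exists K => y By; rewrite normrN fK. Qed.

Lemma bounded_onM B f g : bounded_on B f -> bounded_on B g ->
  bounded_on B (fun y => f y * g y).
Proof.
move=> [K fK] [L gL]; exists (K * L) => y By.
by rewrite normrM ler_pM ?fK ?gL.
Qed.

Lemma bounded_on_sum B (J : Type) (s : seq J) (P : pred J) (f : J -> (I -> R) -> R) :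
  (forall j, bounded_on B (f j)) -> bounded_on B (fun y => \sum_(j <- s | P j) f j y).
Proof.
move=> bf; elim: s => [|j s IH].
  by under eq_fun do rewrite big_nil; exact: bounded_on_cst.
under eq_fun do rewrite big_cons.
by case: (P j) => //; exact: bounded_onD.
Qed.

Lemma bounded_on_prod B (J : Type) (s : seq J) (P : pred J) (f : J -> (I -> R) -> R) :
  (forall j, bounded_on B (f j)) -> bounded_on B (fun y => \prod_(j <- s | P j) f j y).
Proof.
move=> bf; elim: s => [|j s IH].
  by under eq_fun do rewrite big_nil; exact: bounded_on_cst.
under eq_fun do rewrite big_cons.
by case: (P j) => //; exact: bounded_onM.
Qed.

End MeasurableBounded.

Section ConfigFunctions.
Variables (R : realType) (N : nat).
Implicit Types (K : 'I_N.-1 -> nat) (u v : 'I_N.-1 -> R) (y : @config R N).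

Lemma mem_variables K ai : (ai \in variables K) = (ai.2 < K ai.1)%N.
Proof.
apply/allpairsPdep/idP => [[a [i [_]]]|h].
  by rewrite mem_iota add0n => iK ->.
by exists ai.1, ai.2; rewrite mem_enum mem_iota add0n -surjective_pairing.
Qed.

Lemma uniq_variables K : uniq (variables K).
Proof.
apply: allpairs_uniq_dep; first exact: enum_uniq.
  by move=> a _; exact: iota_uniq.
by move=> [a i] [b j] _ _ [-> ->].
Qed.

Lemma real_measurable_selberg K u v beta : real_measurable (selberg_weight K u v beta).
Proof.
apply: real_measurableM.
  apply: real_measurable_prod => a; apply: real_measurableM.
    apply: real_measurable_powR; apply: real_measurable_norm.
    apply: real_measurable_prod => i; apply: real_measurable_prod => j.
    apply: real_measurableD; first exact: real_measurable_coord.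
    by apply: real_measurableN; exact: real_measurable_coord.
  apply: real_measurable_prod => i; apply: real_measurableM; apply: real_measurable_powR.
    exact: real_measurable_coord.
  apply: real_measurableD; first exact: real_measurable_cst.
  by apply: real_measurableN; exact: real_measurable_coord.
apply: real_measurable_prod => a; apply: real_measurable_prod => b.
apply: real_measurable_powR; apply: real_measurable_norm.
apply: real_measurable_prod => i; apply: real_measurable_prod => j.
apply: real_measurableD; first exact: real_measurable_coord.
by apply: real_measurableN; exact: real_measurable_coord.
Qed.

Lemma selberg_weight_ge0 K u v beta y : 0 <= selberg_weight K u v beta y.
Proof.
rewrite /selberg_weight mulr_ge0// prodr_ge0// => a _.
  by rewrite mulr_ge0 ?powR_ge0// prodr_ge0// => i _; rewrite mulr_ge0 ?powR_ge0.
by rewrite prodr_ge0// => b _; rewrite powR_ge0.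
Qed.

Lemma real_measurable_df K beta (al1 al2 al3 : 'rV[R]_N.-1) q :
  real_measurable (df_integrand K beta al1 al2 al3 q).
Proof.
have mdist (c : R) ai : real_measurable (fun y : config R N => `|y ai - c|).
  apply: real_measurable_norm; apply: real_measurableD; first exact: real_measurable_coord.
  exact: real_measurable_cst.
have mdist2 ai bj : real_measurable (fun y : config R N => `|y ai - y bj|).
  apply: real_measurable_norm; apply: real_measurableD; first exact: real_measurable_coord.
  by apply: real_measurableN; exact: real_measurable_coord.
apply: real_measurableM; first apply: real_measurableM.
- apply: real_measurable_prod => a; apply: real_measurable_prod => i.
  by apply: real_measurable_prod => j; exact: real_measurable_powR.
- apply: real_measurable_prod => a; apply: real_measurable_prod => i.
  apply: real_measurableM; first apply: real_measurableM; apply: real_measurable_powR => //.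
  by apply: real_measurable_norm; exact: real_measurable_coord.
- apply: real_measurable_prod => a; apply: real_measurable_prod => b.
  apply: real_measurable_prod => i; apply: real_measurable_prod => j.
  exact: real_measurable_powR.
Qed.

Lemma df_integrand_ge0 K beta (al1 al2 al3 : 'rV[R]_N.-1) q y :
  0 <= df_integrand K beta al1 al2 al3 q y.
Proof.
rewrite /df_integrand !mulr_ge0//; apply: prodr_ge0 => a _; apply: prodr_ge0 => i _.
- by apply: prodr_ge0 => j _; rewrite powR_ge0.
- by rewrite !mulr_ge0 ?powR_ge0.
- by apply: prodr_ge0 => k _; apply: prodr_ge0 => j _; rewrite powR_ge0.
Qed.

(** One family for both averages: the sign s is - 1 near 0 and 1 near infinity, and c is the
    constant shift built from v'. *)
Definition jack_product beta (J : youngdiag -> symfun R) K (s : R) (c : 'I_N -> R)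
    (Y : {ffun 'I_N -> youngdiag}) y : R :=
  \prod_(a < N) normalized_jack beta J (Y a) (fun k => s * rdiff K y a k + c a).

Lemma real_measurable_jack_product beta J K s c Y :
  real_measurable (jack_product beta J K s c Y).
Proof.
apply: real_measurable_prod => a; apply: real_measurableM; last exact: real_measurable_cst.
apply: real_measurable_sum => lam; apply: real_measurableM; first exact: real_measurable_cst.
apply: real_measurable_prod => k; apply: real_measurableD; last exact: real_measurable_cst.
apply: real_measurableM; first exact: real_measurable_cst.
have mp b : real_measurable (fun y : config R N => colour_powersum K y b k).
  by apply: real_measurable_sum => i; apply: real_measurableX; exact: real_measurable_coord.
apply: real_measurableD; first exact: real_measurable_sum.
by apply: real_measurableN; exact: real_measurable_sum.
Qed.

Definition unit_on K y := forall ai, ai \in variables K -> 0 <= y ai <= 1.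

Lemma bounded_jack_product beta J K s c Y :
  bounded_on (unit_on K) (jack_product beta J K s c Y).
Proof.
apply: bounded_on_prod => a; apply: bounded_onM; last exact: bounded_on_cst.
apply: bounded_on_sum => lam; apply: bounded_onM; first exact: bounded_on_cst.
apply: bounded_on_prod => k; apply: bounded_onD; last exact: bounded_on_cst.
apply: bounded_onM; first exact: bounded_on_cst.
have bp b : bounded_on (unit_on K) (fun y => colour_powersum K y b k).
  apply: bounded_on_sum => i; exists 1 => y By.
  have /andP[y0 y1] : 0 <= y (b, val i) <= 1 by apply: By; rewrite mem_variables /= ltn_ord.
  by rewrite normrX ger0_norm// exprn_ile1.
apply: bounded_onD; first exact: bounded_on_sum.
by apply: bounded_onN; exact: bounded_on_sum.
Qed.

Lemma eq_jack_product beta J K s c Y y y' :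
  (forall ai, ai \in variables K -> y ai = y' ai) ->
  jack_product beta J K s c Y y = jack_product beta J K s c Y y'.
Proof.
move=> yy'; have pE b k : colour_powersum K y b k = colour_powersum K y' b k.
  by apply: eq_bigr => i _; rewrite yy'// mem_variables /= ltn_ord.
apply: eq_bigr => a _; congr (_ / _); apply: eq_bigr => lam _; congr (_ * _).
apply: eq_bigr => k _; congr (_ * _ + _); rewrite /rdiff; congr (_ - _); exact: eq_bigr.
Qed.

Lemma eq_selberg_weight K u v beta y y' :
  (forall ai, ai \in variables K -> y ai = y' ai) ->
  selberg_weight K u v beta y = selberg_weight K u v beta y'.
Proof.
move=> yy'; have yE a (i : 'I_(K a)) : y (a, val i) = y' (a, val i).
  by rewrite yy'// mem_variables /= ltn_ord.
rewrite /selberg_weight; congr (_ * _); apply: eq_bigr => a _.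
  congr (`|_| `^ _ * _); last by apply: eq_bigr => i _; rewrite yE.
  by apply: eq_bigr => i _; apply: eq_bigr => j _; rewrite !yE.
apply: eq_bigr => b _; congr (`|_| `^ _).
by apply: eq_bigr => i _; apply: eq_bigr => j _; rewrite !yE.
Qed.

End ConfigFunctions.

(** * The Dotsenko-Fateev integral *)

Section RootSystem.
Variables (R : realType) (N : nat).
Implicit Types x y : 'rV[R]_N.-1.

Lemma rformD x x' y : rform (x + x') y = rform x y + rform x' y.
Proof. by rewrite /rform !mulmxDl mxE. Qed.

Lemma rformZ c x y : rform (c *: x) y = c * rform x y.
Proof. by rewrite /rform -!scalemxAl mxE. Qed.

Lemma rform0 y : rform 0 y = 0.
Proof. by rewrite /rform !mul0mx mxE. Qed.

Lemma rform_sum (I : finType) (x : I -> 'rV[R]_N.-1) y :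
  rform (\sum_i x i) y = \sum_i rform (x i) y.
Proof.
apply: (big_morph (fun x => rform x y)) => [u v|]; [exact: rformD|exact: rform0].
Qed.

Lemma rform_simple_root (a b : 'I_N.-1) :
  rform (simple_root R b) (simple_root R a) = cartan R N a b.
Proof.
rewrite /rform /simple_root trmx_delta -rowE -colE !mxE (eq_sym b a).
by rewrite orbC.
Qed.

End RootSystem.

Section ColourSplit.
Variables (N : nat) (Np Nm : 'I_N.-1 -> nat).
Let M a := (Np a + Nm a)%N.

Lemma df_shift_inj : injective (df_shift Np).
Proof. by move=> [a i] [b j] [/= -> /addnI ->]. Qed.

Let filter_variables (P : pred ('I_N.-1 * nat)) :
  [seq ai <- variables M | P ai] =
  flatten [seq [seq ai <- [seq (a, i) | i <- iota 0 (M a)] | P ai] | a <- enum 'I_N.-1].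
Proof. by rewrite /variables /allpairs_dep filter_flatten -map_comp. Qed.

Lemma variables_plus : [seq ai <- variables M | (ai.2 < Np ai.1)%N] = variables Np.
Proof.
rewrite (filter_variables (fun ai => ai.2 < Np ai.1)%N) /variables /allpairs_dep.
congr flatten; apply: eq_map => a; rewrite filter_map; congr map.
rewrite /M iotaD filter_cat add0n [X in X ++ _](_ : _ = iota 0 (Np a)); last first.
  by apply/all_filterP/allP => i /=; rewrite mem_iota add0n.
rewrite [X in _ ++ X](_ : _ = [::]) ?cats0//.
rewrite -(filter_pred0 (iota (Np a) (Nm a))); apply: eq_in_filter => i /=.
by rewrite mem_iota => /andP[h _]; rewrite ltnNge h.
Qed.

Lemma variables_minus :
  [seq ai <- variables M | ~~ (ai.2 < Np ai.1)%N] = map (df_shift Np) (variables Nm).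
Proof.
rewrite (filter_variables (fun ai => ~~ (ai.2 < Np ai.1))%N) /variables /allpairs_dep.
rewrite map_flatten -map_comp; congr flatten; apply: eq_map => a /=.
rewrite filter_map -map_comp.
rewrite /M iotaD filter_cat add0n [X in X ++ _](_ : _ = [::]); last first.
  rewrite -(filter_pred0 (iota 0 (Np a))); apply: eq_in_filter => i /=.
  by rewrite mem_iota add0n => /andP[_ ->].
rewrite /= [X in map _ X](_ : _ = iota (Np a) (Nm a)); last first.
  by apply/all_filterP/allP => i /=; rewrite mem_iota => /andP[h _]; rewrite -leqNgt.
by rewrite -[X in iota X _]addn0 iotaDl -map_comp.
Qed.

End ColourSplit.

Section UnitInterval.
Variables (R : realType) (N : nat).
Notation T := (measurableTypeR R).

Definition half_open_unit (_ : 'I_N.-1 * nat) : set R := `]0, 1]%classic.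

Lemma integral_half_open_unit i (h : T -> \bar R) : measurable_fun setT h ->
  (\int[@lebesgue_measure R]_(t in @unit_box R N i) h t =
   \int[@lebesgue_measure R]_(t in half_open_unit i) h t)%E.
Proof.
move=> mh; apply/esym/integral_itv_obnd_cbnd; exact: measurable_funTS.
Qed.

Lemma measurable_half_open_unit i : measurable (half_open_unit i : set T).
Proof. exact: measurable_itv. Qed.

Lemma measurable_unit_box i : measurable (@unit_box R N i : set T).
Proof. exact: measurable_itv. Qed.

Lemma averageE K u v beta f : real_measurable f ->
  average K u v beta f =
  fine (weighted_integral half_open_unit (variables K) (fun=> 0) (selberg_weight K u v beta) f) /
  fine (iterated_integral half_open_unit (variables K)
    (EFin \o selberg_weight K u v beta) (fun=> 0)).
Proof.
move=> mf; rewrite /average /selberg /integral_vars /weighted_integral.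
rewrite !(@eq_iterated_integral_domain _ _ (@unit_box R N) half_open_unit)//.
- exact: integral_half_open_unit.
- exact: measurable_unit_box.
- exact: real_measurable_selberg.
- exact: integral_half_open_unit.
- exact: measurable_unit_box.
- by apply: real_measurableM => //; exact: real_measurable_selberg.
Qed.

Lemma selbergE K u v beta : selberg K u v beta =
  iterated_integral half_open_unit (variables K) (EFin \o selberg_weight K u v beta) (fun=> 0).
Proof.
apply: eq_iterated_integral_domain.
- exact: integral_half_open_unit.
- exact: measurable_unit_box.
- exact: real_measurable_selberg.
Qed.

Lemma reachable_unit_on K y : reachable half_open_unit (variables K) (fun=> 0) y -> unit_on K y.
Proof.
move=> ry ai aiK; have := ry ai; rewrite aiK /half_open_unit /= in_itv /=.
by move=> /andP[/ltW -> ->].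
Qed.

Variables (Np Nm : 'I_N.-1 -> nat) (q : R).
Hypothesis q01 : 0 < q < 1.

Lemma measurable_df_jac ai : measurable_fun [set: T] (df_jac Np q ai : T -> R).
Proof.
rewrite /df_jac; case: (_ < _)%N => //; under eq_fun do rewrite -exprVn.
by apply: measurable_funX; exact: measurable_invr.
Qed.

Lemma measurable_df_phi ai : measurable_fun [set: T] (df_phi Np q ai : T -> T).
Proof.
rewrite /df_phi; case: (_ < _)%N; last exact: measurable_invr.
exact: mulrl_measurable.
Qed.

Lemma df_jac_ge0 ai t : 0 <= df_jac Np q ai t.
Proof.
rewrite /df_jac; case: ifP => _; first by case/andP: q01 => /ltW.
by rewrite invr_ge0 sqr_ge0.
Qed.

Lemma integral_df_domain ai (h : T -> \bar R) :
  measurable_fun setT h -> (forall t, (0 <= h t)%E) ->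
  (\int[@lebesgue_measure R]_(t in df_domain Np q ai) h t =
   \int[@lebesgue_measure R]_(t in half_open_unit ai)
     ((df_jac Np q ai t)%:E * h (df_phi Np q ai t)))%E.
Proof.
move=> mh h0; rewrite /df_domain /df_jac /df_phi /half_open_unit.
case: ifP => _; first by apply: integral_scale => //; case/andP: q01.
exact: integral_invert.
Qed.

Lemma measurable_df_domain ai : measurable (df_domain Np q ai : set T).
Proof. by rewrite /df_domain; case: ifP => _; exact: measurable_itv. Qed.

(* The substitution z = q x for the variables near 0, z = 1 / x for the others. *)
Lemma df_substitution beta (al1 al2 al3 : 'rV[R]_N.-1) :
  let M a := (Np a + Nm a)%N in
  integral_vars M (df_domain Np q) (fun z => (df_integrand M beta al1 al2 al3 q z)%:E) =
  iterated_integral half_open_unit (variables M)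
    (fun y => ((\prod_(ai <- variables M) df_jac Np q ai (y ai)) *
      df_integrand M beta al1 al2 al3 q (fun ai => df_phi Np q ai (y ai)))%:E) (fun=> 0).
Proof.
move=> M; rewrite /integral_vars.
(* The coordinates that are not integrated have the value 0, which the substitution fixes because
   0^-1 = 0. *)
rewrite [X in iterated_integral _ _ _ X = _]
  (_ : _ = (fun ai => df_phi Np q ai ((fun=> 0 : R) ai))); last first.
  by apply/funext => ai; rewrite /df_phi mulr0 invr0 if_same.
rewrite (@iterated_integral_change_of_variables _ _ _ half_open_unit (df_jac Np q) (df_phi Np q) _ _ (fun=> 0))//.
- exact: integral_df_domain.
- exact: measurable_df_domain.
- exact: measurable_half_open_unit.
- exact: measurable_df_jac.
- exact: measurable_df_phi.
- exact: df_jac_ge0.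
- exact: uniq_variables.
- exact: real_measurable_df.
- by move=> y; rewrite lee_fin df_integrand_ge0.
Qed.

End UnitInterval.

(** * Integration of the expansion term by term *)

Section Expansion.
Variables (R : realType) (N : nat) (beta : R) (Np Nm : 'I_N.-1 -> nat).
Variables (u v w um : 'I_N.-1 -> R) (J : youngdiag -> symfun R).
Hypotheses (hN : (2 <= N)%N) (beta_gt0 : 0 < beta) (hJ : is_jack beta J).
Let M a := (Np a + Nm a)%N.
Notation U := (@half_open_unit R N).
Notation s := (variables M).
Notation o := (fun=> 0 : R).
Notation sh := (df_shift Np).
Notation Wp := (selberg_weight Np u v beta).
Notation Wm := (selberg_weight Nm um w beta).
Hypothesis Wp_fin : (iterated_integral U (variables Np) (EFin \o Wp) o < +oo)%E.
Hypothesis Wm_fin : (iterated_integral U (variables Nm) (EFin \o Wm) o < +oo)%E.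

Definition jack_plus := jack_product beta J Np (-1) (fun a => - (vprime_plus v a / beta)).
Definition jack_minus := jack_product beta J Nm 1 (fun a => vprime_minus w a / beta).

Let A Y := fine (weighted_integral U (variables Np) o Wp (jack_plus Y)).
Let B Y := fine (weighted_integral U (variables Nm) o Wm (jack_minus Y)).

Let P (ai : 'I_N.-1 * nat) := (ai.2 < Np ai.1)%N.
Let Wm' y := Wm (y \o sh).

Let sP : [seq ai <- s | P ai] = variables Np. Proof. exact: variables_plus. Qed.
Let sNP : [seq ai <- s | ~~ P ai] = map sh (variables Nm). Proof. exact: variables_minus. Qed.

Let mshift f : real_measurable f -> real_measurable (fun y : @config R N => f (y \o sh)).
Proof. by move=> mf; apply: real_measurable_comp => // k; exact: real_measurable_coord. Qed.

Let minus_total f : iterated_integral U [seq ai <- s | ~~ P ai] (fun y => f (y \o sh)) o =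
  iterated_integral U (variables Nm) f o.
Proof. by rewrite sNP (iterated_integral_map (E := U))//; exact: df_shift_inj. Qed.

Let sub_plus : {subset variables Np <= s}.
Proof. by move=> ai; rewrite -sP mem_filter => /andP[]. Qed.

Let sub_minus : {subset map sh (variables Nm) <= s}.
Proof. by move=> ai; rewrite -sNP mem_filter => /andP[]. Qed.

Let unit_plus r y : {subset variables Np <= r} -> reachable U r o y -> unit_on Np y.
Proof.
move=> sub ry ai aiN; have := ry ai; rewrite (sub _ aiN) /half_open_unit /= in_itv /=.
by move=> /andP[/ltW -> ->].
Qed.

Let unit_minus r y : {subset map sh (variables Nm) <= r} -> reachable U r o y ->
  unit_on Nm (y \o sh).
Proof.
move=> sub ry ai aiN; have := ry (sh ai).
rewrite (sub _ (map_f _ aiN)) /half_open_unit /= in_itv /=.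
by move=> /andP[/ltW -> ->].
Qed.

Let plus_insensitive (f : @config R N -> R) :
  (forall y y', (forall ai, ai \in variables Np -> y ai = y' ai) -> f y = f y') ->
  forall i y t, i \in s -> ~~ P i -> f (update y i t) = f y.
Proof.
move=> fE i y t _ Pi; apply: fE => ai; rewrite mem_variables => aiN.
by rewrite /update; case: eqP => // aiE; move: Pi; rewrite -aiE /P aiN.
Qed.

Let minus_insensitive (f : @config R N -> R) i y t :
  i \in s -> P i -> f (update y i t \o sh) = f (y \o sh).
Proof.
move=> _ Pi; congr f; apply/funext => ai; rewrite /update /=.
by case: eqP => // aiE; move: Pi; rewrite -aiE /P /= ltnNge leq_addr.
Qed.

Let mU := @measurable_half_open_unit R N.
Let mWp := @real_measurable_selberg R N Np u v beta.
Let mWm := @real_measurable_selberg R N Nm um w beta.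
Let mWm' : real_measurable Wm' := mshift mWm.
Let Wp0 y : 0 <= Wp y. Proof. exact: selberg_weight_ge0. Qed.
Let Wm'0 y : 0 <= Wm' y. Proof. exact: selberg_weight_ge0. Qed.
Let WpP := plus_insensitive (@eq_selberg_weight R N Np u v beta).
Let WmP := minus_insensitive Wm.

Let Wp_fin' : (iterated_integral U [seq ai <- s | P ai] (EFin \o Wp) o < +oo)%E.
Proof. by rewrite sP. Qed.

Let Wm_fin' : (iterated_integral U [seq ai <- s | ~~ P ai] (EFin \o Wm') o < +oo)%E.
Proof. by rewrite (minus_total (EFin \o Wm)). Qed.

Let W y := Wp y * Wm' y.
Let mW : real_measurable W := real_measurableM mWp mWm'.
Let W0 y : 0 <= W y. Proof. by rewrite mulr_ge0. Qed.
Let W_fin : (iterated_integral U s (EFin \o W) o < +oo)%E.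
Proof. exact: (iterated_integral_product_lty mU mWp mWm' Wp0 Wm'0 WpP WmP Wp_fin' Wm_fin'). Qed.

Let pair Y (y : @config R N) := jack_plus Y y * jack_minus Y (y \o sh).

Let mplus Y : real_measurable (jack_plus Y). Proof. exact: real_measurable_jack_product. Qed.
Let mminus Y : real_measurable (jack_minus Y). Proof. exact: real_measurable_jack_product. Qed.
Let mpair Y : real_measurable (pair Y) := real_measurableM (mplus Y) (mshift (mminus Y)).

Let bplus Y : exists K, forall r, {subset variables Np <= r} -> bounded_by U r o K (jack_plus Y).
Proof.
have [K FK] := bounded_jack_product beta J Np (-1) (fun a => - (vprime_plus v a / beta)) Y.
by exists K => r sub y ry; apply: FK; exact: unit_plus ry.
Qed.

Let bminus Y : exists K, forall r, {subset map sh (variables Nm) <= r} ->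
  bounded_by U r o K (fun y => jack_minus Y (y \o sh)).
Proof.
have [K FK] := bounded_jack_product beta J Nm 1 (fun a => vprime_minus w a / beta) Y.
by exists K => r sub y ry; apply: FK; exact: unit_minus ry.
Qed.

Let bpair Y : exists K, bounded_by U s o K (pair Y).
Proof.
have [K FK] := bplus Y; have [L GL] := bminus Y; exists (K * L) => y ry.
by rewrite normrM; apply: ler_pM; rewrite ?normr_ge0//; [exact: FK sub_plus y ry|exact: GL sub_minus y ry].
Qed.

Let pair_integral Y : fine (weighted_integral U s o W (pair Y)) = A Y * B Y.
Proof.
have [K FK] := bplus Y; have [L GL] := bminus Y.
pose H := `|K| + `|L|.
have F' r : {subset variables Np <= r} -> bounded_by U r o H (jack_plus Y).
  move=> sub y ry; apply: le_trans (FK r sub y ry) _.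
  by apply: le_trans (ler_norm _) _; rewrite lerDl.
have G' r : {subset map sh (variables Nm) <= r} ->
    bounded_by U r o H (fun y => jack_minus Y (y \o sh)).
  move=> sub y ry; apply: le_trans (GL r sub y ry) _.
  by apply: le_trans (ler_norm _) _; rewrite lerDr.
rewrite (weighted_integralM mU mWp mWm' Wp0 Wm'0 WpP WmP Wp_fin' Wm_fin' (K := H)
  (f := jack_plus Y) (g := fun y => jack_minus Y (y \o sh)))//.
- rewrite {1}/weighted_integral sP.
  rewrite [X in (_ * X)%E](_ : _ = weighted_integral U (variables Nm) o Wm (jack_minus Y)).
    rewrite fineM//.
      by apply: (weighted_integral_fin_num mU mWp Wp0 Wp_fin (mplus Y) (F' _ _)).
    have [K' FK'] := bounded_jack_product beta J Nm 1 (fun a => vprime_minus w a / beta) Y.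
    apply: (weighted_integral_fin_num (K := K') mU mWm _ Wm_fin (mminus Y)).
      by move=> y; exact: selberg_weight_ge0.
    by move=> y ry; apply: FK'; exact: reachable_unit_on ry.
  exact: (minus_total (fun y => (Wm y * jack_minus Y y)%:E)).
- exact: mplus.
- exact: (mshift (mminus Y)).
- exact: (plus_insensitive (@eq_jack_product R N beta J Np (-1) _ Y)).
- exact: (minus_insensitive (jack_minus Y)).
- exact: F'.
- by apply: F'; rewrite sP.
- exact: G'.
- by apply: G'; rewrite sNP.
- by rewrite addr_ge0.
Qed.

(** I is the integral of the full product of binomials. Its distance to the m-th partial sum is at
    most the uniform error [eps m] times the total weight, and the integral of each term splits by
    [pair_integral]. *)
Lemma df_series q : 0 < q < 1 -> exists I : R,
  (forall c : R, iterated_integral U s (fun y => (c * (Wp y * Wm (y \o sh) *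
    binom_product (cross_factors beta Np Nm v w y (y \o sh)) q))%:E) o = (c * I)%:E) /\
  series (fun n => q ^+ n * \sum_(Y <- tuple_seq N n) A Y * B Y) @ \oo --> I.
Proof.
move=> q01; have /andP[q0 q1] := q01.
have beta0 : beta != 0 by rewrite gt_eqF.
pose fs y := cross_factors beta Np Nm v w y (y \o sh).
pose h y := binom_product (fs y) q.
(* The weight of the factors is the same at every configuration, so it may be read off at the zero
   one. *)
pose K := Num.truncn (factor_weight (fs o)).
have fsK y : factor_weight (fs y) <= K.+1%:R.
  by rewrite (factor_weight_cross _ _ _ _ _ _ _ o (o \o sh)) ltW// truncnS_gt.
have fs01 y : reachable U s o y -> in_unit (fs y).
  move=> ry; apply: cross_factors_in_unit => a i.
    by apply: (unit_plus sub_plus ry); rewrite mem_variables /= ltn_ord.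
  by apply: (unit_minus sub_minus ry); rewrite mem_variables /= ltn_ord.
have q01' : 0 <= q < 1 by rewrite ltW.
have [eps eps0 epsP] := binom_product_uniform K q01'.
pose c n y := \sum_(Y <- tuple_seq N n) 1 * pair Y y.
have cE n y : reachable U s o y -> cycle_index (factor_sum (fs y)) n = c n y.
  move=> ry; rewrite /c (eq_cycle_index (c' := fun k => \sum_(a < N) beta *
      ((- rdiff Np y a k - vprime_plus v a / beta) *
       (rdiff Nm (y \o sh) a k + vprime_minus w a / beta)))); last first.
    by move=> k _; exact: factor_sum_cross.
  rewrite -(@sum_prod_tuple_seq N R (fun a Y =>
      normalized_jack beta J Y (fun k => - rdiff Np y a k - vprime_plus v a / beta) *
      normalized_jack beta J Y (fun k => rdiff Nm (y \o sh) a k + vprime_minus w a / beta))).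
    apply: eq_bigr => Y _; rewrite mul1r /pair /jack_plus /jack_minus /jack_product -big_split.
    apply: eq_bigr => a _ /=; congr (normalized_jack _ _ _ _ * normalized_jack _ _ _ _).
      by apply/funext => k; rewrite mulN1r.
    by apply/funext => k; rewrite mul1r.
  by move=> a m; exact: jack_cauchy.
have mc n : real_measurable (c n).
  by apply: real_measurable_sum => Y; apply: real_measurableM => //; exact: real_measurable_cst.
have bc n : exists L, bounded_by U s o L (c n).
  have : bounded_on (reachable U s o) (c n).
    by apply: bounded_on_sum => Y; apply: bounded_onM; [exact: bounded_on_cst|exact: bpair].
  by [].
pose S m y := \sum_(n <- iota 0 m) q ^+ n * c n y.
have SE m y : reachable U s o y ->
    S m y = \sum_(n < m) q ^+ n * cycle_index (factor_sum (fs y)) n.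
  move=> ry; rewrite /S -[X in iota 0 X]subn0 -/(index_iota 0 m) big_mkord.
  by apply: eq_bigr => n _; rewrite cE.
have hS m : bounded_by U s o (eps m) (fun y => 1 * h y + - 1 * S m y).
  move=> y ry; rewrite mul1r mulN1r SE//.
  by apply: epsP; [exact: fs01|exact: fsK].
have mh : real_measurable h.
  rewrite /h /fs; under eq_fun do rewrite binom_product_cross//.
  have mfac r (f : @config R N -> R) : real_measurable f ->
      real_measurable (fun y => (1 - f y * q) `^ r).
    move=> mf; apply: real_measurable_powR; apply: real_measurableD.
      exact: real_measurable_cst.
    by apply: real_measurableN; apply: real_measurableM => //; exact: real_measurable_cst.
  have mx ai : real_measurable (fun y : @config R N => y ai) by exact: real_measurable_coord.
  have my ai : real_measurable (fun y : @config R N => (y \o sh) ai) by exact: real_measurable_coord.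
  apply: real_measurableM; last exact: real_measurable_cst.
  apply: real_measurableM; first apply: real_measurableM; first apply: real_measurableM.
  - by apply: real_measurable_prod => a; apply: real_measurable_prod => i; exact: mfac.
  - by apply: real_measurable_prod => a; apply: real_measurable_prod => i; exact: mfac.
  - apply: real_measurable_prod => a; apply: real_measurable_prod => i.
    apply: real_measurable_prod => j; apply: mfac; exact: real_measurableM.
  - apply: real_measurable_prod => a; apply: real_measurable_prod => b.
    by apply: real_measurableM; apply: real_measurable_prod => i;
       apply: real_measurable_prod => j; apply: mfac; exact: real_measurableM.
have mS m : real_measurable (S m).
  by apply: real_measurable_sum => n; apply: real_measurableM => //; exact: real_measurable_cst.
have bS m : exists L, bounded_by U s o L (S m).
  have : bounded_on (reachable U s o) (S m).
    by apply: bounded_on_sum => n; apply: bounded_onM; [exact: bounded_on_cst|exact: bc].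
  by [].
(* The empty partial sum is 0, so the error at m = 0 bounds h itself. *)
have bh : bounded_by U s o (eps 0%N) h.
  by move=> y ry; have := hS 0%N y ry; rewrite /S big_nil mulr0 addr0 mul1r.
have cint n : fine (weighted_integral U s o W (c n)) = \sum_(Y <- tuple_seq N n) A Y * B Y.
  rewrite (weighted_integral_sum mU mW W0 W_fin (tuple_seq N n) (fun=> 1) mpair bpair) /=.
  by apply: eq_bigr => Y _; rewrite mul1r pair_integral.
have Sint m : weighted_integral U s o W (S m) =
    (series (fun n => q ^+ n * \sum_(Y <- tuple_seq N n) A Y * B Y) m)%:E.
  rewrite (weighted_integral_sum mU mW W0 W_fin (iota 0 m) (fun n => q ^+ n) mc bc).
  congr EFin; rewrite /series /= /index_iota subn0.
  by apply: eq_bigr => n _; rewrite cint.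
have Ifin := weighted_integral_fin_num mU mW W0 W_fin mh bh.
exists (fine (weighted_integral U s o W h)); split.
  have bh' (_ : unit) : exists L, bounded_by U s o L h by exists (eps 0%N).
  move=> c0; have := weighted_integral_sum mU mW W0 W_fin [:: tt] (fun=> c0) (fun=> mh) bh'.
  rewrite big_seq1 => <-; apply: eq_iterated_integral => y _.
  by rewrite big_seq1 mulrCA.
pose total := fine (iterated_integral U s (EFin \o W) o).
have total_fin : iterated_integral U s (EFin \o W) o \is a fin_num.
  by rewrite ge0_fin_numE//; apply: iterated_integral_ge0 => y; rewrite lee_fin.
have bound m : `|fine (weighted_integral U s o W h) -
    series (fun n => q ^+ n * \sum_(Y <- tuple_seq N n) A Y * B Y) m| <= `|eps m| * total.
  have hSm : bounded_by U s o `|eps m| (fun y => 1 * h y + - 1 * S m y).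
    by move=> y ry; apply: le_trans (hS m y ry) (ler_norm _).
  have mhS : real_measurable (fun y => 1 * h y + - 1 * S m y).
    by apply: real_measurableD; apply: real_measurableM => //; exact: real_measurable_cst.
  have := weighted_integral_le mU mW W0 W_fin (normr_ge0 _) mhS hSm.
  have [L SL] := bS m.
  rewrite (weighted_integralZD mU mW W0 W_fin 1 (- 1) (K := Num.max (eps 0%N) L) mh (mS m)).
  - rewrite Sint -(fineK Ifin) -(fineK total_fin) mul1e -EFinM -EFinD lee_fin mulN1r.
    by rewrite fineK.
  - by move=> y ry; rewrite le_max bh.
  - by move=> y ry; rewrite le_max SL// orbT.
apply/cvgrPdist_le => e e0.
have : `|eps m| * total @[m --> \oo] --> 0.
  rewrite -(mul0r total); apply: cvgMl; rewrite -(normr0 R); exact: cvg_norm.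
move=> /cvgrPdist_le/(_ e e0); apply: filterS => m.
rewrite sub0r normrN => /(le_trans (ler_norm _)) h1.
exact: le_trans (bound m) h1.
Qed.

End Expansion.

(** Clearing the denominator also works when the Selberg integral is 0: the weighted integral is
    then at most a bound of f times 0, so both sides vanish. *)
Lemma fine_weighted_integral (R : realType) (N : nat) (K : 'I_N.-1 -> nat) (u v : 'I_N.-1 -> R)
    (beta : R) (f : config R N -> R) :
  (selberg K u v beta < +oo)%E -> real_measurable f -> bounded_on (@unit_on R N K) f ->
  fine (weighted_integral (@half_open_unit R N) (variables K) (fun=> 0) (selberg_weight K u v beta) f) =
  average K u v beta f * fine (selberg K u v beta).
Proof.
rewrite selbergE => S_fin mf [L fL]; rewrite averageE//.
have mU := @measurable_half_open_unit R N.
have mW := @real_measurable_selberg R N K u v beta.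
have W0 y : 0 <= selberg_weight K u v beta y by exact: selberg_weight_ge0.
have fL' : bounded_by (@half_open_unit R N) (variables K) (fun=> 0) `|L| f.
  by move=> y ry; apply: le_trans (ler_norm _); apply: fL; exact: reachable_unit_on ry.
have [S0|S0] := eqVneq (fine (iterated_integral (@half_open_unit R N) (variables K)
    (EFin \o selberg_weight K u v beta) (fun=> 0))) 0; last by rewrite divfK.
rewrite S0 mulr0; have := weighted_integral_le mU mW W0 S_fin (normr_ge0 L) mf fL'.
have := weighted_integral_fin_num mU mW W0 S_fin mf fL'.
rewrite -[X in (_ <= _ * X)%E]fineK; last first.
  by rewrite ge0_fin_numE//; apply: iterated_integral_ge0 => y; rewrite lee_fin.
rewrite S0 mule0; case: weighted_integral => //= r _.
by rewrite lee_fin normr_le0 => /eqP.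
Qed.

Theorem proposition1 (R : realType) (N : nat) (hN : (2 <= N)%N)
  (beta : R) (hbeta : 0 < beta)
  (Np Nm : 'I_N.-1 -> nat)
  (al1 al2 al3 al4 rho : 'rV[R]_N.-1)
  (hrho : is_weyl_vector rho)
  (hal4 : al1 + al2 + al3 + al4
          + beta *: (\sum_(a < N.-1) (Np a + Nm a)%:R *: simple_root R a)
          + (2 * (1 - beta)) *: rho = 0)
  (J : youngdiag -> symfun R) (hJ : is_jack beta J) :
  let up a := rform al1 (simple_root R a) in
  let um a := rform al4 (simple_root R a) in
  let vp a := rform al2 (simple_root R a) in
  let vm a := rform al3 (simple_root R a) in
  (selberg Np up vp beta < +oo)%E ->
  (selberg Nm um vm beta < +oo)%E ->
  let term (Y : {ffun 'I_N -> youngdiag}) : R :=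
    average Np up vp beta (fun x => \prod_(a < N)
      normalized_jack beta J (Y a)
        (fun k => - rdiff Np x a k - vprime_plus vp a / beta)) *
    average Nm um vm beta (fun y => \prod_(a < N)
      normalized_jack beta J (Y a)
        (fun k => rdiff Nm y a k + vprime_minus vm a / beta)) in
  let partial_sums (q : R) : R^nat :=
    series (fun n => \sum_(Y \in diagram_tuples n) q ^+ n * term Y) in
  exists C kappa lambda : R, C != 0 /\
    forall q : R, 0 < q < 1 ->
      cvgn (partial_sums q) /\
      Z_DF Np Nm beta al1 al2 al3 q =
        (C * q `^ kappa * (1 - q) `^ lambda * limn (partial_sums q))%:E.
Proof.
move=> up um vp vm Sp_fin Sm_fin term partial_sums.
pose M a := (Np a + Nm a)%N.
pose Sp := fine (selberg Np up vp beta); pose Sm := fine (selberg Nm um vm beta).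
(* C is the Selberg normalization of the two averages. It has to be nonzero, so 1 takes its place
   when the product vanishes; in that case division by 0 makes every [term] equal to 0. *)
pose C := if Sp * Sm == 0 then 1 else Sp * Sm.
(* The power of q released by the scaling z = q x: pairs of one colour, then the Jacobian and the
   single factors, then neighbouring colours. *)
pose k0 := \sum_(a < N.-1) \sum_(i < Np a) \sum_(j < Np a | (i < j)%N) (2 * beta) +
  \sum_(a < N.-1) \sum_(i < Np a) (1 + up a + vp a) +
  \sum_(a < N.-1) \sum_(b < N.-1 | b == a.+1 :> nat) \sum_(i < Np a) \sum_(j < Np b) (- beta).
(* This power of 1 - q undoes the last pair of [cross_factors]. *)
pose l0 := - \sum_(a < N) vprime_plus vp a * vprime_minus vm a / beta.
have umE a : up a + um a + vp a + vm a +
    beta * (\sum_b cartan R N a b * (M b)%:R) = 2 * beta - 2.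
  have := congr1 (fun x => rform x (simple_root R a)) hal4.
  rewrite !rformD !rformZ rform0 rform_sum hrho -/(up a) -/(um a) -/(vp a) -/(vm a).
  under eq_bigr do rewrite rformZ rform_simple_root mulrC.
  move=> h; lra.
have termE Y : fine (weighted_integral (@half_open_unit R N) (variables Np) (fun=> 0)
      (selberg_weight Np up vp beta) (jack_plus beta Np vp J Y)) *
    fine (weighted_integral (@half_open_unit R N) (variables Nm) (fun=> 0)
      (selberg_weight Nm um vm beta) (jack_minus beta Nm vm J Y)) = C * term Y.
  have plusE : jack_plus beta Np vp J Y = fun x => \prod_(a < N)
      normalized_jack beta J (Y a) (fun k => - rdiff Np x a k - vprime_plus vp a / beta).
    apply/funext => x; apply: eq_bigr => a _; congr (normalized_jack _ _ _ _).
    by apply/funext => k; rewrite mulN1r.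
  have minusE : jack_minus beta Nm vm J Y = fun y => \prod_(a < N)
      normalized_jack beta J (Y a) (fun k => rdiff Nm y a k + vprime_minus vm a / beta).
    apply/funext => x; apply: eq_bigr => a _; congr (normalized_jack _ _ _ _).
    by apply/funext => k; rewrite mul1r.
  rewrite !fine_weighted_integral//; last 4 first.
  - exact: real_measurable_jack_product.
  - exact: bounded_jack_product.
  - exact: real_measurable_jack_product.
  - exact: bounded_jack_product.
  rewrite /term -plusE -minusE mulrACA mulrC -/Sp -/Sm /C.
  have [S0|//] := eqVneq (Sp * Sm) 0.
  rewrite S0 mul0r mul1r /average -/Sp -/Sm mulrACA -invfM S0 invr0 mulr0.
  by [].
have C0 : C != 0 by rewrite /C; case: (eqVneq (Sp * Sm) 0) => // _; exact: oner_neq0.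
exists C, (rform al1 al2 / beta + k0), (rform al2 al3 / beta + l0); split => // q q01.
have /andP[q0 q1] := q01.
have Sp_fin' : (iterated_integral (@half_open_unit R N) (variables Np)
    (EFin \o selberg_weight Np up vp beta) (fun=> 0%R) < +oo)%E by rewrite -selbergE.
have Sm_fin' : (iterated_integral (@half_open_unit R N) (variables Nm)
    (EFin \o selberg_weight Nm um vm beta) (fun=> 0%R) < +oo)%E by rewrite -selbergE.
have [I [ZI cvgI]] := df_series hN hbeta hJ Sp_fin' Sm_fin' q01.
have partialE m : partial_sums q m = C^-1 * series (fun n => q ^+ n *
    \sum_(Y <- tuple_seq N n) C * term Y) m.
  rewrite /partial_sums /series /= mulr_sumr; apply: eq_bigr => n _.
  by rewrite sum_diagram_tuples -!mulr_sumr mulrCA (mulrA C^-1) mulVf// mul1r.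
have cvgp : partial_sums q @ \oo --> C^-1 * I.
  rewrite (funext partialE); apply: cvgMr; under eq_fun do under eq_bigr do rewrite -termE.
  exact: cvgI.
split; first by apply/cvg_ex; exists (C^-1 * I).
rewrite (cvg_lim _ cvgp)// /Z_DF (df_substitution _ _ q01).
have q1' : 0 < 1 - q by rewrite subr_gt0.
rewrite (_ : iterated_integral _ _ _ _ = (q `^ k0 * (1 - q) `^ l0 * I)%:E).
  rewrite -EFinM !gt0_powRD//; congr EFin; field; exact: C0.
rewrite -ZI; apply: eq_iterated_integral => y ry; congr EFin.
have y01 a i : (i < M a)%N -> 0 < y (a, i) <= 1.
  move=> iM; have := ry (a, i); rewrite mem_variables /= iM.
  by rewrite /half_open_unit /= in_itv.
have beta0 : beta != 0 by rewrite gt_eqF.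
rewrite (df_integrand_factor (u := up) (v := vp) (w := vm) hN beta0 q01 y01 umE)//.
rewrite -/k0 -/l0; ring.
Qed.
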